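(* For every $m>0$ and any $f\in C_0(\mathbb R^d)$, $$\big\|(L^{\varepsilon}-m)^{-1}f-(L^0-m)^{-1}f\big\|_{C_0(\mathbb R^d)}\to 0\quad\text{as }\varepsilon\to 0^+ .$$
   Context: Let $d\ge 1$ and $\mathbb T^d=[0,1]^d$ be the unit torus; functions on $\mathbb T^d$ are identified with $\mathbb Z^d$-periodic functions on $\mathbb R^d$. Let $a\in C(\mathbb R^d)$ with $a(x)=a(-x)$, $a(x)\ge 0$, $\int_{\mathbb R^d}a(x)\,dx>0$, and $a(x)\le \frac{C}{1+|x|^{d+\delta}}$ for some constants $C$ and $\delta>2$. Let $\lambda,\mu\in C(\mathbb R^d)$ be $\mathbb Z^d$-periodic with $0<\alpha_1\le\lambda(x),\mu(x)\le\alpha_2<\infty$. $C_0(\mathbb R^d)$ is the Banach space of continuous functions on $\mathbb R^d$ vanishing at infinity, with the sup norm. For $\varepsilon>0$, $L^\varepsilon$ is the bounded operator on $C_0(\mathbb R^d)$ $$(L^{\varepsilon}u)(x)=\frac{1}{\varepsilon^{d+2}}\int_{\mathbb R^d}a\Big(\frac{x-y}{\varepsilon}\Big)\lambda\Big(\frac{x}{\varepsilon}\Big)\mu\Big(\frac{y}{\varepsilon}\Big)\big(u(y)-u(x)\big)\,dy .$$ Let $\varkappa_1=(\varkappa_1^1,\dots,\varkappa_1^d)\in (L^2(\mathbb T^d))^d$ be the periodic solution, with zero average of each component over $\mathbb T^d$, of $$\int_{\mathbb R^d}a(\xi-q)\mu(q)\big(\varkappa_1(q)-\varkappa_1(\xi)\big)\,dq=\int_{\mathbb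 R^d}a(\xi-q)(\xi-q)\mu(q)\,dq,\qquad \xi\in\mathbb T^d .$$ The constant matrix $\Theta=\{\Theta^{ij}\}$ is defined by $$\Theta^{ij}\int_{\mathbb T^d}\frac{\mu(\xi)}{\lambda(\xi)}\,d\xi=\int_{\mathbb T^d}\int_{\mathbb R^d}\tfrac12(\xi-q)^i(\xi-q)^ja(\xi-q)\mu(q)\mu(\xi)\,dq\,d\xi-\int_{\mathbb T^d}\int_{\mathbb R^d}a(\xi-q)\mu(q)\mu(\xi)(\xi-q)^i\varkappa_1^j(q)\,dq\,d\xi ;$$ it is positive definite (only its symmetric part matters below). $L^0=\sum_{i,j}\Theta^{ij}\frac{\partial^2}{\partial x^i\partial x^j}$ is regarded as an operator in $C_0(\mathbb R^d)$ (the closure in $C_0(\mathbb R^d)$ of this operator defined on the Schwartz space $\mathcal S(\mathbb R^d)$, which is a core). *)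

(* Defs.v *)
From HB Require Import structures.
From mathcomp Require Import all_boot all_order all_algebra.
From mathcomp Require Import all_classical all_reals all_analysis.

Set Implicit Arguments.
Unset Strict Implicit.
Unset Printing Implicit Defensive.
Import Order.TTheory GRing.Theory Num.Theory.
Import numFieldNormedType.Exports.

Local Open Scope classical_set_scope.
Local Open Scope ring_scope.

(* The library has no Lebesgue measure on R^n.  The points of R^n are the row
   vectors 'rV[R]_n, measurable for the sigma-algebra generated by the
   coordinates (which is the Borel sigma-algebra), and the measure is the
   n-fold product of the Lebesgue measure on R. *)
Definition rV_display : measure_display -> measure_display.
Proof. exact. Qed.

Section measurable_rV.
Context (R : realType) (n : nat).

Let coors : 'I_n -> 'rV[R]_n -> R := fun i x => x ord0 i.

Let rV_set0 : g_sigma_preimage coors set0.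
Proof. exact: sigma_algebra0. Qed.

Let rV_setC A : g_sigma_preimage coors A -> g_sigma_preimage coors (~` A).
Proof. exact: sigma_algebraC. Qed.

Let rV_bigcup (F : _^nat) : (forall i, g_sigma_preimage coors (F i)) ->
  g_sigma_preimage coors (\bigcup_i (F i)).
Proof. exact: sigma_algebra_bigcup. Qed.

HB.instance Definition _ := @isMeasurable.Build
  (rV_display default_measure_display)
  'rV[R]_n (g_sigma_preimage coors) rV_set0 rV_setC rV_bigcup.

End measurable_rV.

Section measurable_rV_theory.
Context d (T : measurableType d) (R : realType).

Lemma measurable_coord n (i : 'I_n) :
  measurable_fun [set: 'rV[R]_n] (fun x : 'rV[R]_n => x ord0 i).
Proof.
move=> _ Y mY; rewrite setTI; apply: sub_sigma_algebra => /=.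
rewrite -bigcup_seq/=; exists i => /=; first by rewrite mem_index_enum.
by exists Y => //; rewrite setTI.
Qed.

Lemma measurable_fun_coordP n (f : T -> 'rV[R]_n) :
  measurable_fun [set: T] f <->
  forall i, measurable_fun [set: T] (fun t => f t ord0 i).
Proof.
split=> [mf i|mf].
  exact: (measurableT_comp (measurable_coord i) mf).
apply: (measurability
  (\big[setU/set0]_(i < n) preimage_set_system setT
     (fun x : 'rV[R]_n => x ord0 i) measurable)) => //.
move=> _ [A + <-]; rewrite -bigcup_seq/= => -[i _ [B mB <-]].
by rewrite setTI [X in measurable X](_ : _ = setT `&` (fun t => f t ord0 i) @^-1` B);
  [exact: mf|rewrite !setTI].
Qed.

End measurable_rV_theory.

Section rV_cons.
Context (R : realType) (n : nat).

Definition rV_cons (p : measurableTypeR R * 'rV[R]_n) : 'rV[R]_n.+1 :=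
  \row_i oapp (fun j => p.2 ord0 j) p.1 (unlift ord0 i).

Definition rV_uncons (x : 'rV[R]_n.+1) : measurableTypeR R * 'rV[R]_n :=
  (x ord0 ord0, \row_j x ord0 (lift ord0 j)).

Lemma rV_cons0 p : rV_cons p ord0 ord0 = p.1.
Proof. by rewrite mxE unlift_none. Qed.

Lemma rV_consS p j : rV_cons p ord0 (lift ord0 j) = p.2 ord0 j.
Proof. by rewrite mxE liftK. Qed.

Lemma rV_consK : cancel rV_cons rV_uncons.
Proof.
move=> [r x]; rewrite /rV_uncons rV_cons0; congr (_, _).
by apply/rowP => j; rewrite mxE rV_consS.
Qed.

Lemma measurable_rV_cons : measurable_fun setT rV_cons.
Proof.
apply/measurable_fun_coordP => i; have [j|] := @unliftP _ ord0 i => ->; last first.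
  by under eq_fun do rewrite rV_cons0; exact: measurable_fst.
under eq_fun do rewrite rV_consS.
exact: (measurableT_comp (measurable_coord j) measurable_snd).
Qed.

Lemma measurable_rV_uncons : measurable_fun setT rV_uncons.
Proof.
apply: measurable_fun_pair; first exact: measurable_coord.
apply/measurable_fun_coordP => i; under eq_fun do rewrite mxE.
exact: measurable_coord.
Qed.

HB.instance Definition _ :=
  isMeasurableFun.Build _ _ _ _ rV_cons measurable_rV_cons.

Section lebesgue_rV_cons.
Local Open Scope ereal_scope.
Variable mu : {sigma_finite_measure set 'rV[R]_n -> \bar R}.

Definition lebesgue_rV_cons : set 'rV[R]_n.+1 -> \bar R :=
  pushforward (@lebesgue_measure R \x mu) rV_cons.

Let cons0 : lebesgue_rV_cons set0 = 0. Proof. exact: measure0. Qed.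

Let cons_ge0 A : 0 <= lebesgue_rV_cons A. Proof. exact: measure_ge0. Qed.

Let cons_sigma_additive : semi_sigma_additive lebesgue_rV_cons.
Proof. exact: measure_semi_sigma_additive. Qed.

HB.instance Definition _ := isMeasure.Build _ _ _ lebesgue_rV_cons
  cons0 cons_ge0 cons_sigma_additive.

Lemma lebesgue_rV_consX A B : measurable A -> measurable B ->
  lebesgue_rV_cons (rV_uncons @^-1` (A `*` B)) = @lebesgue_measure R A * mu B.
Proof.
move=> mA mB; rewrite -product_measure1E// /lebesgue_rV_cons /pushforward.
by rewrite -comp_preimage (_ : _ \o _ = idfun)//; apply/funext/rV_consK.
Qed.

Let cons_sigma_finite : sigma_finite setT lebesgue_rV_cons.
Proof.
have /sigma_finiteP[F [FT ndF Foo]] := sigma_finiteT (@lebesgue_measure R).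
have /sigma_finiteP[G [GT ndG Goo]] := sigma_finiteT mu.
exists (fun k => rV_uncons @^-1` (F k `*` G k)).
  rewrite -preimage_bigcup (_ : \bigcup_i _ = setT) ?preimage_setT//.
  rewrite -setXTT FT GT predeqE => -[x y]; split.
    by move=> [i _ []/= ? ?]; split; exists i.
  move=> [/= [i _ Fix] [k _ Gky]]; exists (maxn i k) => //; split.
  - by move: x Fix; exact/subsetPset/ndF/leq_maxl.
  - by move: y Gky; exact/subsetPset/ndG/leq_maxr.
move=> k; have [mF ?] := Foo k; have [mG ?] := Goo k; split.
  rewrite -[X in measurable X]setTI; apply: measurable_rV_uncons => //.
  exact: measurableX.
by rewrite lebesgue_rV_consX// lte_mul_pinfty// ge0_fin_numE.
Qed.

HB.instance Definition _ :=
  Measure_isSigmaFinite.Build _ _ _ lebesgue_rV_cons cons_sigma_finite.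

End lebesgue_rV_cons.

End rV_cons.

Fixpoint lebesgue_rV (R : realType) (n : nat) :
    {sigma_finite_measure set 'rV[R]_n -> \bar R} :=
  match n with
  | 0 => dirac (0 : 'rV[R]_0)
  | n'.+1 => lebesgue_rV_cons (lebesgue_rV R n')
  end.

Lemma lebesgue_rV_box (R : realType) (n : nat) (A : 'I_n -> set R) :
  (forall i, measurable (A i)) ->
  (lebesgue_rV R n [set x | forall i, A i (x ord0 i)] =
   \prod_(i < n) @lebesgue_measure R (A i))%E.
Proof.
elim: n A => [|n IHn] A mA.
  by rewrite big_ord0 /= diracE mem_set//=; case.
rewrite big_ord_recl -IHn//= -lebesgue_rV_consX; [|exact: mA|].
  congr lebesgue_rV_cons; apply/seteqP; split=> x /=.
    by move=> Ax; split=> //= i; rewrite mxE.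
  move=> [Ar Ax] i; have [j|] := @unliftP _ ord0 i => -> //.
  by have := Ax j; rewrite mxE.
rewrite [X in measurable X](_ : _ = \bigcap_(i in [set: 'I_n])
  ((fun x : 'rV[R]_n => x ord0 i) @^-1` A (lift ord0 i))); last first.
  by apply/seteqP; split=> x /= Ax i; [move=> _|]; exact: Ax.
apply: fin_bigcap_measurable => // i _.
by rewrite -[X in measurable X]setTI; exact: measurable_coord.
Qed.

Section C0.
Context (R : realType) (d : nat).

Definition vanishing_at_infinity (u : 'rV[R]_d -> R) :=
  forall e : R, 0 < e -> exists M : R, forall x, M < `|x| -> `|u x| < e.

Definition C0_pred : {pred ('rV[R]_d -> R)} :=
  fun u => `[< continuous u /\ vanishing_at_infinity u >].

Lemma C0_submod_closed : submod_closed C0_pred.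
Proof.
split.
  apply/asboolP; split; first exact: cst_continuous.
  by move=> e e0; exists 0 => x _; rewrite normr0.
move=> k u v /asboolP[cu u0] /asboolP[cv v0]; apply/asboolP; split.
  by move=> x; apply: continuousD; [exact/continuousZl_tmp/cu|exact: cv].
move=> e e0.
have k0 : 0 < 2 * (`|k| + 1) by rewrite mulr_gt0// ltr_wpDl.
have [M uM] := u0 _ (divr_gt0 e0 k0).
have [N vN] := v0 _ (divr_gt0 e0 (ltr0Sn R 1)).
exists (Num.max M N) => x; rewrite gt_max => /andP[/uM ux /vN vx].
rewrite [e]splitr (le_lt_trans (ler_normD _ _))// ltrD// normrZ.
rewrite (@le_lt_trans _ _ (`|k| * (e / (2 * (`|k| + 1)))))//.
  by rewrite ler_wpM2l// ltW.
rewrite mulrA ltr_pdivrMr// mulrA divfK ?pnatr_eq0// mulrC.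
by rewrite ltr_pM2l// ltrDl.
Qed.

HB.instance Definition _ :=
  GRing.isSubmodClosed.Build R ('rV[R]_d -> R) C0_pred C0_submod_closed.

Record C0 := MkC0 { C0_fun :> 'rV[R]_d -> R ; _ : C0_fun \in C0_pred }.

HB.instance Definition _ := [isSub for C0_fun].
HB.instance Definition _ := [Choice of C0 by <:].
HB.instance Definition _ := [SubChoice_isSubLmodule of C0 by <:].


Lemma C0_continuous (u : C0) : continuous u.
Proof. by case: u => u /= /asboolP[]. Qed.

Lemma C0_vanishing (u : C0) : vanishing_at_infinity u.
Proof. by case: u => u /= /asboolP[]. Qed.

Definition C0_norm (u : C0) : R := sup (range (fun x => `|u x|)).

Lemma C0_bounded (u : C0) : has_ubound (range (fun x => `|u x|)).
Proof.
have [M uM] := C0_vanishing u ltr01.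
pose K := [set x : 'rV[R]_d | `|x| <= M].
have cK : compact K.
  apply: bounded_closed_compact.
    by exists M; split; [exact: num_real|move=> N MN x /= /le_trans; apply;
      exact: ltW].
  rewrite (_ : K = closed_ball_ Num.norm 0 M); first exact: closed_closed_ball_.
  by apply/seteqP; split=> x; rewrite /K /closed_ball_/= sub0r normrN.
have : bounded_set ((fun x => u x) @` K).
  apply: compact_bounded; apply: continuous_compact => //.
  by apply: continuous_subspaceT; exact: C0_continuous.
move=> [N [_ /(_ (N + 1))]]; rewrite ltrDl ltr01 => /(_ isT) uN.
exists (Num.max 1 (N + 1)) => _ [x _ <-]; rewrite le_max.
have [/uM/ltW -> //|xM] := ltP M `|x|.
by rewrite [X in _ || X]uN ?orbT//; exists x.
Qed.

Lemma C0_norm_ge (u : C0) x : `|u x| <= C0_norm u.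
Proof. by apply: ub_le_sup; [exact: C0_bounded|exists x]. Qed.

Lemma C0_norm_le (u : C0) c : (forall x, `|u x| <= c) -> C0_norm u <= c.
Proof.
move=> uc; apply: ge_sup; first by exists `|u 0|, 0.
by move=> _ [x _ <-].
Qed.

Lemma C0_normD u v : C0_norm (u + v) <= C0_norm u + C0_norm v.
Proof.
apply: C0_norm_le => x; apply: (le_trans (ler_normD _ _)).
by apply: lerD; exact: C0_norm_ge.
Qed.

Lemma C0_normZ (k : R) u : C0_norm (k *: u) = `|k| * C0_norm u.
Proof.
have le_normZ c v : C0_norm (c *: v) <= `|c| * C0_norm v.
  apply: C0_norm_le => x; rewrite [X in `|X|](_ : _ = c * v x)// normrM.
  by rewrite ler_wpM2l// C0_norm_ge.
apply/eqP; rewrite eq_le le_normZ/=.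
have [->|k0] := eqVneq k 0.
  by rewrite normr0 mul0r (le_trans _ (C0_norm_ge _ 0)).
rewrite -ler_pdivlMl ?normr_gt0// -normfV.
by rewrite -[in leLHS](scalerK k0 u) le_normZ.
Qed.

Lemma C0_norm0_eq0 u : C0_norm u = 0 -> u = 0.
Proof.
move=> u0; apply/val_inj/funext => x /=; apply/eqP.
by rewrite -normr_le0 -u0 C0_norm_ge.
Qed.

HB.instance Definition _ :=
  Lmodule_isNormed.Build R C0 C0_normD C0_normZ C0_norm0_eq0.

End C0.

(* A possibly unbounded operator in E is given by its graph A : set (E * E).
   (u, f) is in shift_op A m iff u is in the domain and (A - m) u = f, so
   [resolvent A m] is (A - m)^-1; it takes the default value 0 where A - m is
   not onto, hence is meaningful only when [in_resolvent_set A m] holds. *)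
Section resolvent.
Context (R : realType) (E : normedModType R).
Implicit Types (A : set (E * E)) (m : R).

Definition shift_op A m : set (E * E) := [set p : E * E | A (p.1, p.2 + m *: p.1)].

Definition in_resolvent_set A m :=
  (forall f, exists! u, shift_op A m (u, f)) /\
  (exists M : R, forall u f, shift_op A m (u, f) -> `|u| <= M * `|f|).

Definition resolvent A m (f : E) : E := xget 0 [set u | shift_op A m (u, f)].

End resolvent.

Section homogenization.
Context (R : realType) (d : nat).
Local Notation Rd := 'rV[R]_d.
Local Notation leb := (lebesgue_rV R d).

Definition torus : set Rd := [set x | forall i, 0 <= x ord0 i <= 1].

Definition Zd_periodic (f : Rd -> R) :=
  forall (z : 'rV[int]_d) (x : Rd), f (x + map_mx intr z) = f x.

(* The norm of 'rV[R]_d in the library is the sup norm. *)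
Definition enorm (x : Rd) : R := Num.sqrt (\sum_i x ord0 i ^+ 2).

Definition partial (i : 'I_d) (f : Rd -> R) : Rd -> R :=
  'D_(delta_mx ord0 i : Rd) f.

Definition partials (s : seq 'I_d) (f : Rd -> R) : Rd -> R :=
  foldr partial f s.

Definition schwartz (f : Rd -> R) := forall s : seq 'I_d,
  (forall x, differentiable (partials s f) x) /\
  (forall k : nat, exists M : R, forall x, enorm x ^+ k * `|partials s f x| <= M).

(* The domain of L_eps is the set of the u in C_0 such that the right-hand side
   is in C_0. *)
Definition L_eps (a lam mu : Rd -> R) (eps : R) : set (C0 R d * C0 R d) :=
  [set p : C0 R d * C0 R d | forall x : Rd, p.2 x = (eps ^+ (d + 2))^-1 *
     \int[leb]_y (a (eps^-1 *: (x - y)) * lam (eps^-1 *: x) *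
                  mu (eps^-1 *: y) * (p.1 y - p.1 x))].

Definition L0_core (Theta : 'M[R]_d) : set (C0 R d * C0 R d) :=
  [set p : C0 R d * C0 R d | schwartz p.1 /\ forall x : Rd,
     p.2 x = \sum_i \sum_j Theta i j * partial i (partial j p.1) x].

Definition L0 (Theta : 'M[R]_d) : set (C0 R d * C0 R d) :=
  closure (L0_core Theta).

(* An element of L^2(T^d) is a class of functions, so the equation is required
   for almost every xi. *)
Definition is_corrector (a mu : Rd -> R) (kappa : 'I_d -> Rd -> R) :=
  (forall i, [/\ Zd_periodic (kappa i), measurable_fun setT (kappa i),
     leb.-integrable torus (fun x => (kappa i x ^+ 2)%:E) &
     \int[leb]_(x in torus) kappa i x = 0]) /\
  {ae leb, forall xi, torus xi -> forall i,
     \int[leb]_q (a (xi - q) * mu q * (kappa i q - kappa i xi)) =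
     \int[leb]_q (a (xi - q) * (xi - q) ord0 i * mu q)}.

Definition is_effective_matrix (a lam mu : Rd -> R) (kappa : 'I_d -> Rd -> R)
    (Theta : 'M[R]_d) := forall i j : 'I_d,
  Theta i j * \int[leb]_(xi in torus) (mu xi / lam xi) =
    \int[leb]_(xi in torus) \int[leb]_q (2^-1 * (xi - q) ord0 i *
       (xi - q) ord0 j * a (xi - q) * mu q * mu xi) -
    \int[leb]_(xi in torus) \int[leb]_q (a (xi - q) * mu q * mu xi *
       (xi - q) ord0 i * kappa j q).

End homogenization.

(* Main.v *)
Require Import Defs.
From HB Require Import structures.
From mathcomp Require Import all_boot all_order all_algebra.
From mathcomp Require Import all_classical all_reals all_analysis.
From mathcomp Require Import measurable_realfun real_interval ring lra.

(* L^eps is dissipative and, written with its jump rate, its resolvent equation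
   is the fixed point equation of a contraction of C_0.  The two-scale ansatz
     u_eps = u + eps k1(x/eps) . Du + eps^2 chi(x/eps) : D^2 u
   for Schwartz u gives (u_eps, L^eps u_eps) -> (u, L^0 u) as soon as k1 solves
   the first cell problem exactly and chi solves the second one up to a small
   error; such a chi is a finite Neumann sum, because the Markov operator on the
   torus with kernel a(x - y) mu(y) satisfies a Doeblin condition.  Hence L^0
   inherits dissipativity, and the Trotter-Kato argument reduces the theorem to
   the density of the range of L^0 - m on Schwartz functions.  The matrix Theta
   is positive semidefinite by a minimum principle for the cell problem, so its
   symmetric part is a sum of squares w w^T, and the resolvent of the random
   walk with steps +-hw, which commutes with derivatives, solves
   (m - L^0) u = g up to O(h) for any Schwartz g. *)

Set Implicit Arguments.
Unset Strict Implicit.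
Unset Printing Implicit Defensive.
Import Order.TTheory GRing.Theory Num.Theory.
Import numFieldNormedType.Exports.
Local Open Scope classical_set_scope.
Local Open Scope ring_scope.

(** * Lebesgue measure on R^d *)

(** The generator divides by [eps ^ 2], so a residual in the first cell problem is magnified by
    [1 / eps], while one in the second keeps its size. The first corrector therefore has to be exact
    at every point: the given square-integrable solution is replaced by the continuous function that
    its own equation produces by convolution. The second tolerates an error fixed before [eps] tends
    to 0, which is why decay of oscillations under the Markov chain can stand in for a Fredholm
    theory. Its solvability condition is precisely the formula that defines [Theta]. The third
    moment of the kernel may be infinite, so third-order Taylor remainders are interpolated with
    second-order ones before they are integrated. On the side of the limit, the finite-difference
    resolvent obeys a maximum principle with a constant free of the step; commutation passes this
    bound on to the third derivatives, which control the consistency error. *)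

Section rV_norm.
Context (R : realType) (n : nat).
Implicit Types x : 'rV[R]_n.

Lemma rV_norm_le x (c : R) : 0 <= c -> (forall i, `|x ord0 i| <= c) -> `|x| <= c.
Proof.
move=> c0 xc; rewrite /(`|x|)/= mx_normrE; apply: bigmax_le => // -[i j] _ /=.
by rewrite (ord1 i).
Qed.

Lemma rV_norm_coord x i : `|x ord0 i| <= `|x|.
Proof.
rewrite /(`|x|)/= mx_normrE.
exact: (le_bigmax _ (fun ij : 'I_1 * 'I_n => `|x ij.1 ij.2|) (ord0, i)).
Qed.

(** The sigma-algebra is generated by coordinates, so open sets are not measurable by definition.
    Rounding each coordinate down to a multiple of [1 / (k + 1)] gives functions with countably many
    values on measurable cells, and [f] is the pointwise limit of its compositions with these
    roundings. *)
Lemma measurable_fun_rV_continuous (f : 'rV[R]_n -> R) :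
  continuous f -> measurable_fun [set: 'rV[R]_n] f.
Proof.
move=> cf.
pose ro k (x : 'rV[R]_n) : 'rV[R]_n :=
  \row_i ((Num.floor (x ord0 i * k.+1%:R))%:~R / k.+1%:R).
have mfl (i : 'I_n) (k : nat) (z : int) :
    measurable [set x : 'rV[R]_n | Num.floor (x ord0 i * k.+1%:R) = z].
  rewrite [X in measurable X](_ : _ = [set: 'rV[R]_n] `&`
      (fun x : 'rV[R]_n => x ord0 i) @^-1` `[z%:~R / k.+1%:R, (z + 1)%:~R / k.+1%:R[).
    by apply: measurable_coord => //; exact: measurable_itv.
  rewrite setTI; apply/seteqP; split => x /=.
    move=> <-; rewrite in_itv/= ler_pdivrMr// ltr_pdivlMr//.
    exact: floor_itv.
  rewrite in_itv/= ler_pdivrMr// ltr_pdivlMr// => xz.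
  exact: floor_def.
apply: (measurable_fun_cvg (h := fun k => f \o ro k)).
  move=> k _ Y mY; rewrite setTI.
  rewrite [X in measurable X](_ : _ = \bigcup_(z in [set: 'rV[int]_n])
     (if `[< Y (f (\row_i ((z ord0 i)%:~R / k.+1%:R))) >] then
       [set x : 'rV[R]_n | forall i, Num.floor (x ord0 i * k.+1%:R) = z ord0 i]
      else set0)).
    apply: countable_bigcupT_measurable => // z; case: ifPn => // _.
    rewrite [X in measurable X](_ : _ = \bigcap_(i in [set: 'I_n])
      [set x : 'rV[R]_n | Num.floor (x ord0 i * k.+1%:R) = z ord0 i]).
      apply: fin_bigcap_measurable => // i _; exact: mfl.
    by apply/seteqP; split => x /= xz i; [move=> _|]; exact: xz.
  apply/seteqP; split => x /=.
    move=> Yx; exists (\row_i Num.floor (x ord0 i * k.+1%:R)) => //.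
    case: asboolP => [_ i|nY]; first by rewrite mxE.
    case: nY; move: Yx; congr (Y (f _)).
    by apply/rowP => i; rewrite !mxE.
  move=> [z _]; case: asboolP => // Yz xz; move: Yz; congr (Y (f _)).
  by apply/rowP => i; rewrite !mxE xz.
move=> x _; apply: continuous_cvg; first exact: cf.
apply/cvgrPdist_le => e e0.
have [N _ HN] := near_infty_natSinv_lt (PosNum e0).
exists N => // k Nk /=; apply: rV_norm_le; first exact: ltW.
move=> i; rewrite !mxE; have := HN _ Nk => /= ke.
have := floor_itv (x ord0 i * k.+1%:R); rewrite intrD => /andP[l1 l2].
rewrite ger0_norm ?subr_ge0 ?ler_pdivrMr//.
apply: le_trans (ltW ke); rewrite lerBlDr.
by rewrite -[X in X + _]mul1r -mulrDl ler_pdivlMr// addrC ltW.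
Qed.

End rV_norm.

Section affine_lebesgue.
Context (R : realType).

Local Notation leb1 := (@lebesgue_measure R).

Definition affine_map (s r : R) (x : measurableTypeR R) : measurableTypeR R :=
  s + r * x.

Lemma measurable_affine_map s r : measurable_fun setT (affine_map s r).
Proof. by apply: measurable_funD => //; apply: measurable_funM. Qed.

HB.instance Definition _ s r :=
  isMeasurableFun.Build _ _ _ _ (affine_map s r) (measurable_affine_map s r).

(** Both sides are measures in [A], so by uniqueness they need only be compared on intervals []a,
    b]]; a negative [r] moves the closed end to the other side. *)
Lemma lebesgue_measure_affine (s r : R) (A : set R) : (r != 0)%R -> measurable A ->
  (leb1 A = `|r|%:E * leb1 ((fun x => s + r * x)%R @^-1` A))%E.
Proof.
move=> r0 mA.
have nr0 : (0 <= `|r|)%R by [].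
have -> : (`|r|%:E * leb1 (affine_map s r @^-1` A))%E = mscale (NngNum nr0) (pushforward leb1 (affine_map s r)) A by [].
apply: lebesgue_measure_unique mA => X [[a b] /= _ <-].
rewrite lebesgue_measure_itv /=; rewrite [RHS](_ : _ = (`|r|%:E * leb1 (affine_map s r @^-1` `]a, b]))%E)//.
have [ab|ab] := ltP a b; last first.
  rewrite (_ : affine_map s r @^-1` _ = set0) ?measure0 ?mule0//.
    by case: ifPn => //; rewrite lte_fin ltNge ab.
  apply/seteqP; split => // x /=; rewrite in_itv/= => /andP[ax xb].
  by move: (lt_le_trans ax xb); rewrite ltNge ab.
rewrite lte_fin ab.
have [rp|rn|/eqP] := ltrgtP 0%R r; last by rewrite eq_sym (negbTE r0).
  rewrite (_ : affine_map s r @^-1` _ = `](a - s) / r, (b - s) / r]%classic); last first.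
    apply/seteqP; split=> x; rewrite /affine_map/= !in_itv/= ltr_pdivrMr// ler_pdivlMr//;
    by rewrite ltrBlDl lerBrDl (mulrC x).
  rewrite lebesgue_measure_itv/= lte_fin ltr_pM2r ?invr_gt0// ltrD2r ab.
  rewrite -!EFinB -EFinM gtr0_norm//; congr (_%:E)%E; field.
  by rewrite gt_eqF.
rewrite (_ : affine_map s r @^-1` _ = `[(b - s) / r, (a - s) / r[%classic); last first.
  apply/seteqP; split=> x; rewrite /affine_map/= !in_itv/= ltr_ndivlMr// ler_ndivrMr//;
  by rewrite ltrBlDl lerBrDl (mulrC x) andbC.
rewrite lebesgue_measure_itv/= lte_fin ltr_nM2r ?invr_lt0// ltrD2r ab.
rewrite -!EFinB -EFinM ltr0_norm//; congr (_%:E)%E; field.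
by rewrite lt_eqF.
Qed.

Lemma integral_affine (s r : R) (f : R -> \bar R) : (r != 0)%R ->
  measurable_fun setT f -> (forall x, 0 <= f x)%E ->
  (\int[leb1]_x f x = `|r|%:E * \int[leb1]_x f (s + r * x)%R)%E.
Proof.
move=> r0 mf f0.
have nr0 : 0 <= `|r| by [].
have mphi := measurable_affine_map s r.
have := @ge0_integral_pushforward _ _ _ _ _ _ mphi leb1 setT f measurableT mf (fun x _ => f0 x).
rewrite preimage_setT => <-.
rewrite -(ge0_integral_mscale _ _ (NngNum nr0))//.
by apply: eq_measure_integral => A mA _; exact: lebesgue_measure_affine.
Qed.

End affine_lebesgue.

Section integral_rV.
Context (R : realType).
Local Notation leb1 := (@lebesgue_measure R).

Lemma integral_rV_cons n (f : 'rV[R]_n.+1 -> \bar R) :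
  measurable_fun setT f -> (forall x, 0 <= f x)%E ->
  (\int[lebesgue_rV R n.+1]_x f x =
   \int[leb1]_t \int[lebesgue_rV R n]_x f (rV_cons (t, x)))%E.
Proof.
move=> mf f0.
have mc := @measurable_rV_cons R n.
transitivity (\int[(leb1 \x lebesgue_rV R n)%E]_z f (rV_cons z))%E.
  have := @ge0_integral_pushforward _ _ _ _ _ _ mc (leb1 \x lebesgue_rV R n)%E
    setT f measurableT mf (fun x _ => f0 x).
  rewrite preimage_setT => <-.
  exact: eq_measure_integral.
rewrite (fubini_tonelli1 (f \o @rV_cons R n))//; last by move=> x; exact: f0.
exact: measurableT_comp.
Qed.

Lemma measurable_fun_rV_cons n d' (T : measurableType d') (f : 'rV[R]_n.+1 -> \bar R)
    (g : T -> R) (h : T -> 'rV[R]_n) :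
  measurable_fun setT f -> measurable_fun setT g -> measurable_fun setT h ->
  measurable_fun setT (fun t => f (rV_cons (g t, h t))).
Proof.
move=> mf mg mh.
apply: (measurableT_comp mf); apply: (measurableT_comp (@measurable_rV_cons R n)).
exact: measurable_fun_pair.
Qed.

Lemma measurable_rV_affine n (s : 'rV[R]_n) (r : R) :
  measurable_fun setT (fun x : 'rV[R]_n => s + r *: x).
Proof.
apply/measurable_fun_coordP => i; under eq_fun do rewrite !mxE.
by apply: measurable_funD => //; apply: measurable_funM => //; exact: measurable_coord.
Qed.

Lemma rV_cons_affine n (s : 'rV[R]_n.+1) (r t : R) (x : 'rV[R]_n) :
  s + r *: rV_cons (t, x) =
  rV_cons (s ord0 ord0 + r * t, \row_j s ord0 (lift ord0 j) + r *: x).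
Proof.
apply/rowP => i; have [j|] := @unliftP _ ord0 i => ->; rewrite !(mxE, rV_cons0)//;
by rewrite ?unlift_none//= ?liftK//= !mxE.
Qed.

Lemma measurable_fun_int_rV_cons n (f : 'rV[R]_n.+1 -> \bar R) :
  measurable_fun setT f -> (forall x, 0 <= f x)%E ->
  measurable_fun [set: measurableTypeR R]
    (fun t => \int[lebesgue_rV R n]_x f (rV_cons (t, x)))%E.
Proof.
move=> mf f0.
apply: (measurable_fun_fubini_tonelli_F (f \o @rV_cons R n)) => //; last by move=> x; exact: f0.
by apply: measurableT_comp => //; exact: measurable_rV_cons.
Qed.

(** Tonelli splits off the first coordinate, and each coordinate contributes one factor [|r|]; the
    translation vector is split along with the variable, hence the generalisation over [s] in the
    induction. *)
Lemma integral_rV_affine n (s : 'rV[R]_n) (r : R) (f : 'rV[R]_n -> \bar R) : r != 0 ->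
  measurable_fun setT f -> (forall x, 0 <= f x)%E ->
  (\int[lebesgue_rV R n]_x f x =
   (`|r| ^+ n)%:E * \int[lebesgue_rV R n]_x f (s + r *: x)%R)%E.
Proof.
move=> r0; elim: n s f => [|n IHn] s f mf f0.
  rewrite expr0 mul1e; apply: eq_integral => x _; congr f.
  by rewrite !thinmx0.
rewrite !integral_rV_cons//; last exact: measurableT_comp (measurable_rV_affine s r).
under [in RHS]eq_integral do under eq_integral do rewrite rV_cons_affine.
pose F t := (\int[lebesgue_rV R n]_x f (rV_cons (t, x)))%E.
rewrite -[LHS]/(\int[leb1]_t F t)%E (integral_affine (s ord0 ord0) r0); last 2 first.
- exact: measurable_fun_int_rV_cons.
- by move=> x; exact: integral_ge0.
rewrite /F.
rewrite exprS EFinM -muleA; congr (_ * _)%E.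
rewrite -ge0_integralZl//; last 2 first.
- under eq_fun do under eq_integral do rewrite -(rV_cons_affine s r).
  apply: (measurable_fun_int_rV_cons (f := fun x => f (s + r *: x))) => //.
  exact: measurableT_comp (measurable_rV_affine s r).
- by move=> x _; exact: integral_ge0.
apply: eq_integral => t _.
rewrite (IHn (\row_j s ord0 (lift ord0 j)) (fun x => f (rV_cons (s ord0 ord0 + r * t, x))))//.
exact: measurable_fun_rV_cons.
Qed.

End integral_rV.

Section periodic_integral.
Context (R : realType).
Local Notation leb1 := (@lebesgue_measure R).

Lemma integral_shift (s : R) (A : set R) (f : R -> \bar R) : measurable A ->
  measurable_fun setT f -> (forall x, 0 <= f x)%E ->
  (\int[leb1]_(x in A) f x =
   \int[leb1]_(x in [set x | A (s + x)%R]) f (s + x)%R)%E.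
Proof.
move=> mA mf f0; rewrite integral_mkcond (integral_affine s (oner_neq0 R)); last 2 first.
- by apply/(measurable_restrictT _ _).1 => //; exact: measurable_funTS.
- by move=> x; apply: erestrict_ge0.
rewrite normr1 mul1e [RHS]integral_mkcond; apply: eq_integral => x _.
rewrite mul1r !patchE; congr (if _ then _ else _).
Qed.

Lemma integral_itvcoS (a b c : R) (f : R -> \bar R) : (a <= b)%R -> (b <= c)%R ->
  measurable_fun setT f -> (forall x, 0 <= f x)%E ->
  (\int[leb1]_(x in `[a, c[) f x =
   \int[leb1]_(x in `[a, b[) f x + \int[leb1]_(x in `[b, c[) f x)%E.
Proof.
move=> ab bc mf f0; rewrite -ge0_integral_setU//.
- by congr (integral _ _ _); rewrite -itv_bndbnd_setU ?bnd_simp.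
- exact: measurable_funTS.
- apply/disj_setPS => x [/=]; rewrite !in_itv/= => /andP[_ xb] /andP[bx _].
  by move: (lt_le_trans xb bx); rewrite ltxx.
Qed.

Lemma integral_itv_periodic (s : R) (n : nat) (f : R -> \bar R) :
  (forall (k : int) x, f (x + k%:~R) = f x) ->
  measurable_fun setT f -> (forall x, 0 <= f x)%E ->
  (\int[leb1]_(x in `[s, (s + n%:R)%R]) f x =
   n%:R%:E * \int[leb1]_(x in `[0%R, 1%R]) f x)%E.
Proof.
move=> fper mf f0.
have shiftk (a b : R) (k : int) : (\int[leb1]_(x in `[(a + k%:~R)%R, (b + k%:~R)%R[) f x =
    \int[leb1]_(x in `[a, b[) f x)%E.
  rewrite (integral_shift k%:~R)//; transitivity (\int[leb1]_(x in `[a, b[) f (k%:~R + x)%R)%E.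
    congr (integral _ _ _); apply/seteqP; split=> x/=;
    by rewrite !in_itv/= (addrC k%:~R) lerD2r ltrD2r.
  by apply: eq_integral => x _; rewrite addrC fper.
(* Cut at the integer [k + 1], where [k] is the floor of [u]: moved back by 1, the right piece
   completes the left one to [[k, k + 1[]. *)
have I1 u : (\int[leb1]_(x in `[u, (u + 1)%R[) f x = \int[leb1]_(x in `[0%R, 1%R[) f x)%E.
  have := floor_itv u; set k := Num.floor u; rewrite intrD => /andP[ku uk].
  rewrite (@integral_itvcoS _ (k%:~R + 1))//; [|exact: ltW|by rewrite lerD2r].
  rewrite (shiftk k%:~R u 1%Z) addeC -integral_itvcoS//; last exact: ltW.
  by rewrite -(shiftk 0 1 k) add0r (addrC 1).
rewrite -integral_itv_bndo_bndc; last exact: measurable_funTS.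
rewrite -[in RHS]integral_itv_bndo_bndc; last exact: measurable_funTS.
elim: n => [|n IHn]; first by rewrite addr0 set_itvco0 integral_set0 mul0e.
rewrite (@integral_itvcoS _ (s + n%:R))// ?lerDl ?lerD2l ?ler_nat//.
rewrite IHn -natr1 (addrA s) I1 EFinD ge0_muleDl ?lee_fin//.
by rewrite mul1e.
Qed.

Definition box n (s : 'rV[R]_n) (k : nat) : set 'rV[R]_n :=
  [set x | forall i, s ord0 i <= x ord0 i <= s ord0 i + k%:R].

Lemma measurable_box n (s : 'rV[R]_n) k : measurable (box s k).
Proof.
rewrite [X in measurable X](_ : _ = \bigcap_(i in [set: 'I_n])
      ([set: 'rV[R]_n] `&` (fun x : 'rV[R]_n => x ord0 i) @^-1` `[s ord0 i, s ord0 i + k%:R])).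
  apply: fin_bigcap_measurable => // i _.
  by apply: measurable_coord => //; exact: measurable_itv.
apply/seteqP; split => x /= xz i; first by move=> _; split => //=; rewrite in_itv/=; exact: xz.
by have [_] := xz i I; rewrite /= in_itv.
Qed.

Lemma torusE n : @torus R n = box (0 : 'rV[R]_n) 1.
Proof.
by apply/seteqP; split => x /= xz i; have := xz i; rewrite mxE add0r.
Qed.

(** Induction on the dimension: the inner integral over the last [n] coordinates is again periodic
    in the first one, so the one-dimensional identity applies to it. *)
Lemma integral_box_periodic n (s : 'rV[R]_n) (k : nat) (f : 'rV[R]_n -> \bar R) :
  (forall (z : 'rV[int]_n) x, f (x + map_mx intr z) = f x) ->
  measurable_fun setT f -> (forall x, 0 <= f x)%E ->
  (\int[lebesgue_rV R n]_(x in box s k) f x =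
   (k%:R ^+ n)%:E * \int[lebesgue_rV R n]_(x in @torus R n) f x)%E.
Proof.
rewrite torusE.
elim: n s f => [|n IHn] s f fper mf f0.
  rewrite expr0 mul1e; congr (integral _ _ _).
  by apply/seteqP; split => x _ [].
have E (u : 'rV[R]_n.+1) l : (\int[lebesgue_rV R n.+1]_(x in box u l) f x =
  \int[leb1]_(t in `[u ord0 ord0, (u ord0 ord0 + l%:R)%R])
    \int[lebesgue_rV R n]_(x in box (\row_j u ord0 (lift ord0 j)) l) f (rV_cons (t, x)))%E.
  rewrite integral_mkcond integral_rV_cons; last 2 first.
  - apply/(measurable_restrictT _ _).1 => //; first exact: measurable_box.
    exact: measurable_funTS.
  - by move=> x; apply: erestrict_ge0.
  rewrite [RHS]integral_mkcond; apply: eq_integral => t _.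
  rewrite [RHS]patchE; case: ifPn => [/set_mem|/negP tI].
    rewrite /= in_itv/= => tI.
    rewrite [RHS]integral_mkcond; apply: eq_integral => x _.
    rewrite !patchE; congr (if _ then _ else _); apply/idP/idP; rewrite !inE/= => H.
      by move=> i; have := H (lift ord0 i); rewrite rV_consS mxE.
    move=> i; have [j|] := @unliftP _ ord0 i => ->; last by rewrite rV_cons0.
    by have := H j; rewrite mxE rV_consS.
  apply: integral0_eq => x _.
  rewrite patchE ifF//; apply: contra_notF tI => /set_mem/(_ ord0).
  by rewrite rV_cons0 => tI; apply/mem_set; rewrite /= in_itv.
rewrite !E [in RHS]mxE add0r.
have consper t (z : 'rV[int]_n) (x : 'rV[R]_n) :
    f (rV_cons (t, x + map_mx intr z)) = f (rV_cons (t, x)).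
  rewrite -(fper (\row_i oapp (fun j => z ord0 j) 0 (unlift ord0 i)) (rV_cons (t, x))).
  congr f; apply/rowP => i; rewrite !mxE/=.
  by case: unliftP => [j _|_]/=; rewrite ?mxE// addr0.
have mcons t : measurable_fun setT (fun x => f (rV_cons (t, x))).
  exact: measurable_fun_rV_cons.
pose G t := (\int[lebesgue_rV R n]_(x in box (0 : 'rV[R]_n) 1) f (rV_cons (t, x)))%E.
have G0 t : (0 <= G t)%E by exact: integral_ge0.
have mG : measurable_fun [set: measurableTypeR R] G.
  rewrite [X in measurable_fun _ X](_ : _ = fun t => \int[lebesgue_rV R n]_x
      (f (rV_cons (t, x)) * (\1_(box (0 : 'rV[R]_n) 1) x)%:E))%E.
    apply: (measurable_fun_fubini_tonelli_F
      (fun p => f (rV_cons p) * (\1_(box (0 : 'rV[R]_n) 1) p.2)%:E)%E) => [|p].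
      apply: emeasurable_funM.
        by apply: measurableT_comp => //; exact: measurable_rV_cons.
      have mi : measurable_fun setT (\1_(box (0 : 'rV[R]_n) 1) : 'rV[R]_n -> R).
        by apply: measurable_indic; exact: measurable_box.
      by apply/measurable_EFinP; exact: (measurableT_comp mi measurable_snd).
    by rewrite mule_ge0// lee_fin.
  apply/funext => t; rewrite /G integral_mkcond; apply: eq_integral => x _.
  by rewrite patchE indicE; case: ifPn => xb; rewrite ?mule1 ?mule0.
have rowE : (\row_j (0 : 'rV[R]_n.+1) ord0 (lift ord0 j)) = 0 :> 'rV[R]_n.
  by apply/rowP => j; rewrite !mxE.
rewrite rowE -/(G _).
transitivity (\int[leb1]_(t in `[s ord0 ord0, (s ord0 ord0 + k%:R)%R]) ((k%:R ^+ n)%:E * G t))%E.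
  apply: eq_integral => t _; exact: (IHn _ (fun x => f (rV_cons (t, x))) (consper t) (mcons t)).
rewrite ge0_integralZl//; last first.
  exact: measurable_funTS.
rewrite (integral_itv_periodic (s ord0 ord0) k)//; last first.
  move=> j t; rewrite /G; apply: eq_integral => x _.
  rewrite -[RHS](fper (\row_i oapp (fun=> 0) j (unlift ord0 i))).
  congr f; apply/rowP => i; rewrite !mxE/=.
  by case: unliftP => [? _|_]/=; rewrite ?addr0.
by rewrite muleA -EFinM -exprSr.
Qed.

End periodic_integral.

(** * Periodic functions integrated against a polynomially decaying weight *)

Section weight.
Context (R : realType) (n : nat).
Implicit Types (x : 'rV[R]_n) (t : R).

(** The exponent exceeds the dimension by [t], which makes the weight integrable for [t > 0]; the
    shift by 1 keeps it finite at 0 and comparable with its bounded translates. *)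
Definition weight t x : R := (1 + `|x|) `^ (- (n%:R + t)).

Lemma weight_gt0 t x : 0 < weight t x.
Proof. by rewrite powR_gt0// ltr_pwDl. Qed.

Lemma measurable_weight t : measurable_fun setT (weight t).
Proof.
apply: (measurableT_comp (measurable_powR _)).
apply: measurable_funD => //; apply: measurable_fun_rV_continuous.
exact: norm_continuous.
Qed.

Lemma dyadic_bracket (y : R) : 1 <= y -> exists k, 2 ^+ k <= y < 2 ^+ k.+1.
Proof.
move=> y1; have y0 : 0 <= y by exact: le_trans y1.
have := truncn_itv y0; set m := Num.truncn y => /andP[my ym].
have m0 : (0 < m)%N by rewrite /m truncn_gt0.
have /andP[l1 l2] := trunc_log_bounds (isT : (1 < 2)%N) m0.
exists (trunc_log 2 m); rewrite -!natrX; apply/andP; split.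
  by rewrite (le_trans _ my)// ler_nat.
by rewrite (lt_le_trans ym)// ler_nat.
Qed.

Let cube k := box (const_mx (- 2 ^+ k.+1) : 'rV[R]_n) (2 ^ k.+2).

Lemma weight_dyadic t x : 0 < t -> exists k : nat,
  cube k x /\ weight t x <= (2 ^+ k) `^ (- (n%:R + t)).
Proof.
move=> t0; have [k /andP[k1 k2]] := @dyadic_bracket (1 + `|x|) ltac:(by rewrite lerDl).
exists k; split.
  move=> i; rewrite mxE; have xi := rV_norm_coord x i.
  have {}xi : `|x ord0 i| <= 2 ^+ k.+1.
    by rewrite (le_trans xi)// (le_trans _ (ltW k2))// lerDr.
  move: xi; rewrite ler_norml => /andP[-> /= xi]; rewrite (le_trans xi)//.
  rewrite natrX (exprS _ k.+1) mulr_natl mulr2n.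
  by rewrite addrA addNr add0r.
rewrite /weight !powRN lef_pV2 ?posrE ?powR_gt0 ?exprn_gt0// ?ltr_pwDl//.
by rewrite ge0_ler_powR ?nnegrE ?addr_ge0 ?exprn_ge0// ltW.
Qed.

(** The weight is at most the sum over [k] of [2 ^ (- k (n + t))] times the indicator of a cube of
    side [2 ^ (k + 2)]. By periodicity the integral of [f] over this cube is [2 ^ ((k + 2) n)] times
    that over the torus, so the series is geometric with first term [4 ^ n] and ratio
    [q = 2 ^ (- t)]. *)
Lemma integral_weight_periodic t : 0 < t -> exists2 K : R, 0 < K &
  forall f : 'rV[R]_n -> \bar R,
  (forall (z : 'rV[int]_n) x, f (x + map_mx intr z) = f x) ->
  measurable_fun setT f -> (forall x, 0 <= f x)%E ->
  (\int[lebesgue_rV R n]_x ((weight t x)%:E * f x) <=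
   K%:E * \int[lebesgue_rV R n]_(x in @torus R n) f x)%E.
Proof.
move=> t0; pose q : R := 2 `^ (- t).
have q0 : 0 < q by rewrite powR_gt0.
have q1 : q < 1.
  by rewrite /q /powR pnatr_eq0/= expR_lt1 mulNr oppr_lt0 mulr_gt0// ln_gt0 ?ltr1n.
exists (4 ^+ n / (1 - q)); first by rewrite divr_gt0 ?subr_gt0 ?exprn_gt0.
move=> f fper mf f0.
pose c k : R := (2 ^+ k) `^ (- (n%:R + t)).
have c0 k : 0 <= c k by exact: powR_ge0.
have mcube k : measurable (cube k) by exact: measurable_box.
pose g k x : \bar R := ((c k)%:E * (f \_ (cube k)) x)%E.
have g0 k x : (0 <= g k x)%E by rewrite mule_ge0 ?lee_fin//; apply: erestrict_ge0.
have mf_ k : measurable_fun setT (f \_ (cube k)).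
  by apply/(measurable_restrictT _ _).1 => //; exact: measurable_funTS.
have mg k : measurable_fun setT (g k) by exact: emeasurable_funM.
apply: (@le_trans _ _ (\int[lebesgue_rV R n]_x \sum_(k <oo) g k x)%E).
  apply: ge0_le_integral => //.
  - by move=> x _; rewrite mule_ge0// lee_fin ltW// weight_gt0.
  - by apply: emeasurable_funM => //; apply/measurable_EFinP; exact: measurable_weight.
  - by apply: ge0_emeasurable_sum.
  - move=> x _; have [k [Bk wk]] := weight_dyadic x t0.
    apply: (@le_trans _ _ (g k x)).
      by rewrite /g patchE mem_set// lee_wpmul2r// lee_fin.
    have := @nneseries_lim_ge R (g ^~ x) predT 0 k.+1 (fun i _ _ => g0 i x).
    apply: le_trans; rewrite big_nat_recr//= leeDr// sume_ge0//.
rewrite integral_nneseries//.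
set I := (\int[lebesgue_rV R n]_(x in _) f x)%E.
have I0 : (0 <= I)%E by exact: integral_ge0.
have gI k : (\int[lebesgue_rV R n]_x g k x = (4 ^+ n * q ^+ k)%:E * I)%E.
  rewrite ge0_integralZl ?lee_fin//; last by move=> x _; apply: erestrict_ge0.
  rewrite -integral_mkcond integral_box_periodic// muleA -EFinM; congr (_%:E * _)%E.
  rewrite /c opprD powRD; last by rewrite expf_eq0 pnatr_eq0 andbF implybT.
  have -> : (2 ^+ k) `^ (- t) = q ^+ k :> R.
    by rewrite -(powR_mulrn k (ler0n R 2)) -powRrM mulrC powRrM powR_mulrn ?powR_ge0.
  rewrite powRN powR_mulrn ?exprn_ge0// natrX.
  have -> : (2 ^+ k.+2 : R) = 4 * 2 ^+ k by rewrite !exprS; ring.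
  rewrite exprMn; field.
  by rewrite !expf_neq0// pnatr_eq0.
rewrite (eq_eseriesr (fun k _ => gI k)).
apply: lime_le.
  by apply: is_cvg_nneseries => k _ _; rewrite mule_ge0// lee_fin mulr_ge0 ?exprn_ge0// ltW.
apply: nearW => N; rewrite -ge0_sume_distrl; last first.
  by move=> k _; rewrite lee_fin mulr_ge0 ?exprn_ge0// ltW.
apply: lee_wpmul2r => //; rewrite sumEFin lee_fin.
have -> : \sum_(0 <= i < N) 4 ^+ n * q ^+ i = series (geometric (4 ^+ n) q) N by [].
rewrite geometric_seriesE ?lt_eqF//= ler_pM2r ?invr_gt0 ?subr_gt0//.
by rewrite ler_piMr ?exprn_ge0// gerBl exprn_ge0// ltW.
Qed.

End weight.

Section Rintegral_rV.
Context (R : realType) (d : nat).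
Local Notation Rd := 'rV[R]_d.
Local Notation leb := (lebesgue_rV R d).
Implicit Types (f g : Rd -> R).

Lemma integrable_affine (s : Rd) (r : R) f : r != 0 ->
  leb.-integrable setT (EFin \o f) ->
  leb.-integrable setT (EFin \o (fun x => f (s + r *: x))).
Proof.
move=> r0 /integrableP[mf foo]; apply/integrableP; split.
  exact: (measurableT_comp mf (measurable_rV_affine s r)).
move: foo; rewrite (integral_rV_affine s r0); last 2 first.
- exact: measurableT_comp.
- by [].
have A0 : 0 < `|r| ^+ d by rewrite exprn_gt0// normr_gt0.
by rewrite -[X in (_ < X)%E](@gt0_muley _ (`|r| ^+ d)%:E) ?lte_fin// lte_pmul2l ?lte_fin.
Qed.

Lemma Rintegral_affine (s : Rd) (r : R) f : r != 0 ->
  leb.-integrable setT (EFin \o f) ->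
  \int[leb]_x f x = `|r| ^+ d * \int[leb]_x f (s + r *: x).
Proof.
move=> r0 fi; have fi' := integrable_affine s r0 fi.
have mf := measurable_int _ fi.
rewrite -RintegralZl// /Rintegral; congr fine.
rewrite (integralE leb setT (EFin \o f)) (integral_rV_affine s r0); last 2 first.
- exact: measurable_funepos.
- by move=> x; exact: funepos_ge0.
rewrite [X in (_ - X)%E](integral_rV_affine s r0); last 2 first.
- exact: measurable_funeneg.
- by move=> x; exact: funeneg_ge0.
have -> : (\int[leb]_x (`|r| ^+ d * f (s + r *: x))%:E =
    (`|r| ^+ d)%:E * \int[leb]_x (f (s + r *: x))%:E)%E.
  by under eq_integral do rewrite EFinM; rewrite integralZl.
rewrite (integralE leb setT (fun x => (f (s + r *: x))%:E)) [RHS]muleBr//.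
  by congr (_ * _ - _ * _)%E; apply: eq_integral => x _; rewrite ?funeposE ?funenegE.
exact: (integrable_add_def _ fi').
Qed.

(** The translate of the torus by [z] is the unit box with corner [z], to which
    [integral_box_periodic] applies. *)
Lemma integral_torus_shift (z : Rd) (f : Rd -> \bar R) :
  (forall (k : 'rV[int]_d) x, f (x + map_mx intr k) = f x) ->
  measurable_fun setT f -> (forall x, 0 <= f x)%E ->
  (\int[leb]_(x in @torus R d) f (x + z)%R = \int[leb]_(x in @torus R d) f x)%E.
Proof.
move=> fper mf f0; rewrite -[RHS]mul1e -(expr1n _ d).
have /= <- := @integral_box_periodic R d z 1 f fper mf f0.
rewrite [RHS]integral_mkcond (integral_rV_affine z (oner_neq0 R)); last 2 first.
- apply/(measurable_restrictT _ _).1 => //; first exact: measurable_box.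
  exact: measurable_funTS.
- by move=> x; apply: erestrict_ge0.
rewrite normr1 expr1n mul1e [LHS]integral_mkcond; apply: eq_integral => x _.
rewrite scale1r !patchE (addrC z) torusE; congr (if _ then _ else _).
apply/idP/idP; rewrite !inE/= => H i; have := H i; rewrite !mxE add0r.
  by move=> /andP[? ?]; rewrite lerDr (addrC (x _ _)) lerD2l; apply/andP.
by rewrite lerDr (addrC (x _ _)) lerD2l.
Qed.

Lemma Rintegral_torus_shift (z : Rd) f : Zd_periodic f -> measurable_fun setT f ->
  \int[leb]_(x in @torus R d) f (x + z) = \int[leb]_(x in @torus R d) f x.
Proof.
move=> fper mf; congr fine; rewrite integralE [RHS]integralE.
have mf' : measurable_fun setT (EFin \o f) by exact/measurable_EFinP.
congr (_ - _)%E.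
  rewrite -[RHS](@integral_torus_shift z ((EFin \o f)^\+)%E)//.
  - by apply: eq_integral => x _; rewrite !funeposE.
  - by move=> k x; rewrite !funeposE/= fper.
  - exact: measurable_funepos.
rewrite -[RHS](@integral_torus_shift z ((EFin \o f)^\-)%E)//.
- by apply: eq_integral => x _; rewrite !funenegE.
- by move=> k x; rewrite !funenegE/= fper.
- exact: measurable_funeneg.
Qed.

Lemma measurable_torus : measurable (@torus R d).
Proof. by rewrite torusE; exact: measurable_box. Qed.

Lemma lebesgue_torus : leb (@torus R d) = 1%E.
Proof.
have := @lebesgue_rV_box R d (fun=> `[0%R, 1%R]%classic) (fun=> measurable_itv _).
rewrite big1 => [<-|i _]; last by rewrite lebesgue_measure_itv/= lte01 oppr0 adde0.
by congr (leb _).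
Qed.

Lemma integrable_weightM (t : R) f : 0 < t -> Zd_periodic f -> measurable_fun setT f ->
  leb.-integrable (@torus R d) (EFin \o f) ->
  leb.-integrable setT (fun x => (weight t x * f x)%:E).
Proof.
move=> t0 fper mf /integrableP[_ foo].
have [K K0 HK] := @integral_weight_periodic R d t t0.
apply/integrableP; split.
  by apply/measurable_EFinP; apply: measurable_funM => //; exact: measurable_weight.
have := HK (fun x => `|(f x)%:E|)%E; under eq_integral do rewrite -EFinM.
under [X in _ -> (X < _)%E]eq_integral do rewrite /= normrM (gtr0_norm (weight_gt0 _ _)).
move=> /(_ _ _ _)/le_lt_trans; apply => //.
- by move=> z x /=; rewrite fper.
- exact/measurable_EFinP/measurableT_comp.
- by rewrite lte_mul_pinfty// lee_fin ltW.
Qed.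

Lemma integrable_weight (t : R) : 0 < t ->
  leb.-integrable setT (EFin \o (@weight R d t)).
Proof.
move=> t0; have wE : (EFin \o @weight R d t) = fun x => (weight t x * cst 1 x)%:E.
  by apply/funext => x; rewrite /= mulr1.
rewrite wE; apply: integrable_weightM => //; apply/integrableP; split; first exact/measurable_EFinP.
under eq_integral do rewrite /= normr1.
rewrite integral_cst; last exact: measurable_torus.
by rewrite mul1e [X in (X < _)%E]lebesgue_torus ltry.
Qed.

End Rintegral_rV.

(** * Functionals of the jump kernel *)

(** This lets dominated convergence, a statement about sequences, prove continuity of integrals in a
    parameter. If [f] were discontinuous at [x], points within [1 / (k + 1)] of [x] with values far
    from [f x] would form a contradicting sequence. *)
Lemma sequential_continuous (R : realType) (X : normedModType R) (f : X -> R) (x : X) :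
  (forall u : nat -> X, u k @[k --> \oo] --> x -> f (u k) @[k --> \oo] --> f x) ->
  {for x, continuous f}.
Proof.
move=> H; apply/cvgrPdist_lt => e e0; apply: contrapT => Hn.
have Hu k : exists y, `|x - y| < k.+1%:R^-1 /\ e <= `|f x - f y|.
  apply: contrapT => nex; apply: Hn; apply/nbhs_ballP; exists k.+1%:R^-1 => //= y.
  rewrite -ball_normE/= => xy.
  rewrite ltNge; apply/negP => efy; apply: nex; exists y; split=> //.
have [u Pu] := choice Hu.
have ux : u k @[k --> \oo] --> x.
  apply/cvgrPdist_lt => r r0; near=> k; apply: lt_trans (Pu k).1 _.
  by near: k; exact: (near_infty_natSinv_lt (PosNum r0)).
have /cvgrPdist_lt/(_ _ e0)[N _ HN] := H u ux.
by have := HN N (leqnn _); rewrite ltNge (Pu N).2.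
Unshelve. all: end_near. Qed.

Section kernel_functional.
Context (R : realType) (d : nat).
Local Notation Rd := 'rV[R]_d.
Local Notation leb := (lebesgue_rV R d).

(* [s > 0] is what the assumption [delta > 2] leaves beyond second moments of the
   kernel; it makes the Taylor remainders of order [eps ^ (2 + s)]. *)
Definition growth (s : R) (z : Rd) : R := (1 + `|z|) ^+ 2 * (1 + `|z|) `^ s.

(** The field [ker_decay] packs the moment of order [2 + s] into a pointwise bound by an integrable
    weight; every integrability and domination statement about the kernel is read off from it. *)
Record decaying_kernel (a : Rd -> R) (s t C : R) : Prop := DecayingKernel {
  ker_cont : continuous a;
  ker_ge0 : forall z, 0 <= a z;
  ker_even : forall z, a (- z) = a z;
  ker_s : 0 < s <= 1;
  ker_t : 0 < t;
  ker_decay : forall z, a z * growth s z <= C * weight t z }.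

Context (a : Rd -> R) (s t C : R) (ka : decaying_kernel a s t C).

Definition kint (G : Rd -> R) : R := \int[leb]_z (a z * G z).

(** The constant is kept explicit so that a whole family of integrands can share it: this is the
    domination that [kint_cvg], [kint_continuous] and [kint_vanishing] require. *)
Definition admissible (K : R) (G : Rd -> R) :=
  measurable_fun setT G /\ forall z, `|G z| <= K * growth s z.

Lemma growth_ge1 z : 1 <= growth s z.
Proof.
have z1 : 1 <= 1 + `|z| by rewrite lerDl.
have /andP[s0 _] := ker_s ka.
have ps : 1 <= (1 + `|z|) `^ s.
  have := @ge0_ler_powR R s (ltW s0) 1 (1 + `|z|); rewrite powR1; apply => //;
  by rewrite nnegrE ?addr_ge0.
by rewrite (le_trans ps)// ler_peMl ?exprn_ege1// (le_trans _ ps).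
Qed.

Let growth_ge0 z : 0 <= growth s z.
Proof. exact: le_trans (growth_ge1 z). Qed.

Lemma ker_integrable K G : admissible K G ->
  leb.-integrable setT (fun z => (a z * G z)%:E).
Proof.
move=> [mG GK].
have mag : measurable_fun setT (fun z => a z * G z).
  by apply: measurable_funM => //; exact: (measurable_fun_rV_continuous (ker_cont ka)).
apply: (@le_integrable _ _ _ leb setT measurableT _ (fun z => ((`|K| * C)%:E * (weight t z)%:E)%E)).
- exact/measurable_EFinP.
- move=> z _; have h : `|a z * G z| <= `|K| * C * weight t z.
    rewrite normrM (ger0_norm (ker_ge0 ka z)) -mulrA.
    apply: le_trans (ler_wpM2l (normr_ge0 K) (ker_decay ka z)).
    rewrite mulrCA ler_wpM2l ?(ker_ge0 ka)// (le_trans (GK z))//.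
    by rewrite ler_wpM2r// ler_norm.
  by rewrite -EFinM !abse_EFin lee_fin (le_trans h)// ler_norm.
- by apply: integrableZl => //; exact: integrable_weight (ker_t ka).
Qed.

Lemma admissibleD K1 K2 G1 G2 : admissible K1 G1 -> admissible K2 G2 ->
  admissible (K1 + K2) (fun z => G1 z + G2 z).
Proof.
move=> [m1 H1] [m2 H2]; split; first exact: measurable_funD.
by move=> z; rewrite (le_trans (ler_normD _ _))// mulrDl lerD.
Qed.

Lemma admissibleZ k K G : admissible K G -> admissible (`|k| * K) (fun z => k * G z).
Proof.
move=> [m1 H1]; split; first exact: measurable_funM.
by move=> z; rewrite normrM -mulrA ler_wpM2l.
Qed.

Lemma admissible_bounded K (G : Rd -> R) : measurable_fun setT G -> (forall z, `|G z| <= K) ->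
  admissible K G.
Proof.
move=> mG GK; split=> // z; rewrite (le_trans (GK z))// ler_peMr ?growth_ge1//.
exact: le_trans (GK z).
Qed.

Lemma kintD K1 K2 G1 G2 : admissible K1 G1 -> admissible K2 G2 ->
  kint (fun z => G1 z + G2 z) = kint G1 + kint G2.
Proof.
move=> a1 a2; rewrite /kint -RintegralD//.
- by apply: eq_Rintegral => z _; rewrite mulrDr.
- exact: ker_integrable a1.
- exact: ker_integrable a2.
Qed.

Lemma kintZ k K G : admissible K G -> kint (fun z => k * G z) = k * kint G.
Proof.
move=> a1; rewrite /kint -RintegralZl//.
- by apply: eq_Rintegral => z _; rewrite mulrCA.
- exact: ker_integrable a1.
Qed.

Lemma kintB K1 K2 G1 G2 : admissible K1 G1 -> admissible K2 G2 ->
  kint (fun z => G1 z - G2 z) = kint G1 - kint G2.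
Proof.
move=> a1 a2; rewrite /kint -RintegralB//.
- by apply: eq_Rintegral => z _; rewrite mulrBr.
- exact: ker_integrable a1.
- exact: ker_integrable a2.
Qed.

Lemma kint0 : kint (fun=> 0) = 0.
Proof. by rewrite /kint; under eq_Rintegral do rewrite mulr0; rewrite Rintegral_cst// mul0r. Qed.

Lemma admissible_sum (I : Type) (r : seq I) (P : pred I) (K : I -> R) (G : I -> Rd -> R) :
  (forall i, admissible (K i) (G i)) ->
  admissible (\sum_(i <- r | P i) K i) (fun z => \sum_(i <- r | P i) G i z).
Proof.
move=> aG; elim: r => [|i r IH].
  rewrite big_nil (_ : (fun z => _) = fun=> 0); last by apply/funext => z; rewrite big_nil.
  by split=> // z; rewrite normr0 mul0r.
rewrite big_cons (_ : (fun z => _) = fun z => if P i then G i z + \sum_(j <- r | P j) G j z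
    else \sum_(j <- r | P j) G j z); last by apply/funext => z; rewrite big_cons.
by case: (P i) => //; exact: admissibleD.
Qed.

Lemma kint_sum (I : Type) (r : seq I) (P : pred I) (K : I -> R) (G : I -> Rd -> R) :
  (forall i, admissible (K i) (G i)) ->
  kint (fun z => \sum_(i <- r | P i) G i z) = \sum_(i <- r | P i) kint (G i).
Proof.
move=> aG; elim: r => [|i r IH].
  by rewrite [RHS]big_nil -[RHS]kint0; apply: eq_Rintegral => z _; rewrite big_nil.
rewrite big_cons -IH; transitivity (kint (fun z => if P i then G i z + \sum_(j <- r | P j) G j z
    else \sum_(j <- r | P j) G j z)).
  by apply: eq_Rintegral => z _; rewrite big_cons.
by case: (P i) => //; exact: kintD (aG i) (admissible_sum r P aG).
Qed.

Lemma kint_le K1 K2 G1 G2 : admissible K1 G1 -> admissible K2 G2 ->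
  (forall z, G1 z <= G2 z) -> kint G1 <= kint G2.
Proof.
move=> a1 a2 G12; apply: le_Rintegral => //.
- exact: ker_integrable a1.
- exact: ker_integrable a2.
- by move=> z _; rewrite ler_wpM2l// (ker_ge0 ka).
Qed.

Lemma admissible_growth : admissible 1 (growth s).
Proof.
split; last by move=> z; rewrite mul1r ger0_norm.
have mn : measurable_fun setT (fun z : Rd => 1 + `|z|).
  apply: measurable_funD => //; apply: measurable_fun_rV_continuous.
  exact: norm_continuous.
apply: measurable_funM; first exact: measurable_funX.
exact: (measurableT_comp (measurable_powR _)).
Qed.

Lemma kint_norm_le K G : admissible K G -> `|kint G| <= K * kint (growth s).
Proof.
move=> aG; have ag := admissible_growth.
have aKg : admissible (`|K| * 1) (fun z => K * growth s z) by exact: admissibleZ.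
rewrite -(kintZ K ag) ler_norml; apply/andP; split.
  rewrite -mulN1r -(kintZ (-1) aKg); apply: (kint_le (admissibleZ (-1) aKg) aG) => z.
  by rewrite mulN1r; have := aG.2 z; rewrite ler_norml => /andP[].
apply: (kint_le aG aKg) => z.
by have := aG.2 z; rewrite ler_norml => /andP[].
Qed.

Lemma kint_cvg K (G_ : nat -> Rd -> R) (G : Rd -> R) :
  (forall k, admissible K (G_ k)) -> (forall z, G_ k z @[k --> \oo] --> G z) ->
  kint (G_ k) @[k --> \oo] --> kint G.
Proof.
move=> aG cG.
have mG : measurable_fun setT G.
  by apply: (measurable_fun_cvg (fun k => (aG k).1)) => z _; exact: cG.
have ag : admissible K G.
  split=> // z.
  by apply: (cvgr_to_le (cvg_norm (cG z))); apply: nearW => k; exact: (aG k).2.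
apply: fine_cvg; rewrite fineK; last first.
  by apply: integrable_fin_num => //; exact: ker_integrable ag.
apply: (@dominated_cvg _ _ _ leb setT measurableT _ _
    (fun z => (a z * (K * growth s z))%:E)) => //.
- move=> k; exact: (measurable_int _ (ker_integrable (aG k))).
- by move=> z _; apply: cvg_EFin; [exact: nearW|apply: cvgMr; exact: cG].
- have := ker_integrable (admissibleZ K admissible_growth); exact.
- move=> k z _; rewrite abse_EFin lee_fin normrM (ger0_norm (ker_ge0 ka z)).
  by rewrite ler_wpM2l ?(ker_ge0 ka)//; exact: (aG k).2.
Qed.

Lemma kint_continuous (X : normedModType R) K (F : X -> Rd -> R) :
  (forall x, admissible K (F x)) -> (forall z, continuous (F ^~ z)) ->
  continuous (fun x => kint (F x)).
Proof.
move=> aF cF x; apply: sequential_continuous => u ux.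
apply: (@kint_cvg K) => // z.
exact: (@cvg_comp _ _ _ u (F ^~ z) _ _ _ ux (cF z x)).
Qed.

End kernel_functional.

Section periodic_functions.
Context (R : realType) (d : nat).
Local Notation Rd := 'rV[R]_d.
Local Notation leb := (lebesgue_rV R d).
Implicit Types f g : Rd -> R.

Definition cper f := continuous f /\ Zd_periodic f.

Lemma torus_reduction (x : Rd) : exists z : 'rV[int]_d, @torus R d (x + map_mx intr z).
Proof.
exists (\row_i - Num.floor (x ord0 i)) => i; rewrite !mxE.
have /andP[l1 l2] := floor_itv (x ord0 i).
rewrite mulrNz subr_ge0 l1/= lerBlDr addrC (le_trans (ltW l2))//.
by rewrite intrD.
Qed.

Lemma compact_torus : compact (@torus R d).
Proof.
have := @rV_compact R d (fun=> `[0, 1]%classic) (fun=> @segment_compact R 0 1).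
congr compact; apply/seteqP; split => x /= H i; have := H i; rewrite in_itv//.
Qed.

Lemma cper_bounded f : cper f -> exists K, forall x, `|f x| <= K.
Proof.
move=> [cf pf]; have : compact (f @` @torus R d).
  apply: continuous_compact; last exact: compact_torus.
  exact: continuous_subspaceT.
move=> /compact_bounded[M [_ HM]]; exists (M + 1) => x.
have [z zx] := torus_reduction x; rewrite -(pf z x).
by apply: (HM (M + 1)); [rewrite ltrDl|exists (x + map_mx intr z)].
Qed.

Lemma cper_measurable f : cper f -> measurable_fun setT f.
Proof. by move=> [cf _]; exact: measurable_fun_rV_continuous. Qed.

Lemma cper_cst (k : R) : cper (fun=> k).
Proof. by split=> //; exact: cst_continuous. Qed.

Lemma cperD f g : cper f -> cper g -> cper (fun x => f x + g x).
Proof.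
move=> [cf pf] [cg pg]; split; first by move=> x; apply: continuousD; [exact: cf|exact: cg].
by move=> z x; rewrite pf pg.
Qed.

Lemma cperM f g : cper f -> cper g -> cper (fun x => f x * g x).
Proof.
move=> [cf pf] [cg pg]; split; first by move=> x; apply: continuousM; [exact: cf|exact: cg].
by move=> z x; rewrite pf pg.
Qed.

Lemma cperN f : cper f -> cper (fun x => - f x).
Proof.
move=> [cf pf]; split; first by move=> x; apply: continuousN; exact: cf.
by move=> z x; rewrite pf.
Qed.

Lemma cperB f g : cper f -> cper g -> cper (fun x => f x - g x).
Proof. by move=> cf cg; exact: cperD cf (cperN cg). Qed.

Lemma cperV f : cper f -> (forall x, f x != 0) -> cper (fun x => (f x)^-1).
Proof.
move=> [cf pf] f0; split; first by move=> x; apply: continuousV => //; exact: cf.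
by move=> z x; rewrite pf.
Qed.

Lemma cper_sum (I : Type) (r : seq I) (F : I -> Rd -> R) : (forall i, cper (F i)) ->
  cper (fun x => \sum_(i <- r) F i x).
Proof.
move=> cF; elim: r => [|i r IH].
  rewrite (_ : (fun x => _) = fun=> 0); first exact: cper_cst.
  by apply/funext => x; rewrite big_nil.
rewrite (_ : (fun x => _) = fun x => F i x + \sum_(j <- r) F j x); first exact: cperD.
by apply/funext => x; rewrite big_cons.
Qed.

Lemma cper_torus_integrable f : cper f -> leb.-integrable (@torus R d) (EFin \o f).
Proof.
move=> cf; have [K HK] := cper_bounded cf.
apply: (@le_integrable _ _ _ leb _ (@measurable_torus R d) _ (cst K%:E)).
- by apply/measurable_EFinP; apply: measurable_funTS; exact: cper_measurable.
- by move=> x _ /=; rewrite lee_fin (le_trans (HK x))// ler_norm.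
- apply/integrableP; split; first exact: measurable_cst.
  rewrite integral_cst; last exact: measurable_torus.
  by rewrite [X in (_ * X)%E]lebesgue_torus mule1 ltry.
Qed.

Lemma Rintegral_torus_ge f (m : R) : cper f -> (forall x, m <= f x) ->
  m <= \int[leb]_(x in @torus R d) f x.
Proof.
move=> cf mf; have -> : m = \int[leb]_(x in @torus R d) (cst m x).
  rewrite Rintegral_cst; last exact: measurable_torus.
  by rewrite [X in fine X]lebesgue_torus /= mulr1.
apply: le_Rintegral => //; first exact: measurable_torus.
- exact: cper_torus_integrable (cper_cst m).
- exact: cper_torus_integrable.
Qed.

Context (a : Rd -> R) (s t C : R) (ka : decaying_kernel a s t C).

Definition conv (f : Rd -> R) (x : Rd) : R := kint a (fun z => f (x - z)).

Lemma measurable_reflect f (x : Rd) : measurable_fun setT f ->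
  measurable_fun setT (fun z : Rd => f (x - z)).
Proof.
move=> mf; under eq_fun do rewrite -scaleN1r.
exact: (measurableT_comp mf (measurable_rV_affine x (-1))).
Qed.

Lemma cper_admissible f : cper f -> exists K, forall x, admissible s K (fun z => f (x - z)).
Proof.
move=> cf; have [K HK] := cper_bounded cf; exists K => x.
apply: (admissible_bounded ka) => [|z]; last exact: HK.
by apply: measurable_reflect; exact: cper_measurable.
Qed.

Lemma conv_cper f : cper f -> cper (conv f).
Proof.
move=> cf; have [K HK] := cper_admissible cf; split; last first.
  move=> z x; congr (kint a _); apply/funext => y.
  by rewrite addrAC; exact: cf.2.
apply: (kint_continuous ka (K := K) (F := fun x z => f (x - z))) => // z x.
have cs : {for x, continuous (fun x : Rd => x - z)}.
  by apply: continuousB; [exact: cvg_id|exact: cst_continuous].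
exact: (continuous_comp cs (cf.1 (x - z))).
Qed.

Lemma convZ k f x : cper f -> conv (fun y => k * f y) x = k * conv f x.
Proof. by move=> /cper_admissible[K HK]; exact: (kintZ ka k (HK x)). Qed.

Lemma convB f g x : cper f -> cper g -> conv (fun y => f y - g y) x = conv f x - conv g x.
Proof.
move=> /cper_admissible[K HK] /cper_admissible[L HL]; exact: (kintB ka (HK x) (HL x)).
Qed.

Lemma conv_le f g x : cper f -> cper g -> (forall y, f y <= g y) -> conv f x <= conv g x.
Proof.
move=> /cper_admissible[K HK] /cper_admissible[L HL] fg.
by apply: (kint_le ka (HK x) (HL x)) => z.
Qed.

End periodic_functions.

(** * The Markov operator on the torus *)

(** Raise the Peetre-type inequality [1 + |z| <= (1 + M) (1 + |z + v|)] to the power [d + t]. *)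
Lemma weight_shift (R : realType) (d : nat) (t M : R) (v z : 'rV[R]_d) :
  0 < t -> `|v| <= M -> weight t (z + v) <= (1 + M) `^ (d%:R + t) * weight t z.
Proof.
move=> t0 vM; have M0 : 0 <= M by exact: le_trans vM.
have p0 : 0 <= d%:R + t by rewrite addr_ge0// ltW.
rewrite /weight !powRN -lef_pV2 ?posrE; last 2 first.
- by rewrite mulr_gt0 ?invr_gt0 ?powR_gt0 ?ltr_pwDl.
- by rewrite invr_gt0 powR_gt0 ?ltr_pwDl.
rewrite invfM !invrK ler_pdivrMl ?powR_gt0 ?ltr_pwDl// -powRM ?addr_ge0//.
rewrite ge0_ler_powR ?nnegrE ?mulr_ge0 ?addr_ge0// ?(ltW t0)//.
have zv : `|z| <= `|z + v| + M.
  by rewrite (le_trans _ (lerD (lexx _) vM))// -[in leLHS](addrK v z) ler_normB.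
rewrite mulrDl mul1r mulrDr mulr1.
have : 0 <= M * `|z + v| by rewrite mulr_ge0.
by lra.
Qed.

Section equicontinuity.
Context (R : realType) (d : nat).
Local Notation Rd := 'rV[R]_d.
Local Notation leb := (lebesgue_rV R d).
Context (a : Rd -> R) (s t C : R) (ka : decaying_kernel a s t C).

Lemma ker_le_weight z : a z <= C * weight t z.
Proof.
apply: le_trans (ker_decay ka z).
by rewrite ler_peMr ?(ker_ge0 ka)// (growth_ge1 ka).
Qed.

Lemma ker_C_ge0 : 0 <= C.
Proof.
by rewrite -(pmulr_lge0 _ (weight_gt0 t (0 : Rd))) (le_trans _ (ker_le_weight 0))// (ker_ge0 ka).
Qed.

Lemma integrable_ker : leb.-integrable setT (EFin \o a).
Proof.
have := @ker_integrable R d a s t C ka 1 (fun=> 1).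
rewrite (_ : (fun z => (a z * 1)%:E) = EFin \o a); last by apply/funext => z /=; rewrite mulr1.
apply; apply: (admissible_bounded ka) => // z; by rewrite normr1.
Qed.

(** The modulus of continuity of the kernel for translations in L^1; it controls the convolutions
    with all bounded functions at once. *)
Definition ker_modulus (v : Rd) : R := \int[leb]_z `|a (z + v) - a z|.

Lemma integrable_ker_diff v : leb.-integrable setT (EFin \o (fun z => a (z + v) - a z)).
Proof.
have i1 := integrable_ker.
have i2 := integrable_affine v (oner_neq0 R) i1.
rewrite (_ : EFin \o _ = (fun z => (a (v + 1 *: z))%:E - (a z)%:E)%E).
  exact: integrableB.
by apply/funext => z /=; rewrite scale1r (addrC v).
Qed.

Lemma ker_modulus_small (e : R) : 0 < e ->
  exists2 r, 0 < r & forall v, `|v| <= r -> ker_modulus v <= e.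
Proof.
move=> e0; suff : {for (0 : Rd), continuous ker_modulus}.
  move=> /cvgrPdist_le/(_ _ e0)/nbhs_ballP[r /= r0 Hr].
  exists (r / 2); first exact: divr_gt0.
  move=> v vr; have := Hr v; rewrite -ball_normE/= sub0r normrN.
  have -> : ker_modulus 0 = 0.
    rewrite /ker_modulus; under eq_Rintegral do rewrite addr0 subrr normr0.
    by rewrite Rintegral_cst// mul0r.
  rewrite sub0r normrN => /(_ _)/(le_trans (ler_norm _)); apply.
  by rewrite (le_lt_trans vr)// ltr_pdivrMr// mulr_natr mulr2n ltrDl.
apply: sequential_continuous => u u0.
(* The constant of [weight_shift] for vectors of norm at most 1; the rank [N] below discards the
   terms of the sequence of norm 1 or more. *)
pose K := C * 2 `^ (d%:R + t).
have /cvgrPdist_lt/(_ _ ltr01)[N _ HN] := u0.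
rewrite -(cvg_shiftn N); apply: fine_cvg; rewrite fineK; last first.
  apply: integrable_fin_num => //.
  by have := integrable_abse (integrable_ker_diff 0).
apply: (@dominated_cvg _ _ _ leb setT measurableT _ _
    (fun z => ((K + C) * weight t z)%:E)) => //.
- move=> k; have /integrable_abse := integrable_ker_diff (u (k + N)%N).
  exact: measurable_int.
- move=> z _; apply: cvg_EFin; first exact: nearW.
  apply: cvg_norm; apply: cvgB; last exact: cvg_cst.
  have uz : (z + u (k + N)%N) @[k --> \oo] --> z + 0.
    by apply: cvgD; [exact: cvg_cst|rewrite (cvg_shiftn N)].
  by apply: continuous_cvg; [exact: (ker_cont ka)|exact: uz].
- under eq_fun do rewrite EFinM.
  by apply: integrableZl => //; exact: integrable_weight (ker_t ka).
- move=> k z _; rewrite abse_EFin lee_fin normr_id (le_trans (ler_normB _ _))//.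
  rewrite !ger0_norm ?(ker_ge0 ka)// mulrDl lerD ?ker_le_weight//.
  rewrite (le_trans (ker_le_weight _))// /K -mulrA ler_wpM2l ?ker_C_ge0//.
  apply: weight_shift; first exact: ker_t ka.
  by have := HN (k + N)%N (leq_addl _ _); rewrite sub0r normrN => /ltW.
Qed.

(** A translation of the integration variable moves the increment [x - y] from [f] to the kernel, so
    the estimate depends on [f] through its bound only. *)
Lemma conv_modulus (f : Rd -> R) (B : R) (x y : Rd) : cper f -> (forall z, `|f z| <= B) ->
  `|conv a f x - conv a f y| <= B * ker_modulus (x - y).
Proof.
move=> cf fB; have [K HK] := cper_admissible ka cf.
pose v := x - y.
have ix := ker_integrable ka (HK x); have iy := ker_integrable ka (HK y).
have ixv := integrable_affine v (oner_neq0 R) ix.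
rewrite /conv /kint (Rintegral_affine v (oner_neq0 R) ix) normr1 expr1n mul1r.
rewrite -RintegralB//.
have E : (fun z => (a (v + 1 *: z) * f (x - (v + 1 *: z)) - a z * f (y - z))) =
    fun z => (a (z + v) - a z) * f (y - z).
  apply/funext => z; rewrite scale1r (addrC v z).
  have -> : x - (z + v) = y - z by apply/rowP => i; rewrite !mxE; ring.
  by rewrite mulrBl.
rewrite E.
have id_ : leb.-integrable setT (EFin \o (fun z => (a (z + v) - a z) * f (y - z))).
  rewrite -E; have := integrableB measurableT ixv iy; apply: eq_integrable => //.
rewrite (le_trans (le_normr_Rintegral _ id_))// /ker_modulus -RintegralZl//; last first.
  by have := integrable_abse (integrable_ker_diff (x - y)).
apply: le_Rintegral => //.
- by have := integrable_abse id_.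
- exact: (integrableZl measurableT B (integrable_abse (integrable_ker_diff (x - y)))).
- by move=> z _; rewrite normrM mulrC ler_wpM2r.
Qed.

End equicontinuity.

Section markov_operator.
Context (R : realType) (d : nat).
Local Notation Rd := 'rV[R]_d.
Local Notation leb := (lebesgue_rV R d).
Context (a : Rd -> R) (s t C : R) (ka : decaying_kernel a s t C).
Context (a_int : 0 < \int[leb]_x a x).
Context (mu : Rd -> R) (alpha1 alpha2 : R) (mu_cper : cper mu).
Context (alpha1_gt0 : 0 < alpha1) (mu_bnd : forall x, alpha1 <= mu x <= alpha2).

Let A := \int[leb]_x a x.

Definition mass (x : Rd) : R := conv a mu x.

(** The transition operator of the jump chain on the torus: the operator of the cell problems is
    [mass] times [markov - 1], and constants are fixed points. *)
Definition markov (g : Rd -> R) (x : Rd) : R :=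
  (mass x)^-1 * conv a (fun y => mu y * g y) x.

Lemma conv_cst k x : conv a (fun=> k) x = k * A.
Proof.
rewrite /conv /kint /A -RintegralZl//; last exact: integrable_ker ka.
by apply: eq_Rintegral => z _; rewrite mulrC.
Qed.

Lemma mass_bounds x : alpha1 * A <= mass x <= alpha2 * A.
Proof.
rewrite -!(conv_cst _ x); apply/andP; split; apply: (conv_le ka) => //; try exact: cper_cst.
  by move=> y; have /andP[] := mu_bnd y.
by move=> y; have /andP[] := mu_bnd y.
Qed.

Lemma mass_gt0 x : 0 < mass x.
Proof. by have /andP[+ _] := mass_bounds x; apply: lt_le_trans; rewrite mulr_gt0. Qed.

Lemma mass_cper : cper mass. Proof. exact: (conv_cper ka). Qed.

Lemma markov_cper g : cper g -> cper (markov g).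
Proof.
move=> cg; apply: cperM; last by apply: (conv_cper ka); exact: cperM.
by apply: cperV; [exact: mass_cper|move=> x; rewrite gt_eqF// mass_gt0].
Qed.

Lemma markov_le f g x : cper f -> cper g -> (forall y, f y <= g y) ->
  markov f x <= markov g x.
Proof.
move=> cf cg fg; rewrite /markov ler_pM2l ?invr_gt0 ?mass_gt0//.
apply: (conv_le ka); [exact: cperM|exact: cperM|move=> y].
by rewrite ler_wpM2l// (le_trans (ltW alpha1_gt0))//; have /andP[] := mu_bnd y.
Qed.

Lemma markov_cst k x : markov (fun=> k) x = k.
Proof.
rewrite /markov; under [X in conv a X _]eq_fun do rewrite mulrC.
by rewrite (convZ ka)// mulrC mulfK// gt_eqF// mass_gt0.
Qed.

Lemma markovB f g x : cper f -> cper g ->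
  markov (fun y => f y - g y) x = markov f x - markov g x.
Proof.
move=> cf cg; rewrite /markov; under [X in conv a X _]eq_fun do rewrite mulrBr.
by rewrite (convB ka) ?mulrBr//; exact: cperM.
Qed.

Lemma lebesgue_cube (w : Rd) (r : R) : 0 < r ->
  leb [set z : Rd | forall i, `[w ord0 i - r, w ord0 i + r]%classic (z ord0 i)] = ((r *+ 2) ^+ d)%:E.
Proof.
move=> r0; have := @lebesgue_rV_box R d (fun i => `[w ord0 i - r, w ord0 i + r]%classic)
  (fun=> measurable_itv _).
move=> ->; rewrite (eq_bigr (fun=> (r *+ 2)%:E)); last first.
  move=> i _; rewrite lebesgue_measure_itv/= lte_fin ifT; last by rewrite ltrD2l gtrN.
  by rewrite -EFinB; congr (_%:E); rewrite opprB mulr2n; ring.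
by rewrite prodEFin prodr_const card_ord.
Qed.

Lemma measurable_cube (w : Rd) (r : R) :
  measurable [set z : Rd | forall i, `[w ord0 i - r, w ord0 i + r]%classic (z ord0 i)].
Proof.
rewrite [X in measurable X](_ : _ = \bigcap_(i in [set: 'I_d])
    ([set: Rd] `&` (fun x : Rd => x ord0 i) @^-1` `[w ord0 i - r, w ord0 i + r])).
  by apply: fin_bigcap_measurable => // i _; apply: measurable_coord.
apply/seteqP; split => x /= xz i; first by move=> _; split=> //; exact: (xz i).
by have [_] := xz i I.
Qed.

Lemma conv_ge_cube g (w x : Rd) (r h : R) : 0 < r -> cper g -> (forall y, 0 <= g y) ->
  (forall z, `|z - w| <= r -> h <= a z * g (x - z)) ->
  h * (r *+ 2) ^+ d <= conv a g x.
Proof.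
move=> r0 cg g0 hw.
set B := [set z : Rd | forall i, `[w ord0 i - r, w ord0 i + r]%classic (z ord0 i)].
have mB : measurable B by exact: measurable_cube.
have -> : h * (r *+ 2) ^+ d = \int[leb]_(x in B) (cst h x).
  by rewrite Rintegral_cst// [X in fine X]lebesgue_cube.
have [K HK] := cper_admissible ka cg.
have ig := ker_integrable ka (HK x).
rewrite Rintegral_mkcond; apply: le_Rintegral => //.
  rewrite -restrict_EFin; apply/integrable_restrict => //; rewrite setTI.
  apply/integrableP; split; first exact/measurable_EFinP.
  rewrite -[X in (X < _)%E]/(\int[leb]_(x in B) cst `|h|%:E x)%E integral_cst//.
  rewrite [X in (_ * X)%E]lebesgue_cube//.
  by rewrite -EFinM ltry.
move=> z _; rewrite patchE; case: ifPn => [/set_mem zB|_].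
  apply: hw; apply: rV_norm_le => [|i]; first exact: ltW.
  have := zB i; rewrite /= in_itv/= !mxE ler_distl => /andP[z1 z2].
  by rewrite z1 z2.
by rewrite mulr_ge0// (ker_ge0 ka).
Qed.

(** By continuity [a >= a x0 / 2] on a ball around a point where [a] is positive. A cube of
    increments [z] lies in this ball and also satisfies [|x - z - p| <= r]; restricting the integral
    to it gives the bound. *)
Lemma markov_spread : exists x0 : Rd, exists2 rho : R, 0 < rho &
  forall r, 0 < r -> exists2 beta : R, 0 < beta &
  forall g h (p : Rd), cper g -> (forall y, 0 <= g y) -> 0 <= h ->
    (forall q, `|q - p| <= r -> h <= g q) ->
    forall x, `|x - (p + x0)| <= r + rho / 2 -> beta * h <= markov g x.
Proof.
have [x0 ax0] : exists x0, 0 < a x0.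
  apply: contrapT => nex; move: a_int; rewrite [X in 0 < X](_ : _ = 0) ?ltxx//.
  rewrite -[RHS](mul0r (fine (leb setT))) -Rintegral_cst//; apply: eq_Rintegral => x _.
  apply/eqP; rewrite eq_le (ker_ge0 ka) andbT leNgt; apply/negP => ax; apply: nex.
  by exists x.
have [rho rho0 Hrho] : exists2 rho, 0 < rho & forall z, `|z - x0| <= rho -> a x0 / 2 <= a z.
  have ax2 : 0 < a x0 / 2 by rewrite divr_gt0.
  have cax : {for x0, continuous a} by exact: (ker_cont ka).
  move/cvgrPdist_le : cax => /(_ _ ax2)/nbhs_ballP[e /= e0 He].
  exists (e / 2); first by rewrite divr_gt0.
  move=> z zx; have := He z; rewrite -ball_normE/= distrC => /(_ _)/ler_normlP[].
    by rewrite (le_lt_trans zx)// ltr_pdivrMr// mulr_natr mulr2n ltrDl.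
  by move=> _; rewrite lerBlDr -lerBlDl; apply: le_trans; lra.
exists x0, rho => // r r0.
(* The cube has half-side [eta] and centre at distance at most [rho - eta] from [x0]. When
   [L = |x - (p + x0)|] exceeds [rho - eta], the distance left to [x - p] is [L - (rho - eta)]; with
   [L <= r + rho / 2] this is at most [r - eta] as soon as [eta <= rho / 4]. *)
pose eta := Num.min (rho / 4) r.
have eta0 : 0 < eta by rewrite lt_min r0 divr_gt0.
have eta1 : eta <= rho / 4 by rewrite ge_min lexx.
have eta2 : eta <= r by rewrite ge_min lexx orbT.
have A0 : 0 < alpha2 * A.
  rewrite mulr_gt0// (lt_le_trans alpha1_gt0)//; have /andP[] := mu_bnd 0.
  exact: le_trans.
(* The factors are lower bounds for [1 / mass], [a] and [mu], and the volume of the cube. *)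
exists ((alpha2 * A)^-1 * (a x0 / 2 * alpha1 * (eta *+ 2) ^+ d)).
  by rewrite !mulr_gt0 ?invr_gt0// exprn_gt0// mulrn_wgt0.
move=> g h p cg g0 h0 hg x xp.
have mu0 y : 0 <= mu y by rewrite (le_trans (ltW alpha1_gt0))//; have /andP[] := mu_bnd y.
(* the centre of a cube contained in both B(x0, rho) and B(x - p, r) *)
have [w [wx wp]] : exists w : Rd, `|w - x0| <= rho - eta /\ `|w - (x - p)| <= r - eta.
  set L := `|x - (p + x0)| in xp.
  have [Ls|Ls] := leP L (rho - eta).
    exists (x - p); rewrite subrr normr0 subr_ge0; split=> //.
    by rewrite -addrA -opprD.
  have L0 : 0 < L by apply: le_lt_trans Ls; rewrite subr_ge0; lra.
  pose th := (rho - eta) / L.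
  have th1 : th < 1 by rewrite /th ltr_pdivrMr// mul1r.
  have th0 : 0 <= th by rewrite divr_ge0 ?(ltW L0)// subr_ge0; lra.
  exists (x0 + th *: (x - (p + x0))); split.
    by rewrite addrAC subrr add0r normrZ ger0_norm// /th divfK// gt_eqF.
  have -> : x0 + th *: (x - (p + x0)) - (x - p) = (th - 1) *: (x - (p + x0)).
    by apply/rowP => i; rewrite !mxE; ring.
  rewrite normrZ ler0_norm ?subr_le0 ?(ltW th1)// -/L opprB mulrBl mul1r.
  by rewrite /th divfK ?gt_eqF//; lra.
have lb : a x0 / 2 * alpha1 * h * (eta *+ 2) ^+ d <= conv a (fun y => mu y * g y) x.
  apply: (@conv_ge_cube _ w) => //; [exact: cperM|by move=> y; rewrite mulr_ge0|].
  move=> z zw; rewrite -mulrA ler_pM ?mulr_ge0 ?(ltW alpha1_gt0)//.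
  - by rewrite ltW.
  - apply: Hrho; rewrite -(subrK w z) -addrA (le_trans (ler_normD _ _))//.
    by rewrite (le_trans (lerD zw wx))// addrC subrK.
  - rewrite ler_pM ?(ltW alpha1_gt0)//; first by have /andP[] := mu_bnd (x - z).
    apply: hg; have -> : x - z - p = (w - z) - (w - (x - p)).
      by apply/rowP => i; rewrite !mxE; ring.
    rewrite (le_trans (ler_normB _ _))// distrC (le_trans (lerD zw wp))//.
    by rewrite addrC subrK.
rewrite /markov -[_ * _ * h]mulrA; apply: ler_pM.
- by rewrite invr_ge0 ltW.
- by rewrite mulr_ge0// ltW// !mulr_gt0// exprn_gt0// mulrn_wgt0.
- rewrite lef_pV2 ?posrE ?mass_gt0//.
  by have /andP[] := mass_bounds x.
- by apply: le_trans lb; rewrite [leLHS]mulrAC.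
Qed.

End markov_operator.

Section doeblin.
Context (R : realType) (d : nat).
Local Notation Rd := 'rV[R]_d.
Local Notation leb := (lebesgue_rV R d).
Context (a : Rd -> R) (s t C : R) (ka : decaying_kernel a s t C).
Context (a_int : 0 < \int[leb]_x a x).
Context (mu : Rd -> R) (alpha1 alpha2 : R) (mu_cper : cper mu).
Context (alpha1_gt0 : 0 < alpha1) (mu_bnd : forall x, alpha1 <= mu x <= alpha2).

Local Notation P := (markov a mu).

Lemma iter_markov_cper n g : cper g -> cper (iter n P g).
Proof. by move=> cg; elim: n => // n; exact: (markov_cper ka a_int mu_cper alpha1_gt0 mu_bnd). Qed.

Lemma markov_ge0 g : cper g -> (forall x, 0 <= g x) -> forall x, 0 <= P g x.
Proof.
move=> cg g0 x; rewrite -(markov_cst ka a_int mu_cper alpha1_gt0 mu_bnd 0 x).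
exact: (markov_le ka a_int mu_cper alpha1_gt0 mu_bnd _ (cper_cst _ 0) cg).
Qed.

Lemma iter_markov_ge0 n g : cper g -> (forall x, 0 <= g x) -> forall x, 0 <= iter n P g x.
Proof.
move=> cg g0; elim: n => // n IH.
by apply: markov_ge0 => //; exact: iter_markov_cper.
Qed.

(* The kernel may charge only a small ball around some [x0]; each step moves the
   lower bound by [x0] and enlarges its ball by [rho / 2] until it covers the torus. *)
Lemma doeblin r : 0 < r -> exists N, exists2 beta : R, 0 < beta &
  forall g h (p : Rd), cper g -> (forall y, 0 <= g y) -> 0 <= h ->
    (forall q, `|q - p| <= r -> h <= g q) -> forall x, beta * h <= iter N P g x.
Proof.
move=> r0; have [x0 [rho rho0 spread]] :=
  markov_spread ka a_int mu_cper alpha1_gt0 mu_bnd.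
have Hk (k : nat) : exists2 beta : R, 0 < beta &
  forall g h (p : Rd), cper g -> (forall y, 0 <= g y) -> 0 <= h ->
    (forall q, `|q - p| <= r -> h <= g q) ->
    forall x, `|x - (p + x0 *+ k)| <= r + k%:R * (rho / 2) -> beta * h <= iter k P g x.
  elim: k => [|k [beta b0 IH]].
    exists 1 => // g h p cg g0 h0 hg x; rewrite mulr0n mul0r !addr0 mul1r.
    exact: hg.
  have rk : 0 < r + k%:R * (rho / 2) by rewrite ltr_pwDl// mulr_ge0// divr_ge0// ltW.
  have [beta' b'0 Hb] := spread _ rk.
  exists (beta' * beta); first exact: mulr_gt0.
  move=> g h p cg g0 h0 hg x xp; rewrite -mulrA /=.
  apply: (Hb (iter k P g) (beta * h) (p + x0 *+ k)).
  - exact: iter_markov_cper.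
  - exact: iter_markov_ge0.
  - by rewrite mulr_ge0// ltW.
  - by move=> q; exact: IH.
  - by rewrite -addrA -mulrSr (le_trans xp)// -natr1; lra.
(* Then [N * (rho / 2) >= 1], and a sup-norm ball of radius at least 1 contains a representative of
   every point modulo integer vectors; [x] is replaced by the one in the unit cube at the moved
   centre. *)
pose N := (Num.truncn (rho / 2)^-1).+1.
have [beta b0 HN] := Hk N.
exists N, beta => // g h p cg g0 h0 hg x.
have [z zT] := torus_reduction (x - (p + x0 *+ N)).
rewrite -((iter_markov_cper N cg).2 z x); apply: (HN g h p) => //.
apply: (@le_trans _ _ 1).
  apply: rV_norm_le => // i; have /andP[z0 z1] := zT i.
  by rewrite -addrAC ger0_norm.
have NN : 1 <= N%:R * (rho / 2).
  rewrite -ler_pdivrMr ?divr_gt0// div1r.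
  have i0 : 0 <= (rho / 2)^-1 by rewrite invr_ge0 ltW// divr_gt0.
  by have /andP[_ /ltW] := truncn_itv i0.
by rewrite (le_trans NN)// lerDr ltW.
Qed.

(** Since constants are fixed, [m] can be subtracted first. The modulus is thereby proportional to
    the oscillation of [g], not to its size, which is what an iterated contraction of oscillations
    requires. *)
Lemma markov_modulus g m M x y : cper g -> (forall z, m <= g z <= M) ->
  `|P g x - P g y| <= (M - m) * (2 * alpha2 / (alpha1 * \int[leb]_x a x)) * ker_modulus a (x - y).
Proof.
move=> cg gm; set A := \int[leb]_x a x.
have A0 : 0 < alpha1 * A by exact: mulr_gt0.
have mg z : m <= g z by have /andP[] := gm z.
have gM z : g z <= M by have /andP[] := gm z.
have D0 : 0 <= M - m by rewrite subr_ge0 (le_trans (mg 0)).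
pose f z := g z - m.
have cf : cper f by apply: cperB => //; exact: cper_cst.
have Pf z : P f z = P g z - m.
  by rewrite /f (markovB ka mu_cper)//; [rewrite (markov_cst ka a_int mu_cper alpha1_gt0 mu_bnd)|exact: cper_cst].
have f0 z : 0 <= f z by rewrite subr_ge0.
have fD z : f z <= M - m by rewrite lerD2r.
have mu0 z : 0 <= mu z by rewrite (le_trans (ltW alpha1_gt0))//; have /andP[] := mu_bnd z.
have mu2 z : mu z <= alpha2 by have /andP[] := mu_bnd z.
have a2 : 0 <= alpha2 by exact: le_trans (mu2 0).
have -> : P g x - P g y = P f x - P f y by rewrite !Pf; ring.
have c0 z : 0 < mass a mu z by exact: (mass_gt0 ka a_int mu_cper alpha1_gt0 mu_bnd).
have Py0 : 0 <= P f y by exact: markov_ge0.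
have PyD : P f y <= M - m.
  rewrite -(markov_cst ka a_int mu_cper alpha1_gt0 mu_bnd (M - m) y).
  exact: (markov_le ka a_int mu_cper alpha1_gt0 mu_bnd _ cf (cper_cst _ _)).
have tau0 : 0 <= ker_modulus a (x - y) by exact: Rintegral_ge0.
set tau := ker_modulus a (x - y) in tau0 *.
have h1 : `|conv a (fun z => mu z * f z) x - conv a (fun z => mu z * f z) y| <= alpha2 * (M - m) * tau.
  apply: (conv_modulus ka _ _ (cperM mu_cper cf)) => z.
  by rewrite ger0_norm ?mulr_ge0// ler_pM.
have h2 : `|mass a mu x - mass a mu y| <= alpha2 * tau.
  by apply: (conv_modulus ka _ _ mu_cper) => z; rewrite ger0_norm.
(* This separates the variation of the numerator from that of the mass; each is at most
   [alpha2 * (M - m) * tau], whence the factor 2. *)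
have -> : P f x - P f y = (mass a mu x)^-1 *
   ((conv a (fun z => mu z * f z) x - conv a (fun z => mu z * f z) y) -
    P f y * (mass a mu x - mass a mu y)).
  by rewrite /markov; field; rewrite !gt_eqF.
rewrite normrM gtr0_norm ?invr_gt0// ler_pdivrMl//.
apply: (@le_trans _ _ (2 * alpha2 * (M - m) * tau)).
  rewrite (le_trans (ler_normB _ _))// normrM (ger0_norm Py0).
  have := ler_pM Py0 (normr_ge0 _) PyD h2; lra.
have /andP[c1 _] := mass_bounds ka mu_cper mu_bnd x.
have -> : mass a mu x * ((M - m) * (2 * alpha2 / (alpha1 * A)) * tau) =
  (2 * alpha2 * (M - m) * tau) * (mass a mu x / (alpha1 * A)) by ring.
by rewrite ler_peMr ?mulr_ge0// ler_pdivlMr// mul1r.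
Qed.

(** One step smooths: near 0, [P g] stays within a quarter of [M - m] of [P g 0]. According to the
    side of the midpoint on which [P g 0] lies, [P g - m] or [M - P g] is at least [(M - m) / 4] on
    a fixed ball, and the [N] steps of [doeblin] spread a fraction of this gain over the torus. *)
Lemma osc_contraction : exists N, exists2 theta : R, 0 <= theta < 1 &
  forall g m M, cper g -> (forall x, m <= g x <= M) ->
  exists m' M', (forall x, m' <= iter N P g x <= M') /\ M' - m' <= theta * (M - m).
Proof.
set A := \int[leb]_x a x.
have A0 : 0 < alpha1 * A by exact: mulr_gt0.
have a2 : 0 < alpha2.
  by apply: lt_le_trans alpha1_gt0 _; have /andP[] := mu_bnd 0; exact: le_trans.
pose L := 2 * alpha2 / (alpha1 * A).
have L0 : 0 < L by rewrite divr_gt0// mulr_gt0.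
(* [L] is the constant of [markov_modulus], so a kernel modulus below [1 / (4 L)] makes the
   variation of [P g] at most [(M - m) / 4]. *)
have e0 : 0 < (4 * L)^-1 by rewrite invr_gt0 mulr_gt0.
have [r r0 Hr] := ker_modulus_small ka e0.
have [N [beta b0 HN]] := doeblin r0.
(* The cap keeps the contraction factor [1 - be / 4] nonnegative. *)
pose be := Num.min beta 1.
have be0 : 0 < be by rewrite lt_min b0 ltr01.
have be1 : be <= 1 by rewrite ge_min lexx orbT.
have beb : be <= beta by rewrite ge_min lexx.
exists N.+1, (1 - be / 4); first by apply/andP; split; lra.
move=> g m M cg gm.
have mM : m <= M by have /andP[] := gm 0; exact: le_trans.
have cPg : cper (P g) by exact: (iter_markov_cper 1).
have Pgm x : m <= P g x <= M.
  apply/andP; split.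
    rewrite -(markov_cst ka a_int mu_cper alpha1_gt0 mu_bnd m x).
    by apply: (markov_le ka a_int mu_cper alpha1_gt0 mu_bnd _ (cper_cst _ _) cg) => y; have /andP[] := gm y.
  rewrite -(markov_cst ka a_int mu_cper alpha1_gt0 mu_bnd M x).
  by apply: (markov_le ka a_int mu_cper alpha1_gt0 mu_bnd _ cg (cper_cst _ _)) => y; have /andP[] := gm y.
have modg x : `|x - 0| <= r -> `|P g x - P g 0| <= (M - m) / 4.
  move=> xr; have := markov_modulus x 0 cg gm; move/le_trans; apply.
  rewrite -mulrA ler_wpM2l ?subr_ge0// -/A -/L.
  apply: le_trans (ler_wpM2l (ltW L0) (Hr _ xr)) _.
  by rewrite invfM mulrCA mulfV ?mulr1// gt_eqF.
have iterB f k : cper f -> forall n x, iter n P (fun y => f y - k) x = iter n P f x - k.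
  move=> cf; elim=> // n IH x /=.
  have -> : iter n P (fun y => f y - k) = fun y => iter n P f y - k by exact/funext.
  rewrite (markovB ka mu_cper); [|exact: iter_markov_cper|exact: cper_cst].
  by rewrite (markov_cst ka a_int mu_cper alpha1_gt0 mu_bnd).
have iterN f : cper f -> forall n x, iter n P (fun y => - f y) x = - iter n P f x.
  move=> cf; elim=> // n IH x /=.
  have -> : iter n P (fun y => - f y) = fun y => 0 - iter n P f y.
    by apply/funext => y; rewrite IH sub0r.
  rewrite (markovB ka mu_cper); [|exact: cper_cst|exact: iter_markov_cper].
  by rewrite (markov_cst ka a_int mu_cper alpha1_gt0 mu_bnd) sub0r.
have D4 : 0 <= (M - m) / 4 by rewrite divr_ge0// subr_ge0.
have bounds n x : m <= iter n P (P g) x <= M.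
  apply/andP; split.
    have := @iter_markov_ge0 n (fun y => P g y - m) (cperB cPg (cper_cst _ m)).
    rewrite -subr_ge0 -iterB//; apply=> y.
    by rewrite subr_ge0; have /andP[] := Pgm y.
  have := @iter_markov_ge0 n (fun y => - (P g y - M)) (cperN (cperB cPg (cper_cst _ M))).
  move=> /(_ _ x); rewrite iterN; last exact: cperB cPg (cper_cst _ M).
  rewrite iterB// opprB subr_ge0; apply => y.
  by rewrite opprB subr_ge0; have /andP[] := Pgm y.
have [half|half] := leP ((m + M) / 2) (P g 0).
  exists (m + be * ((M - m) / 4)), M; split; last lra.
  move=> x; rewrite iterSr; have /andP[_ ->] := bounds N x; rewrite andbT.
  have := HN (fun y => P g y - m) ((M - m) / 4) 0 (cperB cPg (cper_cst _ m)).
  move=> /(_ _ D4 _ x); rewrite iterB//.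
  have := ler_wpM2r D4 beb; set U := iter N P (P g) x => h1 h2.
  suff : beta * ((M - m) / 4) <= U - m by lra.
  apply: h2 => [y|q /modg].
    by rewrite subr_ge0; have /andP[] := Pgm y.
  by rewrite ler_norml => /andP[]; lra.
exists m, (M - be * ((M - m) / 4)); split; last lra.
move=> x; rewrite iterSr; have /andP[-> _] := bounds N x; rewrite /=.
have := HN (fun y => - (P g y - M)) ((M - m) / 4) 0 (cperN (cperB cPg (cper_cst _ M))).
move=> /(_ _ D4 _ x); rewrite iterN; last exact: cperB cPg (cper_cst _ M).
rewrite iterB//.
have := ler_wpM2r D4 beb; set U := iter N P (P g) x => h1 h2.
suff : beta * ((M - m) / 4) <= - (U - M) by lra.
apply: h2 => [y|q /modg].
  by rewrite opprB subr_ge0; have /andP[] := Pgm y.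
by rewrite ler_norml => /andP[]; lra.
Qed.

Lemma osc_iter (e : R) : 0 < e -> forall g, cper g -> exists n m M,
  (forall x, m <= iter n P g x <= M) /\ M - m <= e.
Proof.
move=> e0 g cg; have [N [th /andP[th0 th1] HN]] := osc_contraction.
have [K HK] := cper_bounded cg.
have Hk k : exists m M, (forall x, m <= iter (k * N) P g x <= M) /\ M - m <= th ^+ k * (K + K).
  elim: k => [|k [m [M [IH1 IH2]]]].
    exists (- K), K; split; last by rewrite expr0 mul1r opprK.
    by move=> x; rewrite -ler_norml.
  have [m' [M' [H1 H2]]] := HN _ m M (iter_markov_cper (k * N) cg) IH1.
  exists m', M'; split; first by move=> x; rewrite mulSn iterD.
  by rewrite (le_trans H2)// exprS -mulrA ler_wpM2l.
have : th ^+ k * (K + K) @[k --> \oo] --> 0 * (K + K).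
  apply: cvgMl; apply: cvg_expr; by rewrite ger0_norm.
rewrite mul0r => /cvgrPdist_le/(_ _ e0)[k _ /(_ k (leqnn _))].
rewrite sub0r normrN => /(le_trans (ler_norm _)) ke.
have [m [M [H1 H2]]] := Hk k.
by exists (k * N)%N, m, M; split => //; exact: le_trans H2 ke.
Qed.

End doeblin.

(** * Cell problems and correctors *)

Section cell_problem.
Context (R : realType) (d : nat).
Local Notation Rd := 'rV[R]_d.
Local Notation leb := (lebesgue_rV R d).
Local Notation T := (@torus R d).
Context (a : Rd -> R) (s t C : R) (ka : decaying_kernel a s t C).

Let mT : measurable T := @measurable_torus R d.

Lemma measurable_fun_conv_integrand (f g : Rd -> R) : measurable_fun setT f ->
  measurable_fun setT g ->
  measurable_fun setT (fun p : Rd * Rd => \1_T p.1 * f p.1 * (a p.2 * g (p.1 - p.2))).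
Proof.
move=> mf mg.
have m1T : measurable_fun setT (\1_T : Rd -> R) by exact: measurable_indic.
have ma : measurable_fun setT a by exact: (measurable_fun_rV_continuous (ker_cont ka)).
have mB : measurable_fun setT (fun p : Rd * Rd => p.1 - p.2).
  apply/measurable_fun_coordP => i; under eq_fun do rewrite !mxE.
  by apply: measurable_funB; [exact: (measurableT_comp (measurable_coord i) measurable_fst)
    |exact: (measurableT_comp (measurable_coord i) measurable_snd)].
apply: measurable_funM; apply: measurable_funM.
- exact: (measurableT_comp m1T measurable_fst).
- exact: (measurableT_comp mf measurable_fst).
- exact: (measurableT_comp ma measurable_snd).
- exact: (measurableT_comp mg mB).
Qed.

(** The indicator of the torus turns the outer integral into one over the whole space. Integrability
    on the product follows from the bounds on [f] and [g] and from the integral of [a]. *)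
Lemma fubini_conv (f g : Rd -> R) : cper f -> cper g ->
  leb.-integrable setT (fun z => (a z * \int[leb]_(x in T) (f x * g (x - z)))%:E) /\
  \int[leb]_(x in T) (f x * conv a g x) =
  kint a (fun z => \int[leb]_(x in T) (f x * g (x - z))).
Proof.
move=> cf cg.
have [Kf HKf] := cper_bounded cf; have [Kg HKg] := cper_bounded cg.
have [Kc HKc] := cper_admissible ka cg.
pose F (p : Rd * Rd) := \1_T p.1 * f p.1 * (a p.2 * g (p.1 - p.2)).
have mF : measurable_fun setT F.
  by apply: measurable_fun_conv_integrand; exact: cper_measurable.
have mFE : measurable_fun setT (EFin \o F) by exact/measurable_EFinP.
have int1T (k : R) : leb.-integrable setT (fun x => (\1_T x * k)%:E).
  have := cper_torus_integrable (@cper_cst R d k).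
  move=> /(integrable_mkcond _ mT).
  apply: eq_integrable => // x _; rewrite patchE indicE.
  by case: ifPn => _; rewrite ?mul1r ?mul0r.
have iF : (leb \x leb)%E.-integrable setT (EFin \o F).
  apply/integrable12ltyP => //.
  apply: (@le_lt_trans _ _ (\int[leb]_x (\1_T x * (Kf * (Kg * \int[leb]_z a z)))%:E)%E).
    apply: ge0_le_integral => //.
    - by move=> x _; exact: integral_ge0.
    - apply: (measurable_fun_fubini_tonelli_F (abse \o (EFin \o F))).
        exact: measurableT_comp.
      by move=> x; exact: abse_ge0.
    - exact: (measurable_int _ (int1T _)).
    - move=> x _.
      have -> : (\1_T x * (Kf * (Kg * \int[leb]_z a z)))%:E =
          (\int[leb]_z (\1_T x * Kf * Kg * a z)%:E)%E.
        under eq_integral do rewrite EFinM.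
        rewrite integralZl//; last exact: integrable_ker ka.
        have ia := integrable_fin_num measurableT (integrable_ker ka).
        by rewrite !EFinM fineK// !muleA.
      apply: ge0_le_integral => //.
      + apply: measurableT_comp => //; apply/measurable_EFinP.
        exact: (measurableT_comp mF (measurable_pair1 x)).
      + apply/measurable_EFinP; apply: measurable_funM => //.
        exact: (measurable_fun_rV_continuous (ker_cont ka)).
      + move=> z _; rewrite lee_fin /F/= !normrM (ger0_norm (ker_ge0 ka z)).
        rewrite ger0_norm// -!mulrA ler_wpM2l//.
        rewrite (mulrC (a z)) ler_pM ?mulr_ge0 ?(ker_ge0 ka)//.
        by rewrite ler_wpM2r ?(ker_ge0 ka).
  by have := integrable_fin_num measurableT (int1T (Kf * (Kg * \int[leb]_z a z)));
    rewrite ltey_eq => ->.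
have HF1 x : (\int[leb]_z (F (x, z))%:E)%E = (\1_T x * (f x * conv a g x))%:E.
  rewrite /F/=; under eq_integral do rewrite EFinM.
  have ig := ker_integrable ka (HKc x).
  rewrite integralZl// (mulrA (\1_T x)) [RHS]EFinM; congr (_ * _)%E.
  by rewrite /conv /kint /Rintegral fineK//; exact: integrable_fin_num.
have HF2 z : (\int[leb]_x (F (x, z))%:E)%E =
    (a z * \int[leb]_(x in T) (f x * g (x - z)))%:E.
  have cfg : cper (fun x => f x * g (x - z)).
    apply: cperM => //; split.
      move=> x; have cs : {for x, continuous (fun x : Rd => x - z)}.
        by apply: continuousB; [exact: cvg_id|exact: cst_continuous].
      exact: (continuous_comp cs (cg.1 (x - z))).
    by move=> k x; rewrite addrAC cg.2.
  have i1 := cper_torus_integrable cfg.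
  transitivity ((a z)%:E * \int[leb]_(x in T) (f x * g (x - z))%:E)%E; last first.
    by rewrite EFinM /Rintegral fineK//; exact: integrable_fin_num.
  rewrite -integralZl// [RHS]integral_mkcond; apply: eq_integral => x _.
  rewrite /F patchE indicE; case: ifPn => _; rewrite ?mul1r ?mul0r//.
  by rewrite -EFinM mulrCA.
split.
  under eq_fun do rewrite -HF2.
  apply/integrableP; split; first exact: (measurable_fubini_G iF).
  apply: le_lt_trans ((integrable21ltyP leb leb mFE).1 iF).
  apply: ge0_le_integral => //.
  - by apply: measurableT_comp => //; exact: (measurable_fubini_G iF).
  - apply: (measurable_fun_fubini_tonelli_G (abse \o (EFin \o F))).
      exact: measurableT_comp.
    by move=> x; exact: abse_ge0.
  - move=> z _; apply: le_abse_integral => //.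
    exact: (measurableT_comp mFE (measurable_pair2 z)).
rewrite Rintegral_mkcond /kint /Rintegral; congr fine.
under [RHS]eq_integral do rewrite -HF2.
rewrite -(Fubini iF); apply: eq_integral => x _.
rewrite HF1 patchE indicE; case: ifPn => _; by rewrite ?mul1r ?mul0r.
Qed.

(** After Fubini, the change [z -> - z] uses that [a] is even, and a translation of the periodic
    integrand by [- z] exchanges the roles of [f] and [g]. *)
Lemma conv_symmetric (f g : Rd -> R) : cper f -> cper g ->
  \int[leb]_(x in T) (f x * conv a g x) = \int[leb]_(x in T) (g x * conv a f x).
Proof.
move=> cf cg; have [i1 ->] := fubini_conv cf cg; have [_ ->] := fubini_conv cg cf.
rewrite /kint (Rintegral_affine 0 (r := -1)) ?oppr_eq0 ?oner_eq0//.
rewrite normrN1 expr1n mul1r; apply: eq_Rintegral => z _.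
rewrite add0r scaleN1r (ker_even ka); congr (_ * _).
have cfg : cper (fun x => f x * g (x - - z)).
  apply: cperM => //; split.
    move=> x; have cs : {for x, continuous (fun x : Rd => x - - z)}.
      by apply: continuousB; [exact: cvg_id|exact: cst_continuous].
    exact: (continuous_comp cs (cg.1 (x - - z))).
  by move=> k x; rewrite addrAC cg.2.
rewrite -(Rintegral_torus_shift (- z) cfg.2 (cper_measurable cfg)).
by apply: eq_Rintegral => x _; rewrite opprK subrK mulrC.
Qed.

Context (a_int : 0 < \int[leb]_x a x).
Context (mu : Rd -> R) (alpha1 alpha2 : R) (mu_cper : cper mu).
Context (alpha1_gt0 : 0 < alpha1) (mu_bnd : forall x, alpha1 <= mu x <= alpha2).

Local Notation P := (markov a mu).

Let c0 x : 0 < mass a mu x.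
Proof. exact: (mass_gt0 ka a_int mu_cper alpha1_gt0 mu_bnd). Qed.

Let Pcper n g := @iter_markov_cper R d a s t C ka a_int mu alpha1 alpha2 mu_cper alpha1_gt0 mu_bnd n g.

(** Detailed balance: [mu * mass] is a reversible density for the chain, because
    [mu x * a (x - y) * mu y] is symmetric in [x] and [y]. *)
Lemma markov_invariant g : cper g ->
  \int[leb]_(x in T) (mu x * mass a mu x * P g x) =
  \int[leb]_(x in T) (mu x * mass a mu x * g x).
Proof.
move=> cg; transitivity (\int[leb]_(x in T) (mu x * conv a (fun y => mu y * g y) x)).
  apply: eq_Rintegral => x _; rewrite /markov -!mulrA; congr (_ * _).
  by rewrite mulVKf// gt_eqF.
rewrite conv_symmetric//; last exact: cperM.
by apply: eq_Rintegral => x _; rewrite /mass mulrAC.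
Qed.

(** The iterates become almost constant, and the invariant density keeps their weighted mean equal
    to 0. An interval of length at most [e] that contains all values must then contain 0. *)
Lemma iter_markov_vanish g (e : R) : cper g -> 0 < e ->
  \int[leb]_(x in T) (mu x * mass a mu x * g x) = 0 ->
  exists n, forall x, `|iter n P g x| <= e.
Proof.
move=> cg e0 g0; have [n [m [M [H1 H2]]]] := osc_iter ka a_int mu_cper alpha1_gt0 mu_bnd e0 cg.
have cm : cper (mass a mu) by exact: (mass_cper ka).
have I0 : \int[leb]_(x in T) (mu x * mass a mu x * iter n P g x) = 0.
  by elim: n {H1} => // n IH; rewrite /= markov_invariant//; exact: Pcper.
have cmm : cper (fun x => mu x * mass a mu x) by exact: cperM.
have mup x : alpha1 <= mu x by have /andP[] := mu_bnd x.
pose A := \int[leb]_x a x.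
have w0 x : alpha1 * (alpha1 * A) <= mu x * mass a mu x.
  rewrite ler_pM ?mulr_ge0 ?(ltW alpha1_gt0) ?(ltW a_int)//.
  by have /andP[] := mass_bounds ka mu_cper mu_bnd x.
have W : 0 < alpha1 * (alpha1 * A) by rewrite !mulr_gt0.
have m0 : m <= 0.
  rewrite leNgt; apply/negP => m0.
  have := @Rintegral_torus_ge R d (fun x => mu x * mass a mu x * iter n P g x)
    (alpha1 * (alpha1 * A) * m) (cperM cmm (Pcper n cg)).
  rewrite I0 leNgt mulr_gt0//= => /(_ _)/notF; apply => x.
  by apply: ler_pM => //; [exact: ltW|exact: ltW|have /andP[] := H1 x].
have M0 : 0 <= M.
  rewrite leNgt; apply/negP => M0.
  have := @Rintegral_torus_ge R d (fun x => - (mu x * mass a mu x * iter n P g x))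
    (alpha1 * (alpha1 * A) * - M) (cperN (cperM cmm (Pcper n cg))).
  have -> : \int[leb]_(x in T) - (mu x * mass a mu x * iter n P g x) = 0.
    under eq_Rintegral do rewrite -mulN1r.
    by rewrite RintegralZl ?I0 ?mulr0//; exact: cper_torus_integrable (cperM cmm (Pcper n cg)).
  rewrite leNgt mulr_gt0 ?oppr_gt0//= => /(_ _)/notF; apply => x.
  rewrite -mulrN; apply: ler_pM => //; [exact: ltW|by rewrite oppr_ge0 ltW|].
  by rewrite lerN2; have /andP[] := H1 x.
exists n => x; have /andP[h1 h2] := H1 x.
by rewrite ler_norml; apply/andP; split; lra.
Qed.

(* Fredholm alternative up to an arbitrarily small error: chi = - sum_(k < n) P^k g
   solves (P - 1) chi = g - P^n g. *)
Lemma approx_cell_solution F (e : R) : cper F -> 0 < e ->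
  \int[leb]_(x in T) (mu x * F x) = 0 ->
  exists2 chi : Rd -> R, cper chi &
    forall x, `|kint a (fun z => mu (x - z) * (chi (x - z) - chi x)) - F x| <= e.
Proof.
move=> cF e0 F0; have cm : cper (mass a mu) by exact: (mass_cper ka).
(* Dividing by [mass] gives the equation the form [(P - 1) chi = g], and the condition on [F]
   becomes zero mean of [g] for the invariant density [mu * mass]. *)
pose g x := (mass a mu x)^-1 * F x.
have cg : cper g by apply: cperM => //; apply: cperV => // x; rewrite gt_eqF.
have a2A : 0 < alpha2 * \int[leb]_x a x.
  by have /andP[_] := mass_bounds ka mu_cper mu_bnd 0; exact: lt_le_trans.
have e'0 : 0 < e / (alpha2 * \int[leb]_x a x) by rewrite divr_gt0.
(* The residual [P^n g] is multiplied back by [mass], which is at most [alpha2] times the integral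
   of [a]. *)
have [n Hn] : exists n, forall x, `|iter n P g x| <= e / (alpha2 * \int[leb]_x a x).
  apply: iter_markov_vanish => //; rewrite -[RHS]F0; apply: eq_Rintegral => x _.
  by rewrite /g -mulrA mulVKf// gt_eqF.
pose chi k x := - \sum_(i < k) iter i P g x.
have cchi k : cper (chi k) by apply: cperN; apply: cper_sum => i; exact: Pcper.
exists (chi n) => // x.
have Pchi k : P (chi k) x - chi k x = g x - iter k P g x.
  elim: k => [|k IH].
    have -> : chi 0%N = fun=> 0 by apply/funext => y; rewrite /chi big_ord0 oppr0.
    by rewrite (markov_cst ka a_int mu_cper alpha1_gt0 mu_bnd) !subrr.
  have E : chi k.+1 = fun y => chi k y - iter k P g y.
    by apply/funext => y; rewrite /chi big_ord_recr/= opprD.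
  rewrite {1}E (markovB ka mu_cper)//; last exact: Pcper.
  by rewrite E -/(iter k.+1 P g x); move: IH => /=; lra.
have [K HK] := cper_admissible ka (cperM mu_cper (cchi n)).
have [K' HK'] := cper_admissible ka mu_cper.
have -> : kint a (fun z => mu (x - z) * (chi n (x - z) - chi n x)) =
    mass a mu x * (P (chi n) x - chi n x).
  transitivity (kint a (fun z => mu (x - z) * chi n (x - z) - chi n x * mu (x - z))).
    by apply: eq_Rintegral => z _; congr (_ * _); rewrite mulrBr (mulrC (chi n x)).
  rewrite (kintB ka (HK x) (admissibleZ (chi n x) (HK' x))) (kintZ ka _ (HK' x)).
  by rewrite /markov mulrBr mulVKf ?gt_eqF// mulrC.
rewrite Pchi /g mulrBr mulVKf ?gt_eqF// addrAC subrr sub0r normrN normrM gtr0_norm//.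
have /andP[_ mx] := mass_bounds ka mu_cper mu_bnd x.
rewrite (le_trans (ler_pM _ _ mx (Hn x)))//; first exact: ltW.
by rewrite mulrC divfK// gt_eqF.
Qed.

End cell_problem.

(** * Decaying kernels convolved with integrable periodic functions *)

Section periodic_convolution.
Context (R : realType) (d : nat).
Local Notation Rd := 'rV[R]_d.
Local Notation leb := (lebesgue_rV R d).
Local Notation T := (@torus R d).
Context (t : R) (t0 : 0 < t) (b : Rd -> R) (B : R).
Context (cb : continuous b) (bB : forall z, `|b z| <= B * weight t z).
Implicit Types (f : Rd -> R).

Let mT : measurable T := @measurable_torus R d.

Lemma weightN (z : Rd) : weight t (- z) = weight t z.
Proof. by rewrite /weight normrN. Qed.

Let B0 : 0 <= B.
Proof.
by rewrite -(pmulr_lge0 _ (weight_gt0 t (0 : Rd))) (le_trans _ (bB 0)).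
Qed.

Lemma reflect_le_weight (M : R) x q : `|x| <= M ->
  `|b (x - q)| <= B * (1 + M) `^ (d%:R + t) * weight t q.
Proof.
move=> xM; rewrite (le_trans (bB _))// -mulrA ler_wpM2l//.
by rewrite -(weightN q) addrC weight_shift.
Qed.

Lemma measurable_reflect_kernel f x : measurable_fun setT f ->
  measurable_fun setT (fun q : Rd => b (x - q) * f q).
Proof.
move=> mf; apply: measurable_funM => //; apply: measurable_reflect.
exact: measurable_fun_rV_continuous.
Qed.

Lemma integrable_weight_norm (k : R) f : Zd_periodic f -> measurable_fun setT f ->
  leb.-integrable T (EFin \o f) ->
  leb.-integrable setT (fun q => (k * (weight t q * `|f q|))%:E).
Proof.
move=> pf mf fi.
have h : leb.-integrable setT (fun x => (weight t x * `|f x|)%:E).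
  apply: integrable_weightM => //; [by move=> z x; rewrite pf|exact: measurableT_comp|].
  exact: (integrable_abse fi).
exact: (integrableZl measurableT k h).
Qed.

Lemma integrable_reflect_kernel f x : Zd_periodic f -> measurable_fun setT f ->
  leb.-integrable T (EFin \o f) ->
  leb.-integrable setT (fun q => (b (x - q) * f q)%:E).
Proof.
move=> pf mf fi.
apply: (le_integrable measurableT _ _
  (integrable_weight_norm (B * (1 + `|x|) `^ (d%:R + t)) pf mf fi)).
  by apply/measurable_EFinP; exact: measurable_reflect_kernel.
move=> q _; rewrite !abse_EFin lee_fin (le_trans _ (ler_norm _))//.
by rewrite normrM mulrA ler_wpM2r// reflect_le_weight.
Qed.

(** All the regularity comes from the kernel, since [f] is merely integrable over a period. For
    bounded [x], translates of the weight are comparable with the weight itself, which gives the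
    dominating function. *)
Lemma reflect_kernel_continuous f : Zd_periodic f -> measurable_fun setT f ->
  leb.-integrable T (EFin \o f) ->
  continuous (fun x : Rd => \int[leb]_q (b (x - q) * f q)).
Proof.
move=> pf mf fi x; apply: sequential_continuous => u ux.
have /cvgrPdist_lt/(_ _ ltr01)[N _ HN] := ux.
rewrite -(cvg_shiftn N); apply: fine_cvg; rewrite fineK; last first.
  by apply: integrable_fin_num => //; exact: integrable_reflect_kernel.
apply: (@dominated_cvg _ _ _ leb setT measurableT _ _
    (fun q => (B * (1 + (`|x| + 1)) `^ (d%:R + t) * (weight t q * `|f q|))%:E)) => //.
- by move=> k; apply/measurable_EFinP; exact: measurable_reflect_kernel.
- move=> q _; apply: cvg_EFin; first exact: nearW.
  apply: cvgMl.
  have uq : (u (k + N)%N - q) @[k --> \oo] --> x - q.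
    by apply: cvgB; [rewrite (cvg_shiftn N)|exact: cvg_cst].
  by apply: continuous_cvg; [exact: cb|exact: uq].
- exact: integrable_weight_norm.
- move=> k q _; rewrite abse_EFin lee_fin normrM mulrA ler_wpM2r//.
  apply: reflect_le_weight; rewrite -lerBlDl (le_trans (lerB_dist _ _))// distrC.
  by apply: ltW; apply: HN => /=; exact: leq_addl.
Qed.

Lemma reflect_kernel_periodic f x (k : 'rV[int]_d) : Zd_periodic f -> measurable_fun setT f ->
  leb.-integrable T (EFin \o f) ->
  \int[leb]_q (b (x + map_mx intr k - q) * f q) = \int[leb]_q (b (x - q) * f q).
Proof.
move=> pf mf fi.
rewrite (Rintegral_affine (map_mx intr k) (oner_neq0 R)); last exact: integrable_reflect_kernel.
rewrite normr1 expr1n mul1r; apply: eq_Rintegral => q _; rewrite scale1r.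
rewrite (addrC _ q) pf; congr (b _ * _).
by apply/rowP => i; rewrite !mxE; ring.
Qed.

(** Two functions equal almost everywhere on the torus are thus indistinguishable under these
    integrals: [integral_weight_periodic] bounds the integral over the whole space by the one over a
    period. *)
Lemma reflect_kernel_ae0 f x : Zd_periodic f -> measurable_fun setT f ->
  (\int[leb]_(q in T) `|(f q)%:E| = 0)%E -> \int[leb]_q (b (x - q) * f q) = 0.
Proof.
move=> pf mf f0.
have fi : leb.-integrable T (EFin \o f).
  apply/integrableP; split; first by apply/measurable_EFinP; exact: measurable_funTS.
  by rewrite [X in (X < _)%E]f0 ltry.
have i1 := integrable_reflect_kernel x pf mf fi.
apply/eqP; rewrite -normr_le0 (le_trans (le_normr_Rintegral _ i1))//.
pose k := B * (1 + `|x|) `^ (d%:R + t).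
have i2 := integrable_weight_norm k pf mf fi.
apply: (@le_trans _ _ (\int[leb]_q (k * (weight t q * `|f q|)))).
  apply: le_Rintegral => //; first by have := integrable_abse i1.
  by move=> q _; rewrite normrM mulrA ler_wpM2r// reflect_le_weight.
have k0 : 0 <= k by rewrite mulr_ge0// powR_ge0.
have [K K0 HK] := @integral_weight_periodic R d t t0.
have i3 : leb.-integrable setT (fun q => (weight t q * `|f q|)%:E).
  have := integrable_weight_norm 1 pf mf fi.
  by apply: eq_integrable => // q _; rewrite mul1r.
rewrite RintegralZl// mulr_ge0_le0//.
rewrite -lee_fin fineK; last exact: integrable_fin_num.
rewrite -[X in (_ <= X)%E](mule0 K%:E) -f0.
under eq_integral do rewrite EFinM.
apply: HK => //; first by move=> z y; rewrite pf.
by apply/measurable_EFinP; exact: measurableT_comp.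
Qed.

End periodic_convolution.

(** * Continuous correctors and the effective matrix *)

Section correctors.
Context (R : realType) (d : nat).
Local Notation Rd := 'rV[R]_d.
Local Notation leb := (lebesgue_rV R d).
Local Notation T := (@torus R d).
Context (a : Rd -> R) (s t C : R) (ka : decaying_kernel a s t C).

Let mT : measurable T := @measurable_torus R d.

Lemma norm_le_growth (z : Rd) (k : nat) : (k <= 2)%N -> `|z| ^+ k <= growth s z.
Proof.
move=> k2; have /andP[s0 _] := ker_s ka.
have z1 : 1 <= 1 + `|z| by rewrite lerDl.
apply: (@le_trans _ _ ((1 + `|z|) ^+ k)); first by rewrite lerXn2r ?nnegrE ?addr_ge0// lerDr.
apply: (@le_trans _ _ ((1 + `|z|) ^+ 2)); first by rewrite ler_weXn2l.
rewrite /growth ler_peMr ?exprn_ge0 ?addr_ge0//.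
have := @ge0_ler_powR R s (ltW s0) 1 (1 + `|z|); rewrite powR1; apply => //;
by rewrite nnegrE ?addr_ge0.
Qed.

Lemma ker_growth_le (H : Rd -> R) z : `|H z| <= growth s z -> `|a z * H z| <= C * weight t z.
Proof.
move=> Hz; rewrite normrM (ger0_norm (ker_ge0 ka z)) (le_trans _ (ker_decay ka z))//.
by rewrite ler_wpM2l ?(ker_ge0 ka).
Qed.

Lemma admissible_growthM (H f : Rd -> R) : measurable_fun setT H ->
  (forall z, `|H z| <= growth s z) -> cper f ->
  exists K, forall x, admissible s K (fun z => H z * f (x - z)).
Proof.
move=> mH HH cf; have [K HK] := cper_bounded cf; exists K => x; split.
  by apply: measurable_funM => //; apply: measurable_reflect; exact: cper_measurable.
move=> z; rewrite normrM mulrC ler_pM//.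
Qed.

Lemma kint_growth_cper (H f : Rd -> R) : measurable_fun setT H ->
  (forall z, `|H z| <= growth s z) -> cper f ->
  cper (fun x => kint a (fun z => H z * f (x - z))).
Proof.
move=> mH HH cf; have [K HK] := admissible_growthM mH HH cf; split; last first.
  move=> k x; apply: eq_Rintegral => z _; congr (_ * (_ * _)).
  by rewrite addrAC cf.2.
apply: (kint_continuous ka HK) => z x; apply: continuousM; first exact: cst_continuous.
have cs : {for x, continuous (fun x : Rd => x - z)}.
  by apply: continuousB; [exact: cvg_id|exact: cst_continuous].
exact: (continuous_comp cs (cf.1 (x - z))).
Qed.

Lemma kint_reflect (H f : Rd -> R) x :
  leb.-integrable setT (fun q => (a (x - q) * H (x - q) * f q)%:E) ->
  \int[leb]_q (a (x - q) * H (x - q) * f q) = kint a (fun z => H z * f (x - z)).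
Proof.
move=> i1; rewrite (Rintegral_affine x (r := -1))// ?oppr_eq0 ?oner_eq0//.
rewrite normrN1 expr1n mul1r; apply: eq_Rintegral => z _.
by rewrite scaleN1r opprB addrC subrK mulrA.
Qed.

Context (a_int : 0 < \int[leb]_x a x).
Context (lam mu : Rd -> R) (alpha1 alpha2 : R) (lam_cper : cper lam) (mu_cper : cper mu).
Context (alpha1_gt0 : 0 < alpha1).
Context (lam_bnd : forall x, alpha1 <= lam x <= alpha2).
Context (mu_bnd : forall x, alpha1 <= mu x <= alpha2).
Context (kappa : 'I_d -> Rd -> R) (Theta : 'M[R]_d).
Context (kappaP : is_corrector a mu kappa) (ThetaP : is_effective_matrix a lam mu kappa Theta).

Let pk i : Zd_periodic (kappa i). Proof. by have [] := kappaP.1 i. Qed.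
Let mk i : measurable_fun setT (kappa i). Proof. by have [] := kappaP.1 i. Qed.

Let ik i : leb.-integrable T (EFin \o kappa i).
Proof.
have [_ _ k2 _] := kappaP.1 i.
have i1 := cper_torus_integrable (@cper_cst R d 1).
apply: (le_integrable mT _ _ (integrableD mT i1 k2)).
  by apply/measurable_EFinP; exact: measurable_funTS.
move=> x _ /=; rewrite lee_fin [leRHS]ger0_norm ?addr_ge0 ?sqr_ge0//.
(* The inequality [|k| <= 1 + k ^ 2] gives integrability from square integrability on a set of
   finite measure. *)
have := sqr_ge0 (`|kappa i x| - 1); rewrite sqrrB1 real_normK ?num_real//.
by have := normr_ge0 (kappa i x); rewrite mulr2n; lra.
Qed.

Let imk (f : Rd -> R) : measurable_fun setT f -> leb.-integrable T (EFin \o f) ->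
  leb.-integrable T (EFin \o (fun x => mu x * f x)).
Proof.
move=> mf fi; have [K HK] := cper_bounded mu_cper.
apply: (le_integrable mT _ _ (integrableZl mT K fi)).
  apply/measurable_EFinP; apply: measurable_funTS; apply: measurable_funM => //.
  exact: cper_measurable.
move=> x _; rewrite -EFinM !abse_EFin lee_fin !normrM ler_wpM2r//.
by rewrite (le_trans (HK x))// ler_norm.
Qed.

Let c0 x : 0 < mass a mu x.
Proof. exact: (mass_gt0 ka a_int mu_cper alpha1_gt0 mu_bnd). Qed.

Let coord_growth (i : 'I_d) (z : Rd) : `|z ord0 i| <= growth s z.
Proof.
by rewrite (le_trans (rV_norm_coord z i))// -[leLHS]expr1 norm_le_growth.
Qed.

Let S i x := \int[leb]_q (a (x - q) * (mu q * kappa i q)).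
Let drift i x := kint a (fun z => z ord0 i * mu (x - z)).

(* the continuous representative of kappa, read off the corrector equation *)
Definition corrector i x := (mass a mu x)^-1 * (S i x - drift i x).

Let pmk i : Zd_periodic (fun q => mu q * kappa i q).
Proof. by move=> z x; rewrite pk mu_cper.2. Qed.

Let mmk i : measurable_fun setT (fun q => mu q * kappa i q).
Proof. by apply: measurable_funM => //; exact: cper_measurable. Qed.

Let aw z : `|a z| <= C * weight t z.
Proof. by rewrite ger0_norm ?(ker_ge0 ka)// (ker_le_weight ka). Qed.

Lemma corrector_cper i : cper (corrector i).
Proof.
apply: cperM; first by apply: cperV => [|x]; [exact: (mass_cper ka)|rewrite gt_eqF].
apply: cperB; last first.
  by apply: kint_growth_cper => //; exact: measurable_coord.
have t0 := ker_t ka; split.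
  by apply: (reflect_kernel_continuous t0 (ker_cont ka) aw) => //; exact: imk.
by move=> k x; apply: (reflect_kernel_periodic t0 (ker_cont ka) aw) => //; exact: imk.
Qed.

(** The corrector equation reads [S i x - kappa i x * mass a mu x = drift i x]: the pointwise value
    of [kappa] occurs only as a factor of the positive mass, so it can be solved for. *)
Lemma corrector_ae i : {ae leb, forall x, T x -> kappa i x = corrector i x}.
Proof.
apply: filterS kappaP.2 => x eqx Tx; have {eqx} := eqx Tx i.
have t0 := ker_t ka.
have i1 := integrable_reflect_kernel t0 (ker_cont ka) aw x (pmk i) (mmk i) (imk (mk i) (ik i)).
have i2 := integrable_reflect_kernel t0 (ker_cont ka) aw x mu_cper.2 (cper_measurable mu_cper)
  (cper_torus_integrable mu_cper).
have -> : \int[leb]_q (a (x - q) * mu q * (kappa i q - kappa i x)) =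
    S i x - kappa i x * mass a mu x.
  have -> : mass a mu x = \int[leb]_q (a (x - q) * mu q).
    rewrite /mass /conv (_ : (fun z => mu (x - z)) = fun z => (fun=> 1) z * mu (x - z)); last first.
      by apply/funext => z; rewrite mul1r.
    rewrite -(kint_reflect (H := fun=> 1)).
      by apply: eq_Rintegral => q _; rewrite mulr1.
    by apply: eq_integrable i2 => // q _; rewrite mulr1.
  rewrite -RintegralZl// /S -RintegralB//; last exact: (integrableZl measurableT (kappa i x) i2).
  by apply: eq_Rintegral => q _; ring.
have -> : \int[leb]_q (a (x - q) * (x - q) ord0 i * mu q) = drift i x.
  rewrite (kint_reflect (H := fun z => z ord0 i))//.
  have cb : continuous (fun z : Rd => a z * z ord0 i).
    move=> z; apply: continuousM; first exact: (ker_cont ka).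
    exact: coord_continuous.
  apply: (integrable_reflect_kernel t0 cb (B := C)) mu_cper.2 (cper_measurable mu_cper)
    (cper_torus_integrable mu_cper).
  by move=> z; apply: (ker_growth_le (H := fun z => z ord0 i)).
rewrite /corrector => <-; rewrite opprB addrCA subrr addr0 mulrC mulfK//.
by rewrite gt_eqF.
Qed.

Let kernel_corrector (b : Rd -> R) i x : continuous b -> (forall z, `|b z| <= C * weight t z) ->
  \int[leb]_q (b (x - q) * (mu q * kappa i q)) =
  \int[leb]_q (b (x - q) * (mu q * corrector i q)).
Proof.
move=> cb bw; have t0 := ker_t ka.
have cc := corrector_cper i; have cmc := cperM mu_cper cc.
have i1 := integrable_reflect_kernel t0 cb bw x (pmk i) (mmk i) (imk (mk i) (ik i)).
have i2 := integrable_reflect_kernel t0 cb bw x cmc.2 (cper_measurable cmc)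
  (cper_torus_integrable cmc).
apply/eqP; rewrite -subr_eq0 -RintegralB//; apply/eqP.
transitivity (\int[leb]_q (b (x - q) * (mu q * kappa i q - mu q * corrector i q))).
  by apply: eq_Rintegral => q _; rewrite mulrBr.
have mdiff : measurable_fun setT (fun q => mu q * kappa i q - mu q * corrector i q).
  by apply: measurable_funB => //; exact: cper_measurable.
apply: (reflect_kernel_ae0 t0 cb bw) => //.
  by move=> z y; rewrite pmk cmc.2.
transitivity (\int[leb]_(q in T) 0)%E; last by rewrite integral0.
apply: ae_eq_integral => //.
  by apply: measurable_funTS; apply/measurable_EFinP; exact: measurableT_comp.
apply: filterS (corrector_ae i) => q kq Tq.
by rewrite kq// subrr abse0.
Qed.

(** The equation now holds at every point: by definition [corrector] solves it with [kappa] inside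
    the integral, and there [kappa] may be replaced by the almost everywhere equal [corrector]. *)
Lemma corrector_eq i x :
  kint a (fun z => mu (x - z) * (corrector i (x - z) - corrector i x)) =
  kint a (fun z => mu (x - z) * z ord0 i).
Proof.
have cmc := cperM mu_cper (corrector_cper i).
have [K HK] := cper_admissible ka cmc.
have [K' HK'] := cper_admissible ka mu_cper.
transitivity (kint a (fun z => mu (x - z) * corrector i (x - z) - corrector i x * mu (x - z))).
  by apply: eq_Rintegral => z _; congr (_ * _); rewrite mulrBr (mulrC (corrector i x)).
rewrite (kintB ka (HK x) (admissibleZ (corrector i x) (HK' x))) (kintZ ka _ (HK' x)).
have -> : kint a (fun z => mu (x - z) * corrector i (x - z)) = S i x.
  rewrite /S (kernel_corrector i x (ker_cont ka) aw).
  have i2 := integrable_reflect_kernel (ker_t ka) (ker_cont ka) aw x cmc.2 (cper_measurable cmc)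
    (cper_torus_integrable cmc).
  rewrite (_ : (fun z => _) = fun z => (fun=> 1) z * (mu (x - z) * corrector i (x - z))); last first.
    by apply/funext => z; rewrite mul1r.
  rewrite -(kint_reflect (H := fun=> 1) (f := fun q => mu q * corrector i q)).
    by apply: eq_Rintegral => q _; rewrite mulr1.
  by apply: eq_integrable i2 => // q _; rewrite mulr1.
have -> : corrector i x * kint a (fun z => mu (x - z)) = S i x - drift i x.
  by rewrite /corrector [LHS]mulrC mulVKf// gt_eqF//; exact: c0.
rewrite opprB addrC subrK.
by apply: eq_Rintegral => z _; rewrite (mulrC (z _ _)).
Qed.

Let quad (i j : 'I_d) x := kint a (fun z => (2^-1 * z ord0 i * z ord0 j) * mu (x - z)).
Let cross i j x := kint a (fun z => z ord0 i * (mu (x - z) * corrector j (x - z))).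

Let quad_growth (i j : 'I_d) (z : Rd) : `|2^-1 * z ord0 i * z ord0 j| <= growth s z.
Proof.
apply: le_trans (norm_le_growth z (leqnn 2)).
rewrite !normrM expr2 ler_pM ?mulr_ge0//; last exact: rV_norm_coord.
rewrite -[leRHS]mul1r ler_pM//; last exact: rV_norm_coord.
by rewrite ger0_norm ?invr_ge0// invf_le1// ler1n.
Qed.

Let mquad (i j : 'I_d) : measurable_fun setT (fun z : Rd => 2^-1 * z ord0 i * z ord0 j).
Proof.
by apply: measurable_funM; [apply: measurable_funM => //|]; exact: measurable_coord.
Qed.

Let quad_cper i j : cper (quad i j).
Proof. by apply: kint_growth_cper => //; exact: quad_growth. Qed.

Let cross_cper i j : cper (cross i j).
Proof.
apply: (kint_growth_cper (H := fun z => z ord0 i)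
  (f := fun y => mu y * corrector j y)) => //; first exact: measurable_coord.
exact: cperM mu_cper (corrector_cper j).
Qed.

(** In this form the definition of [Theta] is the compatibility condition of the second cell
    problem: [Theta i j / lam] and [quad i j - cross i j] have the same integral against [mu]. *)
Lemma effective_matrixE i j : Theta i j * \int[leb]_(x in T) (mu x / lam x) =
  \int[leb]_(x in T) (mu x * quad i j x) - \int[leb]_(x in T) (mu x * cross i j x).
Proof.
have t0 := ker_t ka.
rewrite ThetaP; congr (_ - _); apply: eq_Rintegral => x _.
  have cb : continuous (fun z : Rd => a z * (2^-1 * z ord0 i * z ord0 j)).
    have cH : continuous (fun z : Rd => 2^-1 * z ord0 i * z ord0 j).
      move=> z; apply: (@continuousM _ _ (fun z : Rd => 2^-1 * z ord0 i) (fun z : Rd => z ord0 j)).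
        by apply: continuousM; [exact: cst_continuous|exact: coord_continuous].
      exact: coord_continuous.
    by move=> z; apply: (continuousM (ker_cont ka (x := z)) (cH z)).
  have cmu := cper_torus_integrable mu_cper.
  have i2 : leb.-integrable setT (fun q => (a (x - q) * (2^-1 * (x - q) ord0 i * (x - q) ord0 j) * mu q)%:E).
    apply: (integrable_reflect_kernel t0 cb (B := C)) mu_cper.2 (cper_measurable mu_cper) cmu.
    by move=> z; apply: (ker_growth_le (H := fun z => 2^-1 * z ord0 i * z ord0 j)); exact: quad_growth.
  rewrite /quad -(kint_reflect (H := fun z => 2^-1 * z ord0 i * z ord0 j))// -RintegralZl//.
  by apply: eq_Rintegral => q _; ring.
have cb : continuous (fun z : Rd => a z * z ord0 i).
  by move=> z; apply: continuousM; [exact: (ker_cont ka)|exact: coord_continuous].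
have bw z : `|a z * z ord0 i| <= C * weight t z by exact: (ker_growth_le (H := fun z => z ord0 i)).
have cmc := cperM mu_cper (corrector_cper j).
have i2 := integrable_reflect_kernel t0 cb bw x cmc.2 (cper_measurable cmc)
  (cper_torus_integrable cmc).
have i1 := integrable_reflect_kernel t0 cb bw x (pmk j) (mmk j) (imk (mk j) (ik j)).
rewrite /cross -(kint_reflect (H := fun z => z ord0 i) (f := fun q => mu q * corrector j q))//.
rewrite -(kernel_corrector j x cb bw) -RintegralZl//.
by apply: eq_Rintegral => q _; ring.
Qed.

Lemma correctors_exist : exists k1 : 'I_d -> Rd -> R, [/\ forall i, cper (k1 i),
  forall i x, kint a (fun z => mu (x - z) * (k1 i (x - z) - k1 i x - z ord0 i)) = 0 &
  forall e, 0 < e -> exists chi : 'I_d -> 'I_d -> Rd -> R,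
    (forall i j, cper (chi i j)) /\
    forall i j x, `|kint a (fun z => mu (x - z) * (2^-1 * z ord0 i * z ord0 j -
       z ord0 i * k1 j (x - z) + chi i j (x - z) - chi i j x)) - Theta i j / lam x| <= e].
Proof.
exists corrector; split; first exact: corrector_cper.
  move=> i x.
  have [K HK] := admissible_growthM (@measurable_coord R d i) (coord_growth i) mu_cper.
  have cc := corrector_cper i.
  have [K' HK'] := cper_admissible ka (cperM mu_cper cc).
  have [K2 HK2] := cper_admissible ka mu_cper.
  transitivity (kint a (fun z => (mu (x - z) * corrector i (x - z) - corrector i x * mu (x - z)) -
      z ord0 i * mu (x - z))).
    by apply: eq_Rintegral => z _; congr (_ * _); ring.
  have aZ := admissibleZ (- corrector i x) (HK2 x).
  have aB := admissibleD (HK' x) aZ.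
  have E : (fun z => mu (x - z) * corrector i (x - z) - corrector i x * mu (x - z)) =
    fun z => mu (x - z) * corrector i (x - z) + - corrector i x * mu (x - z).
    by apply/funext => z; ring.
  rewrite -E in aB.
  rewrite (kintB ka aB (HK x)); apply/eqP; rewrite subr_eq0; apply/eqP.
  transitivity (kint a (fun z => mu (x - z) * (corrector i (x - z) - corrector i x))).
    by apply: eq_Rintegral => z _; congr (_ * _); ring.
  by rewrite corrector_eq; apply: eq_Rintegral => z _; congr (_ * _); ring.
move=> e e0.
(* The terms of the second cell problem that do not contain [chi], moved to the right-hand side. *)
pose F i j x := Theta i j * (lam x)^-1 - (quad i j x - cross i j x).
have lam0 x : 0 < lam x by have /andP[+ _] := lam_bnd x; exact: lt_le_trans.
have clV : cper (fun x => (lam x)^-1) by apply: cperV => // x; rewrite gt_eqF.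
have cF i j : cper (F i j).
  apply: cperB; first by apply: cperM => //; exact: cper_cst.
  exact: cperB.
have F0 i j : \int[leb]_(x in T) (mu x * F i j x) = 0.
  have i1 := cper_torus_integrable (cperM mu_cper clV).
  have i2 := cper_torus_integrable (cperM mu_cper (quad_cper i j)).
  have i3 := cper_torus_integrable (cperM mu_cper (cross_cper i j)).
  transitivity (\int[leb]_(x in T) (Theta i j * (mu x / lam x) - (mu x * quad i j x - mu x * cross i j x))).
    by apply: eq_Rintegral => x _; rewrite /F; ring.
  rewrite RintegralB//; [|exact: (integrableZl mT (Theta i j) i1)|exact: (integrableB mT i2 i3)].
  by rewrite RintegralZl// effective_matrixE RintegralB// subrr.
have Hchi ij : exists chi, cper chi /\ forall x,
    `|kint a (fun z => mu (x - z) * (chi (x - z) - chi x)) - F ij.1 ij.2 x| <= e.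
  have [chi c1 c2] := approx_cell_solution ka a_int mu_cper alpha1_gt0 mu_bnd
    (cF ij.1 ij.2) e0 (F0 ij.1 ij.2).
  by exists chi.
have [chi Pchi] := choice Hchi.
exists (fun i j => chi (i, j)); split => [i j|i j x]; first exact: (Pchi (i, j)).1.
have [cchi Hx] := Pchi (i, j); apply: le_trans (Hx x); rewrite /F/=.
have [Kq HKq] := admissible_growthM (mquad i j) (quad_growth i j) mu_cper.
have [Kc HKc] := admissible_growthM (@measurable_coord R d i) (coord_growth i)
  (cperM mu_cper (corrector_cper j)).
have cdiff : cper (fun y => mu y * (chi (i, j) y - chi (i, j) x)).
  by apply: cperM => //; apply: cperB => //; exact: cper_cst.
have [Kd HKd] := cper_admissible ka cdiff.
have -> : kint a (fun z => mu (x - z) * (2^-1 * z ord0 i * z ord0 j -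
       z ord0 i * corrector j (x - z) + chi (i, j) (x - z) - chi (i, j) x)) =
   quad i j x - cross i j x + kint a (fun z => mu (x - z) * (chi (i, j) (x - z) - chi (i, j) x)).
  rewrite /quad /cross -(kintB ka (HKq x) (HKc x)).
  have aB := admissibleD (HKq x) (admissibleZ (-1) (HKc x)).
  have E : (fun z : Rd => 2^-1 * z ord0 i * z ord0 j * mu (x - z) -
       z ord0 i * (mu (x - z) * corrector j (x - z))) =
     fun z : Rd => 2^-1 * z ord0 i * z ord0 j * mu (x - z) +
       -1 * (z ord0 i * (mu (x - z) * corrector j (x - z))).
    by apply/funext => z; ring.
  rewrite -E in aB; rewrite -(kintD ka aB (HKd x)).
  by apply: eq_Rintegral => z _; congr (_ * _); ring.
by rewrite le_eqVlt; apply/orP; left; apply/eqP; congr (`| _ |); ring.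
Qed.

End correctors.

(** * Operators in C_0 *)

Lemma continuous_distP (R : realType) (X : normedModType R) (f : X -> R) (x : X) :
  {for x, continuous f} <-> forall e, 0 < e -> \forall y \near x, `|f x - f y| <= e.
Proof. by split=> [/cvgrPdist_le//|H]; apply/cvgrPdist_le. Qed.

Section C0_complete.
Context (R : realType) (d : nat).
Local Notation C := (C0 R d).
Implicit Types u v : C.

Lemma C0_addE u v x : (u + v) x = u x + v x. Proof. by []. Qed.
Lemma C0_oppE u x : (- u) x = - u x. Proof. by []. Qed.
Lemma C0_subE u v x : (u - v) x = u x - v x. Proof. by []. Qed.
Lemma C0_scaleE k u x : (k *: u) x = k * u x. Proof. by []. Qed.

Lemma C0_le_norm u x : `|u x| <= `|u|. Proof. exact: C0_norm_ge. Qed.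

Lemma C0_norm_leP u (c : R) : (forall x, `|u x| <= c) -> `|u| <= c.
Proof. exact: C0_norm_le. Qed.

Lemma C0_exists (f : 'rV[R]_d -> R) : continuous f -> vanishing_at_infinity f ->
  exists u : C, forall x, u x = f x.
Proof.
move=> cf vf; have Pf : f \in @C0_pred R d by apply/asboolP.
by exists (MkC0 Pf).
Qed.

Lemma uniform_limit_C0 (f : 'rV[R]_d -> R) :
  (forall e, 0 < e -> exists u : C, forall x, `|u x - f x| <= e) ->
  exists u : C, forall x, u x = f x.
Proof.
move=> H; have cf (x : 'rV[R]_d) : {for x, continuous f}.
  apply/continuous_distP => e e0.
  have e3 : 0 < e / 3 by rewrite divr_gt0.
  have [u Hu] := H _ e3.
  have cu : {for x, continuous u} by exact: (@C0_continuous _ _ u).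
  move/continuous_distP : cu => /(_ _ e3); apply: filterS => y uxy.
  have -> : f x - f y = - (u x - f x) + (u x - u y) + (u y - f y) by ring.
  rewrite (le_trans (ler_normD _ _))// (le_trans (lerD (ler_normD _ _) (lexx _)))// normrN.
  by have := Hu x; have := Hu y; lra.
apply: C0_exists => [x|e e0]; first exact: cf.
have e2 : 0 < e / 2 by rewrite divr_gt0.
have [u Hu] := H _ e2.
have [M HM] := C0_vanishing u e2; exists M => x /HM ux.
rewrite -(subrK (u x) (f x)) (le_lt_trans (ler_normD _ _))// distrC.
by have := Hu x; lra.
Qed.

(** Pointwise limits exist by completeness of the reals. A ball of radius [e] that belongs to the
    filter bounds the distance to the pointwise limit by [e] uniformly, so the limit is again in the
    space. *)
Lemma C0_complete (F : set_system C) : ProperFilter F -> cauchy F -> cvg F.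
Proof.
move=> FF /cauchyP cF.
have Fx x : cvg ((fun u : C => u x) @ F).
  apply: cauchy_cvg; apply: cauchy_exP => e e0.
  have [u Fu] := cF _ e0; exists (u x); suff : F [set v : C | ball (u x) e (v x)] by [].
  apply: filterS Fu => v.
  rewrite -!ball_normE/=; apply: le_lt_trans; exact: (C0_le_norm (u - v)).
pose g x := lim ((fun u : C => u x) @ F).
have Fg e (u : C) : F (ball u e) -> forall x, `|u x - g x| <= e.
  move=> Fu x.
  have h : `|u x - (v : C) x| @[v --> F] --> `|u x - g x|.
    by apply: cvg_norm; apply: cvgB; [exact: cvg_cst|exact: Fx].
  apply: (cvgr_to_le h); apply: filterS Fu => v.
  rewrite -ball_normE/= => /ltW; apply: le_trans; exact: (C0_le_norm (u - v)).
have [w wg] : exists w : C, forall x, w x = g x.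
  apply: uniform_limit_C0 => e e0; have [u Fu] := cF _ e0.
  by exists u; exact: Fg.
apply/cvg_ex; exists w; apply/cvgrPdist_le => e e0.
have e2 : 0 < e / 2 by rewrite divr_gt0.
have [u Fu] := cF _ e2; near=> v.
rewrite -(subrK u w) -addrA (le_trans (ler_normD _ _))//.
have h1 : `|w - u| <= e / 2.
  by apply: C0_norm_leP => x; rewrite C0_subE wg distrC; exact: Fg.
have h2 : `|u - v| < e / 2.
  by near: v; apply: filterS Fu => v; rewrite -ball_normE.
lra.
Unshelve. all: end_near. Qed.

HB.instance Definition _ := Uniform_isComplete.Build C C0_complete.

Lemma C0_contraction_fixpoint (f : C -> C) (q : R) : 0 <= q < 1 ->
  (forall u v, `|f u - f v| <= q * `|u - v|) -> exists u, f u = u.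
Proof.
move=> /andP[q0 q1] fq.
have hf : {homo f : x / [set: C] x >-> [set: C] x} by [].
have := @banach_fixed_point R C setT (mkfun_fun hf).
case=> //.
- exists (NngNum q0); split=> // -[u v] _ /=; exact: fq.
- by exists 0.
- by move=> u _ uf; exists u; rewrite {2}uf.
Qed.

End C0_complete.

Section resolvent_theory.
Context (R : realType) (E : normedModType R).
Implicit Types (A : set (E * E)) (m : R).

Definition dissipative A := forall m u h, 0 < m -> A (u, h) -> m * `|u| <= `|h - m *: u|.

Definition sub_closed A := forall u v h k, A (u, h) -> A (v, k) -> A (u - v, h - k).

Lemma shift_opE A m u f : shift_op A m (u, f) = A (u, f + m *: u). Proof. by []. Qed.

Lemma resolvent_set_dissipative A m : 0 < m -> dissipative A -> sub_closed A ->
  (forall f, exists u, shift_op A m (u, f)) -> in_resolvent_set A m.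
Proof.
move=> m0 dA sA H; have bnd u f : shift_op A m (u, f) -> m * `|u| <= `|f|.
  by move=> Auf; have := dA m u _ m0 Auf; rewrite /= addrK.
split; last first.
  by exists m^-1 => u f /bnd uf; rewrite ler_pdivlMl.
move=> f; have [u Au] := H f; exists u; split=> // v Av.
have /bnd : shift_op A m (u - v, 0).
  by rewrite shift_opE add0r scalerBr; have := sA _ _ _ _ Au Av; rewrite /= opprD addrACA subrr add0r.
by rewrite normr0 pmulr_rle0// normr_le0 subr_eq0 => /eqP.
Qed.

Lemma resolventP A m f : in_resolvent_set A m -> shift_op A m (resolvent A m f, f).
Proof.
move=> [/(_ f)[u [Au _]] _]; rewrite /resolvent; by apply: (@xgetPex _ 0 [set u | shift_op A m (u, f)]); exists u.
Qed.

(** The stability estimate behind the convergence: any [(u, h)] in the graph for which [h - m *: u]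
    is close to [f] has [u] close to the resolvent of [f]. *)
Lemma resolvent_dist A m u h f : 0 < m -> dissipative A -> sub_closed A ->
  in_resolvent_set A m -> A (u, h) ->
  m * `|resolvent A m f - u| <= `|f - (h - m *: u)|.
Proof.
move=> m0 dA sA rA Auh; have := sA _ _ _ _ (resolventP f rA) Auh => /(dA m _ _ m0) /=.
rewrite scalerBr; congr (_ <= `| _ |).
by rewrite !opprB -!addrA; congr (_ + _); rewrite addrC -addrA subrK addrC.
Qed.

End resolvent_theory.

Section kint_vanishing.
Context (R : realType) (d : nat).
Local Notation Rd := 'rV[R]_d.
Context (a : Rd -> R) (s t C : R) (ka : decaying_kernel a s t C).

(** Otherwise there would be points [u n] of norm above [n] where the integral stays large, while
    [F (u n) z] tends to 0 for each [z]; dominated convergence forbids this. *)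
Lemma kint_vanishing (K : R) (F : Rd -> Rd -> R) :
  (forall x, admissible s K (F x)) -> (forall z, vanishing_at_infinity (F ^~ z)) ->
  vanishing_at_infinity (fun x => kint a (F x)).
Proof.
move=> aF vF e e0; apply: contrapT => nex.
have Hu n : exists x, n%:R < `|x| /\ e <= `|kint a (F x)|.
  apply: contrapT => nx; apply: nex; exists n%:R => x nlx.
  by rewrite ltNge; apply/negP => ex; apply: nx; exists x.
have [u Pu] := choice Hu.
have := @kint_cvg R d a s t C ka K (fun n => F (u n)) (fun=> 0) (fun n => aF (u n)).
rewrite kint0; have H z : F (u k) z @[k --> \oo] --> 0.
  apply/cvgrPdist_lt => r r0; have [M HM] := vF z r r0.
  exists (Num.truncn M).+1 => // n /= nM; rewrite sub0r normrN; apply: HM.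
  apply: lt_trans (Pu n).1; apply: (@lt_le_trans _ _ (Num.truncn M).+1%:R).
    exact: truncnS_gt.
  by rewrite ler_nat.
move=> /(_ H)/cvgrPdist_lt/(_ _ e0)[N _ /(_ N (leqnn N))].
by rewrite sub0r normrN ltNge (Pu N).2.
Qed.

End kint_vanishing.

Lemma continuous_mul (R : realType) (X : topologicalType) (f g : X -> R) :
  continuous f -> continuous g -> continuous (fun x => f x * g x).
Proof. by move=> cf cg x; apply: continuousM; [exact: cf|exact: cg]. Qed.

Lemma continuous_add (R : realType) (X : topologicalType) (f g : X -> R) :
  continuous f -> continuous g -> continuous (fun x => f x + g x).
Proof. by move=> cf cg x; apply: continuousD; [exact: cf|exact: cg]. Qed.

Lemma continuous_inv (R : realType) (X : topologicalType) (f : X -> R) :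
  continuous f -> (forall x, f x != 0) -> continuous (fun x => (f x)^-1).
Proof. by move=> cf f0 x; apply: continuousV => //; exact: cf. Qed.

(** * The operators L^eps: dissipativity and resolvents *)

Section nonlocal_operator.
Context (R : realType) (d : nat).
Local Notation Rd := 'rV[R]_d.
Local Notation leb := (lebesgue_rV R d).
Context (a : Rd -> R) (s t C : R) (ka : decaying_kernel a s t C).
Context (a_int : 0 < \int[leb]_x a x).
Context (lam mu : Rd -> R) (alpha1 alpha2 : R) (lam_cper : cper lam) (mu_cper : cper mu).
Context (alpha1_gt0 : 0 < alpha1).
Context (lam_bnd : forall x, alpha1 <= lam x <= alpha2).
Context (mu_bnd : forall x, alpha1 <= mu x <= alpha2).
Context (eps : R) (eps_gt0 : 0 < eps).

Local Notation L := (L_eps a lam mu eps).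

Let lam0 x : 0 < lam x. Proof. by have /andP[+ _] := lam_bnd x; exact: lt_le_trans. Qed.
Let mu0 x : 0 < mu x. Proof. by have /andP[+ _] := mu_bnd x; exact: lt_le_trans. Qed.
Let c0 x : 0 < mass a mu x.
Proof. exact: (mass_gt0 ka a_int mu_cper alpha1_gt0 mu_bnd). Qed.

Lemma admissible_jump (u : C0 R d) (x : Rd) :
  admissible s (alpha2 * `|u|) (fun z => mu (eps^-1 *: x - z) * u (x - eps *: z)).
Proof.
apply: (admissible_bounded ka) => [|z].
  apply: measurable_funM; first by apply: measurable_reflect; exact: cper_measurable.
  under eq_fun do rewrite -scaleNr.
  apply: (measurableT_comp _ (measurable_rV_affine x (- eps))).
  by apply: measurable_fun_rV_continuous; exact: (@C0_continuous _ _ u).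
rewrite normrM ger0_norm ?(ltW (mu0 _))// ler_pM ?(ltW (mu0 _))//.
  by have /andP[] := mu_bnd (eps^-1 *: x - z).
exact: C0_le_norm.
Qed.

(** Loss and gain parts of the generator: [L^eps u] is [jump_part u - jump_rate * u], both parts
    being bounded because the kernel is integrable. *)
Definition jump_rate (x : Rd) : R := eps ^- 2 * lam (eps^-1 *: x) * mass a mu (eps^-1 *: x).

Definition jump_part (u : C0 R d) (x : Rd) : R := eps ^- 2 * lam (eps^-1 *: x) *
  kint a (fun z => mu (eps^-1 *: x - z) * u (x - eps *: z)).

(** The substitution [y = x - eps z] absorbs [eps ^ d] of the prefactor and leaves [eps ^ (- 2)]. *)
Lemma L_eps_integralE (u : C0 R d) x : (eps ^+ (d + 2))^-1 *
     \int[leb]_y (a (eps^-1 *: (x - y)) * lam (eps^-1 *: x) *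
                  mu (eps^-1 *: y) * (u y - u x)) =
  eps ^- 2 * lam (eps^-1 *: x) *
    kint a (fun z => mu (eps^-1 *: x - z) * (u (x - eps *: z) - u x)).
Proof.
have [K HK] := cper_admissible ka mu_cper.
have aG : admissible s (alpha2 * `|u| + `|- u x| * K)
    (fun z => mu (eps^-1 *: x - z) * (u (x - eps *: z) - u x)).
  have := admissibleD (admissible_jump u x) (admissibleZ (- u x) (HK (eps^-1 *: x))).
  by congr admissible; apply/funext => z; ring.
have ig := ker_integrable ka aG.
have e0 : eps != 0 by rewrite gt_eqF.
have ne : - eps^-1 != 0 by rewrite oppr_eq0 invr_eq0.
rewrite /kint (Rintegral_affine (eps^-1 *: x) ne ig).
rewrite normrN gtr0_norm ?invr_gt0// exprVn.
have ig' := integrable_affine (eps^-1 *: x) ne ig.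
transitivity (eps ^- (d + 2) * (lam (eps^-1 *: x) * \int[leb]_y
    (a (eps^-1 *: x + - eps^-1 *: y) *
       (mu (eps^-1 *: x - (eps^-1 *: x + - eps^-1 *: y)) *
        (u (x - eps *: (eps^-1 *: x + - eps^-1 *: y)) - u x))))); last first.
  by rewrite exprD invfM; ring.
congr (_ * _); rewrite -(RintegralZl (lam (eps^-1 *: x)) measurableT ig').
apply: eq_Rintegral => y _.
have -> : eps^-1 *: x + - eps^-1 *: y = eps^-1 *: (x - y) by rewrite scaleNr -scalerBr.
rewrite scalerA mulfV// scale1r subKr -scalerBr subKr; ring.
Qed.

Lemma L_epsE (u h : C0 R d) : L (u, h) <-> forall x, h x = jump_part u x - jump_rate x * u x.
Proof.
have [K HK] := cper_admissible ka mu_cper.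
suff E x : (eps ^+ (d + 2))^-1 *
     \int[leb]_y (a (eps^-1 *: (x - y)) * lam (eps^-1 *: x) *
                  mu (eps^-1 *: y) * (u y - u x)) = jump_part u x - jump_rate x * u x.
  by split=> H x; rewrite H// E.
rewrite L_eps_integralE /jump_part /jump_rate -!mulrA -!mulrBr; congr (_ * (_ * _)).
transitivity (kint a (fun z => mu (eps^-1 *: x - z) * u (x - eps *: z) -
    u x * mu (eps^-1 *: x - z))).
  by apply: eq_Rintegral => z _; congr (_ * _); ring.
rewrite (kintB ka (admissible_jump u x) (admissibleZ (u x) (HK _))) (kintZ ka _ (HK _)).
by rewrite (mulrC (u x)).
Qed.

Lemma L_eps_sub_closed : sub_closed L.
Proof.
move=> u v h k /L_epsE Hu /L_epsE Hv; apply/L_epsE => x.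
rewrite !C0_subE Hu Hv.
have -> : jump_part (u - v) x = jump_part u x - jump_part v x.
  rewrite /jump_part -mulrBr -(kintB ka (admissible_jump u x) (admissible_jump v x)).
  by congr (_ * _); apply: eq_Rintegral => z _; rewrite C0_subE mulrBr.
ring.
Qed.

Lemma scale_continuous (r : R) (x : Rd) : {for x, continuous (fun y : Rd => r *: y)}.
Proof. exact: scaler_continuous. Qed.

Lemma cper_scale (f : Rd -> R) : cper f -> continuous (fun x : Rd => f (eps^-1 *: x)).
Proof.
by move=> cf x; exact: (continuous_comp (scale_continuous (x := x)) (cf.1 (eps^-1 *: x))).
Qed.

Lemma jump_part_C0 (u : C0 R d) : exists w : C0 R d, forall x, w x = jump_part u x.
Proof.
have cu : continuous u := @C0_continuous _ _ u.
have vk : vanishing_at_infinity (fun x : Rd =>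
    kint a (fun z => mu (eps^-1 *: x - z) * u (x - eps *: z))).
  apply: (kint_vanishing ka (admissible_jump u)) => z e e0.
  have a2 : 0 < alpha2 by rewrite (lt_le_trans alpha1_gt0)//; have /andP[] := mu_bnd 0; exact: le_trans.
  have [M HM] := C0_vanishing u (divr_gt0 e0 a2).
  exists (M + `|eps *: z|) => x Mx; rewrite normrM gtr0_norm//.
  have := HM (x - eps *: z); rewrite ltr_pdivlMr// mulrC => /(_ _)/(le_lt_trans _); apply.
    by rewrite ler_wpM2r//; have /andP[] := mu_bnd (eps^-1 *: x - z).
  by rewrite (lt_le_trans _ (lerB_dist _ _))// ltrBrDr.
apply: C0_exists.
  have clam : continuous (fun x : Rd => eps ^- 2 * lam (eps^-1 *: x)).
    by apply: continuous_mul; [exact: cst_continuous|exact: (cper_scale lam_cper)].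
  apply: (continuous_mul clam).
  apply: (kint_continuous ka (F := fun x z => mu (eps^-1 *: x - z) * u (x - eps *: z))
    (admissible_jump u)) => z; apply: continuous_mul => x.
    have cs : {for x, continuous (fun x : Rd => eps^-1 *: x - z)}.
      by apply: continuousB; [exact: scale_continuous|exact: cst_continuous].
    exact: (continuous_comp cs (mu_cper.1 _)).
  have cs : {for x, continuous (fun x : Rd => x - eps *: z)}.
    by apply: continuousB; [exact: cvg_id|exact: cst_continuous].
  exact: (continuous_comp cs (cu _)).
move=> e e0; have a2 : 0 < eps ^- 2 * alpha2.
  rewrite mulr_gt0 ?invr_gt0 ?exprn_gt0// (lt_le_trans alpha1_gt0)//.
  by have /andP[] := mu_bnd 0; exact: le_trans.
have [M HM] := vk _ (divr_gt0 e0 a2); exists M => x /HM.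
rewrite ltr_pdivlMr// mulrC => /(le_lt_trans _); apply.
rewrite /jump_part normrM ler_wpM2r// gtr0_norm ?mulr_gt0 ?invr_gt0 ?exprn_gt0//.
by rewrite ler_pM2l ?invr_gt0 ?exprn_gt0//; have /andP[] := lam_bnd (eps^-1 *: x).
Qed.

Lemma jump_rate_gt0 x : 0 < jump_rate x.
Proof. by rewrite !mulr_gt0// invr_gt0 exprn_gt0. Qed.

Lemma jump_rate_bounded : exists2 K, 0 < K & forall x, jump_rate x <= K.
Proof.
have a2 : 0 < alpha2 by rewrite (lt_le_trans alpha1_gt0)//; have /andP[] := mu_bnd 0; exact: le_trans.
exists (eps ^- 2 * alpha2 * (alpha2 * \int[leb]_x a x)).
  by rewrite !mulr_gt0 ?invr_gt0 ?exprn_gt0.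
move=> x; rewrite /jump_rate ler_pM ?mulr_ge0 ?invr_ge0 ?exprn_ge0 ?(ltW eps_gt0) ?(ltW (lam0 _)) ?(ltW (c0 _))//.
  by rewrite ler_pM2l ?invr_gt0 ?exprn_gt0//; have /andP[] := lam_bnd (eps^-1 *: x).
by have /andP[] := mass_bounds ka mu_cper mu_bnd (eps^-1 *: x).
Qed.

Lemma jump_rate_continuous : continuous jump_rate.
Proof.
have clam : continuous (fun x : Rd => eps ^- 2 * lam (eps^-1 *: x)).
  by apply: continuous_mul; [exact: cst_continuous|exact: (cper_scale lam_cper)].
exact: (continuous_mul clam (cper_scale (mass_cper ka mu_cper))).
Qed.

Lemma C0_bounded_mul (f : Rd -> R) (K : R) (u : C0 R d) : continuous f ->
  (forall x, `|f x| <= K) -> exists w : C0 R d, forall x, w x = f x * u x.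
Proof.
move=> cf fK; apply: C0_exists.
  by move=> x; apply: continuousM; [exact: cf|exact: (@C0_continuous _ _ u)].
move=> e e0; have K1 : 0 < K + 1.
  by rewrite ltr_wpDl// (le_trans _ (fK 0)).
have [M HM] := C0_vanishing u (divr_gt0 e0 K1); exists M => x /HM.
rewrite ltr_pdivlMr// mulrC => /(le_lt_trans _); apply; rewrite normrM ler_wpM2r//.
by rewrite (le_trans (fK x))// lerDl.
Qed.

Lemma L_eps_total (u : C0 R d) : exists h, L (u, h).
Proof.
have [w Hw] := jump_part_C0 u; have [K K0 HK] := jump_rate_bounded.
have [v Hv] : exists v : C0 R d, forall x, v x = jump_rate x * u x.
  apply: (C0_bounded_mul (K := K)); first exact: jump_rate_continuous.
  by move=> x; rewrite ger0_norm ?(ltW (jump_rate_gt0 x)).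
by exists (w - v); apply/L_epsE => x; rewrite C0_subE Hw Hv.
Qed.

Lemma jump_part_le (u : C0 R d) x : `|jump_part u x| <= jump_rate x * `|u|.
Proof.
have [K HK] := cper_admissible ka mu_cper.
rewrite /jump_part normrM gtr0_norm ?mulr_gt0 ?invr_gt0 ?exprn_gt0//.
rewrite /jump_rate -!mulrA !ler_wpM2l ?invr_ge0 ?exprn_ge0 ?(ltW eps_gt0) ?(ltW (lam0 _))//.
have aK := admissibleZ `|u| (HK (eps^-1 *: x)).
have E : mass a mu (eps^-1 *: x) * `|u| = kint a (fun z => `|u| * mu (eps^-1 *: x - z)).
  by rewrite (kintZ ka _ (HK _)) mulrC.
have le z : `|mu (eps^-1 *: x - z) * u (x - eps *: z)| <= `|u| * mu (eps^-1 *: x - z).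
  by rewrite normrM gtr0_norm// mulrC ler_wpM2r ?(ltW (mu0 _))// C0_le_norm.
rewrite E ler_norml; apply/andP; split.
  rewrite -mulN1r -(kintZ ka (-1) aK).
  apply: (kint_le ka (admissibleZ (-1) aK) (admissible_jump u x)) => z.
  by rewrite mulN1r; have := le z; rewrite ler_norml => /andP[].
apply: (kint_le ka (admissible_jump u x) aK) => z.
by have := le z; rewrite ler_norml => /andP[].
Qed.

Lemma jump_partB (u v : C0 R d) x : jump_part (u - v) x = jump_part u x - jump_part v x.
Proof.
rewrite /jump_part -mulrBr -(kintB ka (admissible_jump u x) (admissible_jump v x)).
by congr (_ * _); apply: eq_Rintegral => z _; rewrite C0_subE mulrBr.
Qed.

(** A quantitative maximum principle. Solving the equation for [u x] bounds [|u x|] by [(jump_rate x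
    * |u| + |h - m u|) / (jump_rate x + m)]; if [|h - m u|] were below [m * |u|], every value would
    lie below the norm by a fixed amount. *)
Lemma L_eps_dissipative : dissipative L.
Proof.
move=> m u h m0 /L_epsE Hh; have [K K0 HK] := jump_rate_bounded.
rewrite leNgt; apply/negP => hu.
(* Dividing by the largest possible [jump_rate x + m] makes this gap the same for all [x]. *)
pose D := (m * `|u| - `|h - m *: u|) / (K + m).
have Km : 0 < K + m by exact: addr_gt0.
have D0 : 0 < D by rewrite divr_gt0// subr_gt0.
have : `|u| <= `|u| - D.
  apply: C0_norm_leP => x.
  have cm : 0 < jump_rate x + m by rewrite addr_gt0// jump_rate_gt0.
  have E : u x = (jump_part u x - (h - m *: u) x) / (jump_rate x + m).
    by rewrite C0_subE C0_scaleE Hh; field; rewrite gt_eqF.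
  rewrite {1}E normrM normfV (gtr0_norm cm) ler_pdivrMr//.
  rewrite (le_trans (ler_normB _ _))//.
  have h1 := jump_part_le u x; have h2 := C0_le_norm (h - m *: u) x.
  have h3 : D * (jump_rate x + m) <= m * `|u| - `|h - m *: u|.
    rewrite /D mulrAC ler_pdivrMr// ler_wpM2l ?lerD2r//.
    by rewrite subr_ge0 ltW.
  by rewrite mulrBl mulrDr (mulrC _ (jump_rate x)) (mulrC `|u| m); lra.
by rewrite lerDl oppr_ge0 leNgt D0.
Qed.

Lemma L_eps_resolvent_set m : 0 < m -> in_resolvent_set L m.
Proof.
move=> m0; apply: resolvent_set_dissipative => //.
- exact: L_eps_dissipative.
- exact: L_eps_sub_closed.
move=> f; have [K K0 HK] := jump_rate_bounded.
have cm x : 0 < jump_rate x + m by rewrite addr_gt0// jump_rate_gt0.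
have Hstep (u : C0 R d) : exists v : C0 R d, forall x,
    v x = (jump_part u x - f x) / (jump_rate x + m).
  have [w Hw] := jump_part_C0 u.
  have cinv : continuous (fun x => (jump_rate x + m)^-1).
    apply: continuous_inv; last by move=> x; rewrite gt_eqF.
    by apply: continuous_add; [exact: jump_rate_continuous|exact: cst_continuous].
  have [|v Hv] := C0_bounded_mul (K := m^-1) (w - f) cinv.
    move=> x; rewrite ger0_norm ?invr_ge0 ?(ltW (cm x))// lef_pV2 ?posrE//.
    by rewrite lerDr ltW// jump_rate_gt0.
  by exists v => x; rewrite Hv C0_subE Hw mulrC.
have [S HS] := choice Hstep.
(* The local contraction factor [jump_rate x / (jump_rate x + m)] increases with the rate, so the
   bound [K] of the rate gives a uniform one. *)
have [|u v|u Hu] := @C0_contraction_fixpoint R d S (K / (K + m)).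
- have Km : 0 < K + m by exact: addr_gt0.
  by rewrite divr_ge0 ?(ltW K0) ?(ltW Km)//= ltr_pdivrMr// mul1r ltrDl.
- apply: C0_norm_leP => x; rewrite C0_subE !HS -mulrBl.
  have -> : jump_part u x - f x - (jump_part v x - f x) = jump_part (u - v) x.
    by rewrite jump_partB; ring.
  rewrite normrM normfV (gtr0_norm (cm x)) ler_pdivrMr// (le_trans (jump_part_le _ _))//.
  have Km : 0 < K + m by exact: addr_gt0.
  rewrite [leRHS]mulrAC ler_wpM2r// mulrAC ler_pdivlMr// !mulrDr (mulrC K) lerD2l.
  by rewrite ler_wpM2r// ltW.
exists u; rewrite shift_opE; apply/L_epsE => x.
rewrite C0_addE C0_scaleE; have := HS u x; rewrite Hu => ->.
by field; rewrite gt_eqF.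
Qed.

End nonlocal_operator.

(** * Taylor expansions and Schwartz functions *)

Section taylor.
Context (R : realType) (d : nat).
Local Notation Rd := 'rV[R]_d.
Implicit Types (f : Rd -> R) (x h : Rd).

Lemma is_derive_line f x h (t : R) : differentiable f (x + t *: h) ->
  is_derive t 1 (fun t => f (x + t *: h)) (\sum_i h ord0 i * partial i f (x + t *: h)).
Proof.
move=> df; have dfh : derivable f (x + t *: h) h by exact: diff_derivable.
have E : (fun k : R => k^-1 *: (f (x + (k *: 1 + t) *: h) - f (x + t *: h))) =
         (fun k : R => k^-1 *: (f (k *: h + (x + t *: h)) - f (x + t *: h))).
  apply/funext => k; congr (_ *: (f _ - _)).
  by rewrite scalerDl addrCA; congr (_ *: _ + _); rewrite /GRing.scale/= mulr1.
have dl : derivable (fun t : R => f (x + t *: h)) t 1.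
  by rewrite /derivable /= E.
suff <- : 'D_1 (fun t : R => f (x + t *: h)) t = \sum_i h ord0 i * partial i f (x + t *: h).
  exact: derivableP.
have -> : 'D_1 (fun t : R => f (x + t *: h)) t = 'D_h f (x + t *: h).
  by rewrite /derive /= E.
move: {dfh E dl} (x + t *: h) df => y dy.
rewrite deriveE// {1}(row_sum_delta h) linear_sum; apply: eq_bigr => i _.
by rewrite linearZ /partial deriveE.
Qed.

Lemma mvt_bound (phi dphi : R -> R) (K : R) :
  (forall t : R, is_derive t 1 phi (dphi t)) -> (forall t : R, 0 <= t <= 1 -> `|dphi t| <= K) ->
  `|phi 1 - phi 0| <= K.
Proof.
move=> Hphi HK.
have [c c01 ->] := @MVT_segment R phi dphi 0 1 ler01 (fun t _ => Hphi t)
  (derivable_within_continuous (fun t _ => @ex_derive _ _ _ _ _ _ _ (Hphi t))).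
by rewrite subr0 mulr1 HK//; move: c01; rewrite in_itv.
Qed.

Lemma sum_coord_le (h : Rd) (F : 'I_d -> R) (M : R) : (forall i, `|F i| <= M) ->
  `|\sum_i h ord0 i * F i| <= d%:R * M * `|h|.
Proof.
move=> FM; rewrite (le_trans (ler_norm_sum _ _ _))//.
apply: (@le_trans _ _ (\sum_(i < d) M * `|h|)).
  by apply: ler_sum => i _; rewrite normrM mulrC ler_pM// rV_norm_coord.
by rewrite sumr_const card_ord -(mulr_natl (M * _)) mulrA.
Qed.

Lemma taylor1 f (M : R) : (forall x, differentiable f x) ->
  (forall i x, `|partial i f x| <= M) ->
  forall x h, `|f (x + h) - f x| <= d%:R * M * `|h|.
Proof.
move=> df fM x h.
have := @mvt_bound (fun t => f (x + t *: h)) _ (d%:R * M * `|h|)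
  (fun t => is_derive_line (df (x + t *: h))).
rewrite scale1r scale0r addr0; apply => t _.
exact: sum_coord_le.
Qed.

Let M_ge0 f (M : R) : (forall i x, `|partial i f x| <= M) -> 0 <= d%:R * M.
Proof.
case: (posnP d) => [d0 _|d0 fM]; first by rewrite (_ : d%:R = 0 :> R) ?mul0r// d0.
by rewrite mulr_ge0// (le_trans _ (fM (Ordinal d0) 0)).
Qed.

(** The [t]-derivative of the remainder along the segment from [x] to [x + h] is the sum of [h_i]
    times increments of [partial i f], which [taylor1] bounds. The same recursion yields [taylor3]
    from [taylor2]. *)
Lemma taylor2 f (M : R) : (forall x, differentiable f x) ->
  (forall i x, differentiable (partial i f) x) ->
  (forall i j x, `|partial j (partial i f) x| <= M) ->
  forall x h, `|f (x + h) - f x - \sum_i h ord0 i * partial i f x| <= d%:R * (d%:R * M) * `|h| ^+ 2.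
Proof.
move=> df ddf fM x h; pose S := \sum_i h ord0 i * partial i f x.
have der (t : R) : is_derive t 1 (fun t => f (x + t *: h) - t * S)
    (\sum_i h ord0 i * (partial i f (x + t *: h) - partial i f x)).
  have h1 := is_derive_line (df (x + t *: h)).
  have h2 : is_derive t 1 (fun t : R => t * S) S.
    have -> : (fun t : R => t * S) = S *: (id : R -> R).
      by apply/funext => u; rewrite !fctE /GRing.scale/= mulrC.
    by apply: is_derive_eq; rewrite /GRing.scale/= mulr1.
  apply: is_derive_eq.
  rewrite /S -sumrB; apply: eq_bigr => i _; by rewrite mulrBr.
have := @mvt_bound (fun t => f (x + t *: h) - t * S) _ (d%:R * (d%:R * M) * `|h| ^+ 2) der.
rewrite scale1r scale0r addr0 mul1r mul0r subr0 addrAC; apply => t /andP[t0 t1].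
rewrite (le_trans (sum_coord_le (M := d%:R * M * `|h|) _ _))//; last first.
  by rewrite expr2 !mulrA.
move=> i; have := taylor1 (ddf i) (fM i) x (t *: h).
move=> /le_trans; apply; rewrite ler_wpM2l ?(M_ge0 (fM i))//.
by rewrite normrZ ger0_norm// ler_piMl.
Qed.

Lemma taylor3 f (M : R) : (forall x, differentiable f x) ->
  (forall i x, differentiable (partial i f) x) ->
  (forall i j x, differentiable (partial j (partial i f)) x) ->
  (forall i j k x, `|partial k (partial j (partial i f)) x| <= M) ->
  forall x h, `|f (x + h) - f x - \sum_i h ord0 i * partial i f x -
     2^-1 * \sum_i \sum_j h ord0 i * h ord0 j * partial i (partial j f) x| <=
     d%:R * (d%:R * (d%:R * M)) * `|h| ^+ 3.
Proof.
move=> df ddf d3f fM x h; pose S := \sum_i h ord0 i * partial i f x.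
(* Written so that [taylor2] for [partial i f] applies to the inner sum; [QE] matches it with the
   statement by renaming the summation indices. *)
pose Q := \sum_i h ord0 i * \sum_j h ord0 j * partial j (partial i f) x.
have QE : \sum_i \sum_j h ord0 i * h ord0 j * partial i (partial j f) x = Q.
  rewrite exchange_big /Q; apply: eq_bigr => i _; rewrite mulr_sumr.
  by apply: eq_bigr => j _; rewrite mulrA (mulrC (h _ j)).
have der (t : R) : is_derive t 1 (fun t => f (x + t *: h) - (t * S + 2^-1 * t ^+ 2 * Q))
    (\sum_i h ord0 i * (partial i f (x + t *: h) - partial i f x -
        t * \sum_j h ord0 j * partial j (partial i f) x)).
  have h1 := is_derive_line (df (x + t *: h)).
  have h2 : is_derive t 1 (fun t : R => t * S + 2^-1 * t ^+ 2 * Q) (S + t * Q).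
    have -> : (fun t : R => t * S + 2^-1 * t ^+ 2 * Q) =
        (S *: (id : R -> R) + (2^-1 * Q) *: ((id : R -> R) * (id : R -> R))).
      by apply/funext => u; rewrite !fctE /GRing.scale/= expr2; ring.
    have i1 := is_derive_id t (1 : R).
    have i2 := is_deriveZ S i1.
    have i3 := is_deriveZ (2^-1 * Q) (is_deriveM i1 i1).
    have i4 := is_deriveD i2 i3.
    apply: (is_derive_eq i4); rewrite /GRing.scale/=.
    rewrite (mulr1 S) (mulr1 t); congr (_ + _).
    have -> : t + t = 2 * t by rewrite mulr_natl mulr2n.
    by rewrite mulrACA mulVf ?mul1r 1?mulrC// pnatr_eq0.
  apply: is_derive_eq.
  rewrite /S /Q opprD addrA -sumrB mulr_sumr -sumrB; apply: eq_bigr => i _; ring.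
have := @mvt_bound _ _ (d%:R * (d%:R * (d%:R * M)) * `|h| ^+ 3) der.
rewrite QE scale1r scale0r addr0 !mul1r expr1n mulr1 expr0n/= !(mulr0, mul0r, addr0) subr0.
move=> Hm; have {Hm} : `|f (x + h) - (S + 2^-1 * Q) - f x| <= d%:R * (d%:R * (d%:R * M)) * `|h| ^+ 3.
  apply: Hm => t /andP[t0 t1].
  rewrite (le_trans (sum_coord_le (M := d%:R * (d%:R * M) * `|h| ^+ 2) _ _))//; last first.
    by rewrite (exprSr _ 2) !mulrA.
  move=> i; have := taylor2 (ddf i) (d3f i) (fM i) x (t *: h).
  rewrite (_ : \sum_j (t *: h) ord0 j * _ = t * \sum_j h ord0 j * partial j (partial i f) x); last first.
    by rewrite mulr_sumr; apply: eq_bigr => j _; rewrite mxE mulrA.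
  move=> /le_trans; apply; rewrite ler_wpM2l//.
    case: (posnP d) => [d0|d0]; first by rewrite (_ : d%:R = 0 :> R) ?mul0r// d0.
    by rewrite mulr_ge0//; exact: (M_ge0 (fM i (Ordinal d0))).
  rewrite normrZ ger0_norm// lerXn2r ?nnegrE ?mulr_ge0//.
  by rewrite ler_piMl.
by congr (`| _ | <= _); rewrite /S; ring.
Qed.

End taylor.

Section schwartz_theory.
Context (R : realType) (d : nat).
Local Notation Rd := 'rV[R]_d.
Implicit Types (f g : Rd -> R) (x y h : Rd).

Lemma norm_le_enorm x : `|x| <= enorm x.
Proof.
apply: rV_norm_le => [|i]; first exact: sqrtr_ge0.
rewrite -sqrtr_sqr ler_wsqrtr// (bigD1 i)//= lerDl sumr_ge0// => j _.
exact: sqr_ge0.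
Qed.

Lemma enorm_le_norm x : enorm x <= d%:R * `|x|.
Proof.
rewrite -[leRHS]ger0_norm ?mulr_ge0// -sqrtr_sqr ler_wsqrtr//.
apply: (@le_trans _ _ (\sum_(i < d) `|x| ^+ 2)).
  by apply: ler_sum => i _; rewrite -real_normK ?num_real// lerXn2r ?nnegrE// rV_norm_coord.
rewrite sumr_const card_ord -(mulr_natl (_ ^+ 2)) exprMn ler_wpM2r ?sqr_ge0//.
by rewrite -natrX ler_nat; case: (d) => // n; rewrite leq_pmulr.
Qed.

Definition rapid f := forall k : nat, exists M : R, forall x, (1 + `|x|) ^+ k * `|f x| <= M.

Lemma rapidP f : rapid f <-> forall k : nat, exists M : R, forall x, enorm x ^+ k * `|f x| <= M.
Proof.
split=> H k.
  have [M HM] := H k; exists (d%:R ^+ k * M) => x.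
  apply: (@le_trans _ _ ((d%:R * `|x|) ^+ k * `|f x|)).
    by rewrite ler_wpM2r// lerXn2r ?nnegrE ?mulr_ge0 ?sqrtr_ge0// enorm_le_norm.
  rewrite exprMn -mulrA ler_wpM2l ?exprn_ge0// (le_trans _ (HM x))// ler_wpM2r//.
  by rewrite lerXn2r ?nnegrE ?addr_ge0// lerDr.
have [M0 HM0] := H 0; have [M HM] := H k.
exists (2 ^+ k * (M0 + M)) => x.
apply: (@le_trans _ _ (2 ^+ k * ((1 + enorm x ^+ k) * `|f x|))); last first.
  by rewrite ler_wpM2l ?exprn_ge0// mulrDl lerD// (le_trans _ (HM0 x))// expr0.
rewrite mulrA ler_wpM2r//.
have ex0 : 0 <= enorm x by exact: sqrtr_ge0.
apply: (@le_trans _ _ ((1 + enorm x) ^+ k)).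
  by rewrite lerXn2r ?nnegrE ?addr_ge0// lerD2l norm_le_enorm.
have [e1|e1] := leP (enorm x) 1.
  apply: (@le_trans _ _ (2 ^+ k)); first by rewrite lerXn2r ?nnegrE ?addr_ge0//; lra.
  by rewrite ler_peMr ?exprn_ge0// lerDl exprn_ge0.
apply: (@le_trans _ _ ((2 * enorm x) ^+ k)).
  by rewrite lerXn2r ?nnegrE ?mulr_ge0 ?addr_ge0//; lra.
by rewrite exprMn ler_wpM2l ?exprn_ge0// lerDr.
Qed.

Lemma schwartzP f : schwartz f <-> forall s : seq 'I_d,
  (forall x, differentiable (partials s f) x) /\ rapid (partials s f).
Proof. by split=> H s; have [h1 h2] := H s; split=> //; apply/rapidP. Qed.

Lemma partials_partial (s : seq 'I_d) i f : partials s (partial i f) = partials (rcons s i) f.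
Proof. by rewrite /partials foldr_rcons. Qed.

Lemma schwartz_partial i f : schwartz f -> schwartz (partial i f).
Proof. by move=> sf s; rewrite partials_partial; exact: sf. Qed.

Lemma schwartz_differentiable f x : schwartz f -> differentiable f x.
Proof. by move=> sf; exact: (sf [::]).1. Qed.

Lemma schwartz_continuous f : schwartz f -> continuous f.
Proof. by move=> sf x; apply: differentiable_continuous; exact: schwartz_differentiable. Qed.

Lemma rapid_vanishing f : rapid f -> vanishing_at_infinity f.
Proof.
move=> rf e e0; have [M HM] := rf 1; exists (M / e) => x; rewrite ltr_pdivrMr// => Mx.
have := HM x; rewrite expr1 mulrDl mul1r => h.
have x0 : 0 < `|x|.
  rewrite lt_neqAle normr_ge0 andbT; apply/negP => /eqP x0; move: Mx h.
  by rewrite -x0 !mul0r addr0; have := normr_ge0 (f x); lra.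
rewrite -(ltr_pM2l x0); have := normr_ge0 (f x); lra.
Qed.

Lemma schwartz_rapid f : schwartz f -> rapid f.
Proof. by move=> /schwartzP /(_ [::]) []. Qed.

Lemma schwartz_C0 f : schwartz f -> exists u : C0 R d, forall x, u x = f x.
Proof.
move=> sf; apply: C0_exists; first exact: schwartz_continuous.
exact/rapid_vanishing/schwartz_rapid.
Qed.

Lemma rapid_bounded f : rapid f -> exists M, forall x, `|f x| <= M.
Proof. by move=> /(_ 0)[M HM]; exists M => x; have := HM x; rewrite expr0 mul1r. Qed.

Lemma family_bounded (I : finType) (F : I -> Rd -> R) :
  (forall i, exists M, forall x, `|F i x| <= M) ->
  exists2 K : R, 0 <= K & forall i x, `|F i x| <= K.
Proof.
move=> /choice[M HM]; exists (\sum_i `|M i|); first by rewrite sumr_ge0.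
move=> i x; rewrite (le_trans (HM i x))// (le_trans (ler_norm _))//.
by rewrite (bigD1 i)//= lerDl sumr_ge0.
Qed.

Lemma schwartz_bounds n f : schwartz f -> exists2 K : R, 0 <= K &
  forall s : seq 'I_d, (size s <= n)%N -> forall x, `|partials s f x| <= K.
Proof.
elim: n f => [|n IHn] f sf; have [M HM] := rapid_bounded (schwartz_rapid sf).
  exists `|M| => // -[]// _ x; exact: le_trans (HM x) (ler_norm _).
have /choice[K HK] : forall i, exists K, 0 <= K /\ forall s : seq 'I_d, (size s <= n)%N ->
    forall x, `|partials s (partial i f) x| <= K.
  by move=> i; have [K K0 HK] := IHn _ (schwartz_partial i sf); exists K.
have K0 : 0 <= \sum_i K i by apply: sumr_ge0 => i _; exact: (HK i).1.
exists (`|M| + \sum_i K i) => [|s]; first by rewrite addr_ge0.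
case: (lastP s) => [_ x|{}s i]; first by rewrite (le_trans (HM x))// (le_trans (ler_norm _))// lerDl.
rewrite size_rcons ltnS -partials_partial => sn x; rewrite (le_trans ((HK i).2 _ sn x))//.
by rewrite (bigD1 i)//= addrCA lerDl addr_ge0// sumr_ge0// => j _; exact: (HK j).1.
Qed.

Lemma partialsD s f g : schwartz f -> schwartz g ->
  partials s (fun x => f x + g x) = fun x => partials s f x + partials s g x.
Proof.
move=> sf sg; elim: s => //= i s ->; apply/funext => x; rewrite /partial.
apply: deriveD; apply: diff_derivable; [exact: (sf s).1|exact: (sg s).1].
Qed.

Lemma partialsZ s k f : schwartz f ->
  partials s (fun x => k * f x) = fun x => k * partials s f x.
Proof.
move=> sf; elim: s => //= i s ->; apply/funext => x; rewrite /partial.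
apply: (deriveZ (f := partials s f)); apply: diff_derivable; exact: (sf s).1.
Qed.

Lemma schwartzD f g : schwartz f -> schwartz g -> schwartz (fun x => f x + g x).
Proof.
move=> sf sg; apply/schwartzP => s; rewrite (partialsD _ sf sg).
have [df rf] := (schwartzP f).1 sf s; have [dg rg] := (schwartzP g).1 sg s; split.
  by move=> x; exact: differentiableD.
move=> k; have [M HM] := rf k; have [N HN] := rg k; exists (M + N) => x.
by rewrite (le_trans _ (lerD (HM x) (HN x)))// -mulrDr ler_wpM2l ?exprn_ge0 ?addr_ge0// ler_normD.
Qed.

Lemma schwartzZ k f : schwartz f -> schwartz (fun x => k * f x).
Proof.
move=> sf; apply/schwartzP => s; rewrite (partialsZ _ _ sf).
have [df rf] := (schwartzP f).1 sf s; split.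
  by move=> x; exact: differentiableZ.
move=> n; have [M HM] := rf n; exists (`|k| * M) => x.
by rewrite normrM mulrCA ler_wpM2l.
Qed.

Lemma schwartz0 : schwartz (fun _ : Rd => 0 : R).
Proof.
apply/schwartzP => s.
have -> : partials s (fun _ : Rd => 0 : R) = fun=> 0.
  by elim: s => //= i s ->; apply/funext => x; exact: derive_cst.
split=> [x|k]; first exact: differentiable_cst.
by exists 0 => x; rewrite normr0 mulr0.
Qed.

Lemma schwartz_sum (I : Type) (r : seq I) (F : I -> Rd -> R) :
  (forall i, schwartz (F i)) -> schwartz (fun x => \sum_(i <- r) F i x).
Proof.
move=> sF; elim: r => [|i r IHr].
  by rewrite (_ : (fun _ => _) = fun=> 0); [exact: schwartz0|apply/funext => x; rewrite big_nil].
rewrite (_ : (fun _ => _) = fun x => F i x + \sum_(j <- r) F j x); first exact: schwartzD.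
by apply/funext => x; rewrite big_cons.
Qed.

Lemma partials_shift s f h : partials s (fun x => f (x + h)) = fun x => partials s f (x + h).
Proof.
elim: s => //= i s ->; apply/funext => x; rewrite /partial /derive.
by rewrite /=; under eq_fun do rewrite -addrA.
Qed.

Lemma schwartz_shift f h : schwartz f -> schwartz (fun x => f (x + h)).
Proof.
move=> sf; apply/schwartzP => s; rewrite partials_shift.
have [df rf] := (schwartzP f).1 sf s; split=> [x|k].
  apply: differentiable_comp; last exact: df.
  by apply: differentiableD; [exact: ex_diff|exact: differentiable_cst].
have [M HM] := rf k; exists ((1 + `|h|) ^+ k * M) => x.
rewrite (le_trans _ (ler_wpM2l _ (HM (x + h)))) ?exprn_ge0 ?addr_ge0//.
rewrite mulrA -exprMn ler_wpM2r// lerXn2r ?nnegrE ?mulr_ge0 ?addr_ge0//.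
have xh : `|x| <= `|x + h| + `|h| by rewrite -{1}(addrK h x) -[`|h|]normrN ler_normD.
have := normr_ge0 h; have := normr_ge0 (x + h); nra.
Qed.

(* The second difference of [f] along [t e_i, t e_j] is [t ^ 2] times either mixed
   derivative up to [O(t ^ 3)]. *)
Lemma partial_comm f i j x : schwartz f -> partial i (partial j f) x = partial j (partial i f) x.
Proof.
move=> sf; have [K K0 HK] := schwartz_bounds 3 sf.
have d0 : 0 <= d%:R :> R by [].
pose e_ (i : 'I_d) : Rd := delta_mx ord0 i.
have ne i' : `|e_ i'| <= 1.
  by apply: rV_norm_le => // k; rewrite mxE; case: eqP => _; case: eqP; rewrite ?normr0 ?normr1.
have esum k (t : R) (F : 'I_d -> R) : \sum_l (t *: e_ k) ord0 l * F l = t * F k.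
  rewrite (bigD1 k)//= big1 => [|l lk]; first by rewrite !mxE !eqxx mulr1 addr0.
  by rewrite !mxE eqxx (negPf lk) mulr0 mul0r.
have key (k l : 'I_d) (t : R) : 0 < t ->
    `|f (x + t *: e_ k + t *: e_ l) - f (x + t *: e_ k) - f (x + t *: e_ l) + f x -
      t ^+ 2 * partial l (partial k f) x| <= (d%:R * (d%:R * (d%:R * K)) + d%:R * (d%:R * K)) * t ^+ 3.
  move=> t0; have tn k' : `|t *: e_ k'| <= t by rewrite normrZ gtr0_norm//; exact: (ler_piMr (ltW t0) (ne k')).
  (* The second derivatives of this increment are [O(t)], so expanding [g] along [t e_k] to first
     order costs [O(t ^ 3)]. The first derivative of [g] is itself an increment along [t e_l],
     expanded next. *)
  pose g y := f (y + t *: e_ l) + -1 * f y.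
  have sg : schwartz g by apply: schwartzD; [exact: schwartz_shift|exact: schwartzZ].
  have Eg s y : partials s g y = partials s f (y + t *: e_ l) - partials s f y.
    rewrite /g partialsD; [|exact: schwartz_shift|exact: schwartzZ].
    by rewrite partials_shift partialsZ// mulN1r.
  have bg k1 k2 y : `|partial k2 (partial k1 g) y| <= d%:R * K * t.
    rewrite -[partial k2 _ y]/(partials [:: k2; k1] g y) Eg.
    have := taylor1 (M := K) (sf [:: k2; k1]).1 (fun k3 y => HK [:: k3; k2; k1] isT y) y (t *: e_ l).
    by move=> /le_trans; apply; rewrite ler_wpM2l ?mulr_ge0.
  have := taylor2 (fun y => (sg [::]).1 y) (fun k y => (sg [:: k]).1 y) bg x (t *: e_ k).
  rewrite esum -[partial k g x]/(partials [:: k] g x) (Eg [:: k]) => h1.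
  have := taylor2 (fun y => (sf [:: k]).1 y) (fun k' y => (sf [:: k'; k]).1 y)
    (fun k1 k2 y => HK [:: k2; k1; k] isT y) x (t *: e_ l).
  rewrite esum => h2.
  have n2 k' : `|t *: e_ k'| ^+ 2 <= t ^+ 2 by rewrite lerXn2r ?nnegrE ?(ltW t0) ?tn.
  have {}h1 := le_trans h1 (ler_wpM2l (_ : 0 <= d%:R * (d%:R * (d%:R * K * t))) (n2 k)).
  have {}h2 := le_trans h2 (ler_wpM2l (_ : 0 <= d%:R * (d%:R * K)) (n2 l)).
  have -> : f (x + t *: e_ k + t *: e_ l) - f (x + t *: e_ k) - f (x + t *: e_ l) + f x -
      t ^+ 2 * partial l (partial k f) x =
      (g (x + t *: e_ k) - g x - t * (partials [:: k] f (x + t *: e_ l) - partials [:: k] f x)) +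
      t * (partials [:: k] f (x + t *: e_ l) - partials [:: k] f x - t * partial l (partials [:: k] f) x).
    by rewrite /g /=; ring.
  rewrite (le_trans (ler_normD _ _))// [leRHS]mulrDl lerD//.
    apply: (le_trans (h1 _)); first by rewrite !mulr_ge0// ltW.
    by rewrite le_eqVlt; apply/orP; left; apply/eqP; ring.
  rewrite normrM (gtr0_norm t0); apply: (le_trans (ler_wpM2l (ltW t0) (h2 _))); first by rewrite !mulr_ge0.
  by rewrite le_eqVlt; apply/orP; left; apply/eqP; ring.
set c := _ + _ in key; have c0 : 0 <= c by rewrite addr_ge0 ?mulr_ge0.
apply/eqP; rewrite -subr_eq0 -normr_le0; apply/ler_addgt0Pr => e e0; rewrite add0r.
pose t := e / (2 * c + 1); have c1 : 0 < 2 * c + 1 by lra.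
have t0 : 0 < t by rewrite divr_gt0.
have te : 2 * c * t <= e by rewrite /t mulrA ler_pdivrMr//; nra.
have := key i j t t0; have := key j i t t0.
rewrite (addrAC x (t *: e_ j)) (addrAC _ (- f (x + t *: e_ j))).
set Q := _ + f x; set D1 := partial i _ x; set D2 := partial j _ x => h1 h2.
rewrite (le_trans _ te)// -(ler_pM2l (exprn_gt0 2 t0)).
rewrite -[X in X * _](gtr0_norm (exprn_gt0 2 t0)) -normrM.
have -> : t ^+ 2 * (D1 - D2) = (Q - t ^+ 2 * D2) - (Q - t ^+ 2 * D1) by ring.
rewrite (le_trans (ler_normB _ _))// (le_trans (lerD h2 h1))//.
by rewrite le_eqVlt; apply/orP; left; apply/eqP; ring.
Qed.

End schwartz_theory.

(** * Gaussian functions as Schwartz functions and as kernels *)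

Section gaussian.
Context (R : realType) (d : nat).
Local Notation Rd := 'rV[R]_d.
Implicit Types (p : Rd -> R) (x : Rd).

(** Polynomials, given as a class of functions stable under products and partial derivatives; every
    derivative of a Gaussian is such a function times the Gaussian. *)
Inductive polyfun : (Rd -> R) -> Prop :=
| polyfun_cst (c : R) : polyfun (fun=> c)
| polyfun_coord (i : 'I_d) : polyfun (fun x => x ord0 i)
| polyfun_add p q : polyfun p -> polyfun q -> polyfun (fun x => p x + q x)
| polyfun_mul p q : polyfun p -> polyfun q -> polyfun (fun x => p x * q x).

Lemma polyfun_sum (I : Type) (r : seq I) (F : I -> Rd -> R) :
  (forall i, polyfun (F i)) -> polyfun (fun x => \sum_(i <- r) F i x).
Proof.
move=> pF; elim: r => [|i r IHr].
  by rewrite (_ : (fun _ => _) = fun=> 0); [exact: polyfun_cst|apply/funext => x; rewrite big_nil].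
rewrite (_ : (fun _ => _) = fun x => F i x + \sum_(j <- r) F j x); first exact: polyfun_add.
by apply/funext => x; rewrite big_cons.
Qed.

Lemma partial_mul i (f g : Rd -> R) x : differentiable f x -> differentiable g x ->
  partial i (fun x => f x * g x) x = f x * partial i g x + g x * partial i f x.
Proof. by move=> df dg; rewrite /partial deriveM//; exact: diff_derivable. Qed.

Lemma polyfun_differentiable p : polyfun p ->
  (forall x, differentiable p x) /\ forall i, polyfun (partial i p).
Proof.
elim=> [c|j|f g _ [df pf] _ [dg pg]|f g Pf [df pf] Pg [dg pg]].
- split=> [x|i]; first exact: differentiable_cst.
  rewrite (_ : partial i _ = fun=> 0); first exact: polyfun_cst.
  by apply/funext => x; exact: derive_cst.
- have dc x : differentiable (fun x : Rd => x ord0 j) x by exact: differentiable_coord.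
  split=> // i; rewrite (_ : partial i _ = fun=> (i == j)%:R); first exact: polyfun_cst.
  apply/funext => x; rewrite /partial deriveE//.
  have -> : 'd (fun x : Rd => x ord0 j) x = (fun x : Rd => x ord0 j) :> (Rd -> R).
    have lin : linear (fun x : Rd => x ord0 j : R) by move=> k u v; rewrite !mxE.
    exact: (@diff_lin _ _ _ (HB.pack_for {linear Rd -> R} (fun x : Rd => x ord0 j : R)
      (GRing.isLinear.Build _ _ _ _ _ lin)) x (@coord_continuous _ _ _ ord0 j)).
  by rewrite mxE eqxx eq_sym.
- split=> [x|i]; first exact: differentiableD.
  rewrite (_ : partial i _ = fun x => partial i f x + partial i g x); first exact: polyfun_add.
  by apply/funext => x; rewrite /partial deriveD//; exact: diff_derivable.
- split=> [x|i]; first exact: differentiableM.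
  rewrite (_ : partial i _ = fun x => f x * partial i g x + g x * partial i f x).
    by apply: polyfun_add; exact: polyfun_mul.
  by apply/funext => x; exact: partial_mul.
Qed.

Lemma polyfun_growth p : polyfun p ->
  exists (C : R) (N : nat), 0 <= C /\ forall x, `|p x| <= C * (1 + `|x|) ^+ N.
Proof.
have x1 x : 1 <= 1 + `|x| by rewrite lerDl.
elim=> [c|j|f g _ [C [N [C0 Hf]]] _ [D [M [D0 Hg]]]|f g _ [C [N [C0 Hf]]] _ [D [M [D0 Hg]]]].
- by exists `|c|, 0; split=> // x; rewrite expr0 mulr1.
- exists 1, 1; split=> // x; rewrite mul1r expr1 (le_trans (rV_norm_coord _ _))//.
  by rewrite lerDr.
- exists (C + D), (N + M)%N; split=> [|x]; first exact: addr_ge0.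
  rewrite (le_trans (ler_normD _ _))// mulrDl lerD//.
    by rewrite (le_trans (Hf x))//; apply: ler_wpM2l => //; apply: ler_weXn2l => //; exact: leq_addr.
  by rewrite (le_trans (Hg x))//; apply: ler_wpM2l => //; apply: ler_weXn2l => //; exact: leq_addl.
- exists (C * D), (N + M)%N; split=> [|x]; first exact: mulr_ge0.
  by rewrite normrM exprD mulrACA; apply: ler_pM.
Qed.

Definition gauss (b : R) x : R := expR (- (b * \sum_i x ord0 i ^+ 2)).

Lemma gauss_partial b : (forall x, differentiable (gauss b) x) /\
  forall i, exists2 q, polyfun q & partial i (gauss b) = fun x => q x * gauss b x.
Proof.
pose S (x : Rd) : R := - (b * \sum_i x ord0 i ^+ 2).
have pS : polyfun S.
  rewrite (_ : S = fun x => - b * \sum_i x ord0 i * x ord0 i).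
    apply: polyfun_mul; first exact: polyfun_cst.
    by apply: polyfun_sum => i; apply: polyfun_mul; exact: polyfun_coord.
  by apply/funext => y; rewrite /S mulNr; under eq_bigr do rewrite expr2.
have [dS pdS] := polyfun_differentiable pS.
have dE y : differentiable (@expR R) y by exact/derivable1_diffP.
have dg x : differentiable (gauss b) x.
  exact: (@differentiable_comp _ _ _ _ S (@expR R)).
split=> // i; exists (partial i S); first exact: pdS.
apply/funext => x; rewrite /partial !deriveE// (_ : gauss b = @expR R \o S)// diff_comp//=.
rewrite diff1E// derive1E; congr (_ * _).
exact: (@derive_val _ _ _ _ _ _ _ (is_derive_expR (S x))).
Qed.

Definition polygauss b (f : Rd -> R) := exists2 q, polyfun q & f = fun x => q x * gauss b x.

Lemma polygauss_partial b f : polygauss b f ->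
  (forall x, differentiable f x) /\ forall i, polygauss b (partial i f).
Proof.
move=> [q pq ->]; have [dq pdq] := polyfun_differentiable pq.
have [dg Hg] := gauss_partial b.
split=> [x|i]; first exact: differentiableM.
have [r pr Er] := Hg i.
exists (fun x => q x * r x + partial i q x).
  by apply: polyfun_add => //; exact: polyfun_mul.
by apply/funext => x; rewrite partial_mul// Er; ring.
Qed.

Lemma polygauss_rapid b f : 0 < b -> polygauss b f -> rapid f.
Proof.
move=> b0 [q pq ->] k; have [C [N [C0 HC]]] := polyfun_growth pq.
pose n : R := (k + N)%:R.
(* From [1 + r <= expR r] the polynomial factor is at most [expR (n r)], and
   [n r - b r ^ 2 <= n ^ 2 / b] follows from [(n - b r) ^ 2 >= 0] and [n b r >= 0]. *)
exists (C * expR (n ^+ 2 / b)) => x.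
rewrite normrM (ger0_norm (expR_ge0 _)) mulrA.
apply: (@le_trans _ _ ((1 + `|x|) ^+ k * (C * (1 + `|x|) ^+ N) * gauss b x)).
  by rewrite ler_wpM2r ?expR_ge0// ler_wpM2l ?exprn_ge0 ?addr_ge0.
rewrite mulrCA -exprD -mulrA ler_wpM2l//.
apply: (@le_trans _ _ (expR (n * `|x|) * expR (- (b * `|x| ^+ 2)))).
  rewrite ler_pM ?expR_ge0 ?exprn_ge0 ?addr_ge0//.
    by rewrite /n expRM_natl lerXn2r ?nnegrE ?addr_ge0 ?expR_ge0// expR_ge1Dx.
  rewrite /gauss ler_expR lerN2 ler_wpM2l ?(ltW b0)//.
  have -> : \sum_i x ord0 i ^+ 2 = enorm x ^+ 2.
    by rewrite sqr_sqrtr// sumr_ge0// => i _; exact: sqr_ge0.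
  by rewrite lerXn2r ?nnegrE ?sqrtr_ge0// norm_le_enorm.
rewrite -expRD ler_expR ler_pdivlMr// mulrDl.
have := sqr_ge0 (n - b * `|x|); have : 0 <= n * (b * `|x|) by rewrite !mulr_ge0// ltW.
rewrite !expr2; move: (`|x|) => r; nra.
Qed.

Lemma gauss_schwartz b : 0 < b -> schwartz (gauss b).
Proof.
move=> b0; apply/schwartzP => s.
have pg : polygauss b (partials s (gauss b)).
  elim: s => [|i s IHs] /=.
    exists (fun=> 1); first exact: polyfun_cst.
    by apply/funext => x; rewrite mul1r.
  exact: (polygauss_partial IHs).2.
by split; [exact: (polygauss_partial pg).1|exact: polygauss_rapid pg].
Qed.

(** Makes the calculus of [kint] available for mollification. The required decay is of order 3 for
    [growth 1] plus [d + 1] for the weight. *)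
Lemma gauss_kernel : exists C, decaying_kernel (gauss 1) 1 1 C.
Proof.
have sg := gauss_schwartz ltr01; have [M HM] := schwartz_rapid sg (3 + d.+1)%N.
exists M; split.
- exact: schwartz_continuous.
- by move=> z; exact: expR_ge0.
- by move=> z; rewrite /gauss; congr (expR (- (_ * _))); apply: eq_bigr => i _; rewrite mxE sqrrN.
- by rewrite ltr01 lexx.
- exact: ltr01.
move=> z; rewrite /growth /weight powRr1 ?addr_ge0// powRN natr1.
rewrite powR_mulrn ?addr_ge0// ler_pdivlMr ?exprn_gt0 ?ltr_wpDr//.
by rewrite -exprSr -mulrA -exprD mulrC -(ger0_norm (expR_ge0 _ : 0 <= gauss 1 z)).
Qed.

End gaussian.

(** * The two-scale expansion *)

Section two_scale.
Context (R : realType) (d : nat).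
Local Notation Rd := 'rV[R]_d.
Local Notation leb := (lebesgue_rV R d).

(* The increment of [u_eps] from [x] to [x - eps z]: primed letters are the values at
   [x - eps z], the subtracted sums are the integrands of the two cell problems, and
   the right-hand side consists of Taylor remainders. *)
Lemma two_scale_identity (eps u u' : R) (k k' D D' z : 'I_d -> R) (B B' c c' : 'I_d -> 'I_d -> R) :
  (u' + eps * \sum_i k' i * D' i + eps ^+ 2 * \sum_i \sum_j c' i j * B' i j) -
  (u + eps * \sum_i k i * D i + eps ^+ 2 * \sum_i \sum_j c i j * B i j) -
  (\sum_i eps * D i * (k' i - k i - z i) + \sum_i \sum_j eps ^+ 2 * B i j *
     (2^-1 * z i * z j - z i * k' j + c' i j - c i j)) =
  (u' - u - \sum_i (- eps * z i) * D i - 2^-1 * \sum_i \sum_j (- eps * z i) * (- eps * z j) * B i j) +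
  eps * \sum_i k' i * (D' i - D i - \sum_j (- eps * z j) * B j i) +
  eps ^+ 2 * \sum_i \sum_j c' i j * (B' i j - B i j).
Proof.
have -> : \sum_i eps * D i * (k' i - k i - z i) =
    eps * (\sum_i k' i * D i - \sum_i k i * D i - \sum_i z i * D i).
  by rewrite -!sumrB mulr_sumr; apply: eq_bigr => i _; ring.
have -> : \sum_i \sum_j eps ^+ 2 * B i j * (2^-1 * z i * z j - z i * k' j + c' i j - c i j) =
    eps ^+ 2 * (2^-1 * \sum_i \sum_j z i * z j * B i j - \sum_i \sum_j z i * k' j * B i j +
      \sum_i \sum_j c' i j * B i j - \sum_i \sum_j c i j * B i j).
  rewrite [2^-1 * _]mulr_sumr -sumrB -big_split -sumrB mulr_sumr; apply: eq_bigr => i _ /=.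
  rewrite [2^-1 * \sum_(_ < _) _]mulr_sumr -sumrB -big_split -sumrB mulr_sumr; apply: eq_bigr => j _ /=; ring.
have -> : \sum_i (- eps * z i) * D i = - eps * \sum_i z i * D i.
  by rewrite mulr_sumr; apply: eq_bigr => i _; ring.
have -> : \sum_i \sum_j (- eps * z i) * (- eps * z j) * B i j =
    eps ^+ 2 * \sum_i \sum_j z i * z j * B i j.
  rewrite mulr_sumr; apply: eq_bigr => i _; rewrite mulr_sumr; apply: eq_bigr => j _; ring.
have -> : \sum_i k' i * (D' i - D i - \sum_j (- eps * z j) * B j i) =
    \sum_i k' i * D' i - \sum_i k' i * D i + eps * \sum_i \sum_j z i * k' j * B i j.
  rewrite [\sum_i \sum_j z i * k' j * B i j]exchange_big mulr_sumr -sumrB -big_split.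
  apply: eq_bigr => i _ /=; rewrite mulrBr mulrBr [eps * _]mulr_sumr [k' i * \sum_j _]mulr_sumr.
  by rewrite -sumrN; congr (_ + _); apply: eq_bigr => j _; ring.
have -> : \sum_i \sum_j c' i j * (B' i j - B i j) =
    \sum_i \sum_j c' i j * B' i j - \sum_i \sum_j c' i j * B i j.
  by rewrite -sumrB; apply: eq_bigr => i _; rewrite -sumrB; apply: eq_bigr => j _; ring.
ring.
Qed.

Lemma ord_sum_le (F : 'I_d -> R) (M : R) : (forall i, `|F i| <= M) -> `|\sum_i F i| <= d%:R * M.
Proof.
move=> FM; rewrite (le_trans (ler_norm_sum _ _ _))//.
by rewrite (le_trans (ler_sum _ (fun i _ => FM i)))// sumr_const card_ord mulr_natl.
Qed.

(** For [q <= 1] the cubic bound is the better one and [q ^ 3 <= q ^ (2 + s)]; for [q > 1] the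
    quadratic one is used with [q ^ 2 <= q ^ (2 + s)]. The result can be integrated against the
    kernel even when the cube cannot. *)
Lemma powR_interpolation (s A B r q : R) : 0 < s <= 1 -> 0 <= A -> 0 <= B -> 0 <= q ->
  r <= A * q ^+ 2 -> r <= B * q ^+ 3 -> r <= (A + B) * (q ^+ 2 * q `^ s).
Proof.
move=> /andP[s0 s1] A0 B0 q0 rA rB; have [q1|q1] := leP q 1.
  apply: (le_trans rB); apply: (@le_trans _ _ (B * (q ^+ 2 * q `^ s))); last first.
    by rewrite ler_wpM2r ?lerDr// mulr_ge0 ?exprn_ge0 ?powR_ge0.
  rewrite ler_wpM2l// exprSr ler_wpM2l ?exprn_ge0//.
  have [->|q'] := eqVneq q 0; first by rewrite powR_ge0.
  have qp : 0 < q by rewrite lt_neqAle eq_sym q'.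
  by rewrite -{1}(powRr1 q0); apply: ger_powR; rewrite ?qp.
apply: (le_trans rA); apply: (@le_trans _ _ (A * (q ^+ 2 * q `^ s))); last first.
  by rewrite ler_wpM2r ?lerDl// mulr_ge0 ?exprn_ge0 ?powR_ge0.
rewrite ler_wpM2l// ler_peMr ?exprn_ge0//.
have := @ge0_ler_powR R s (ltW s0) 1 q; rewrite powR1; apply; rewrite ?nnegrE//; exact: ltW.
Qed.

Context (a : Rd -> R) (s t C : R) (ka : decaying_kernel a s t C).
Context (a_int : 0 < \int[leb]_x a x).
Context (lam mu : Rd -> R) (alpha1 alpha2 : R) (lam_cper : cper lam) (mu_cper : cper mu).
Context (alpha1_gt0 : 0 < alpha1).
Context (lam_bnd : forall x, alpha1 <= lam x <= alpha2).
Context (mu_bnd : forall x, alpha1 <= mu x <= alpha2).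

Let mu0 x : 0 < mu x. Proof. by have /andP[+ _] := mu_bnd x; exact: lt_le_trans. Qed.
Let lam0 x : 0 < lam x. Proof. by have /andP[+ _] := lam_bnd x; exact: lt_le_trans. Qed.

Lemma drift_admissible i (k : Rd -> R) (x : Rd) : cper k ->
  exists K, admissible s K (fun z : Rd => mu (x - z) * (k (x - z) - k x - z ord0 i)).
Proof.
move=> ck; have [K1 HK1] := cper_admissible ka (cperM mu_cper (cperB ck (cper_cst _ (k x)))).
have [K2 HK2] : exists K, forall x, admissible s K (fun z : Rd => z ord0 i * mu (x - z)).
  apply: admissible_growthM mu_cper; first exact: measurable_coord.
  by move=> z; rewrite (le_trans _ (norm_le_growth ka z (isT : 1 <= 2)%N))// expr1 rV_norm_coord.
exists (K1 + `|-1| * K2); have := admissibleD (HK1 x) (admissibleZ (-1) (HK2 x)).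
by congr admissible; apply/funext => z; ring.
Qed.

Lemma diffusion_admissible i j (k c : Rd -> R) (x : Rd) : cper k -> cper c ->
  exists K, admissible s K (fun z : Rd => mu (x - z) *
    (2^-1 * z ord0 i * z ord0 j - z ord0 i * k (x - z) + c (x - z) - c x)).
Proof.
move=> ck cc; have [K1 HK1] := cper_admissible ka (cperM mu_cper (cperB cc (cper_cst _ (c x)))).
have [K2 HK2] : exists K, forall x, admissible s K (fun z : Rd => z ord0 i * (mu (x - z) * k (x - z))).
  apply: (admissible_growthM _ _ (cperM mu_cper ck)); first exact: measurable_coord.
  by move=> z; rewrite (le_trans _ (norm_le_growth ka z (isT : 1 <= 2)%N))// expr1 rV_norm_coord.
have [K3 HK3] : exists K, forall x, admissible s K (fun z : Rd => (2^-1 * z ord0 i * z ord0 j) * mu (x - z)).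
  apply: (admissible_growthM _ _ mu_cper).
    by apply: measurable_funM; [apply: measurable_funM => //|]; exact: measurable_coord.
  move=> z; rewrite (le_trans _ (norm_le_growth ka z (isT : 2 <= 2)%N))// !normrM expr2.
  rewrite ler_pM ?mulr_ge0 ?rV_norm_coord// ger0_norm// (le_trans _ (rV_norm_coord z i))//.
  by rewrite ler_piMl//; lra.
exists (K3 + `|-1| * K2 + K1).
have := admissibleD (admissibleD (HK3 x) (admissibleZ (-1) (HK2 x))) (HK1 x).
by congr admissible; apply/funext => z; ring.
Qed.

Lemma C0_sumE (I : Type) (r : seq I) (F : I -> C0 R d) (x : Rd) :
  (\sum_(i <- r) F i) x = \sum_(i <- r) F i x.
Proof. by elim: r => [|i r IHr]; rewrite ?big_nil// !big_cons C0_addE IHr. Qed.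

Lemma two_scale_C0 (eps : R) (u0 : Rd -> R) (k1 : 'I_d -> Rd -> R) (chi : 'I_d -> 'I_d -> Rd -> R) :
  0 < eps -> schwartz u0 -> (forall i, cper (k1 i)) -> (forall i j, cper (chi i j)) ->
  exists u : C0 R d, forall x, u x = u0 x + eps * \sum_i k1 i (eps^-1 *: x) * partial i u0 x +
    eps ^+ 2 * \sum_i \sum_j chi i j (eps^-1 *: x) * partial i (partial j u0) x.
Proof.
move=> eps0 su ck cc.
have prod f g : cper f -> schwartz g -> exists w : C0 R d, forall x, w x = f (eps^-1 *: x) * g x.
  move=> cf /schwartz_C0[v Hv]; have [K HK] := cper_bounded cf.
  have [w Hw] := @C0_bounded_mul R d (fun x => f (eps^-1 *: x)) K v (cper_scale (eps := eps) cf)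
    (fun x => HK _).
  by exists w => x; rewrite Hw Hv.
have [u Hu] := schwartz_C0 su.
have /choice[v Hv] := fun i => prod _ _ (ck i) (schwartz_partial i su).
have /choice[w Hw] := fun p : 'I_d * 'I_d =>
  prod _ _ (cc p.1 p.2) (schwartz_partial p.1 (schwartz_partial p.2 su)).
exists (u + eps *: (\sum_i v i) + eps ^+ 2 *: \sum_i \sum_j w (i, j)) => x.
rewrite !C0_addE !C0_scaleE Hu !C0_sumE; congr (_ + _ * _ + _ * _).
  by apply: eq_bigr => i _; rewrite Hv.
by apply: eq_bigr => i _; rewrite C0_sumE; apply: eq_bigr => j _; rewrite Hw.
Qed.

(** The first line is of order [2 + s] in [eps] by interpolation. The other two are of order 3, and
    [eps <= eps ^ s]. The correctors enter through a bound on their values only, so [Kr] is uniform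
    in [eps], [x] and [z]. *)
Lemma two_scale_remainder (u0 : Rd -> R) (K0 Kc : R) : schwartz u0 -> 0 <= K0 -> 0 <= Kc ->
  (forall r : seq 'I_d, (size r <= 3)%N -> forall x, `|partials r u0 x| <= K0) ->
  exists2 Kr : R, 0 <= Kr & forall (eps : R) (k : 'I_d -> R) (c : 'I_d -> 'I_d -> R) (x z : Rd),
  0 < eps <= 1 -> (forall i, `|k i| <= Kc) -> (forall i j, `|c i j| <= Kc) ->
  `|(u0 (x - eps *: z) - u0 x - \sum_i (- eps * z ord0 i) * partial i u0 x -
     2^-1 * \sum_i \sum_j (- eps * z ord0 i) * (- eps * z ord0 j) * partial i (partial j u0) x) +
   eps * \sum_i k i * (partial i u0 (x - eps *: z) - partial i u0 x -
     \sum_j (- eps * z ord0 j) * partial j (partial i u0) x) +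
   eps ^+ 2 * \sum_i \sum_j c i j * (partial i (partial j u0) (x - eps *: z) -
     partial i (partial j u0) x)| <= Kr * (eps ^+ 2 * eps `^ s * growth s z).
Proof.
move=> su K00 Kc0 HK; have hs : 0 < s <= 1 := ker_s ka.
have s0 : 0 <= s by case/andP: hs => /ltW.
pose A1 := d%:R * K0; pose A2 := d%:R * A1; pose A3 := d%:R * A2.
have A10 : 0 <= A1 by rewrite mulr_ge0.
have A20 : 0 <= A2 by rewrite mulr_ge0.
have A30 : 0 <= A3 by rewrite mulr_ge0.
exists (A2 + A2 + A3 + d%:R * (Kc * A2) + d%:R * (d%:R * (Kc * A1))).
  by rewrite !addr_ge0 ?mulr_ge0.
move=> eps k c x z /andP[eps0 eps1] kK cK.
pose h : Rd := - eps *: z; have hE i : h ord0 i = - eps * z ord0 i by rewrite mxE.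
have -> : x - eps *: z = x + h by rewrite /h scaleNr.
under eq_bigr do rewrite -hE.
under [X in 2^-1 * X]eq_bigr do under eq_bigr do rewrite -!hE.
under [X in eps * X]eq_bigr do under eq_bigr do rewrite -hE.
pose q := eps * `|z|; have nh : `|h| = q by rewrite /h normrZ normrN gtr0_norm.
have q0 : 0 <= q by rewrite mulr_ge0 ?(ltW eps0).
have T1 r : (size r <= 2)%N -> `|partials r u0 (x + h) - partials r u0 x| <= A1 * q.
  move=> r2; rewrite -nh; apply: (taylor1 (su r).1) => i y.
  exact: (HK (i :: r)).
have T2 r : (size r <= 1)%N -> `|partials r u0 (x + h) - partials r u0 x -
    \sum_i h ord0 i * partial i (partials r u0) x| <= A2 * q ^+ 2.
  move=> r1; rewrite -nh; apply: (taylor2 (su r).1 (fun i => (su (i :: r)).1)) => i j y.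
  exact: (HK (j :: i :: r)).
have T3 : `|u0 (x + h) - u0 x - \sum_i h ord0 i * partial i u0 x -
     2^-1 * \sum_i \sum_j h ord0 i * h ord0 j * partial i (partial j u0) x| <= A3 * q ^+ 3.
  rewrite -nh; apply: (taylor3 (su [::]).1 (fun i => (su [:: i]).1)
    (fun i j => (su [:: j; i]).1)) => i j l y; exact: (HK [:: l; j; i]).
have H2 : `|\sum_i \sum_j h ord0 i * h ord0 j * partial i (partial j u0) x| <= A2 * q ^+ 2.
  under eq_bigr do (under eq_bigr do rewrite -mulrA; rewrite -mulr_sumr).
  apply: (le_trans (sum_coord_le (M := A1 * `|h|) _ _)) => [i|]; last first.
    by rewrite nh /A2 expr2 !mulrA.
  by apply: sum_coord_le => j; exact: (HK [:: i; j]).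
(* The quadratic bound is the second-order remainder plus the second-order term itself; the cubic
   one is [T3]. *)
have B0 : `|u0 (x + h) - u0 x - \sum_i h ord0 i * partial i u0 x -
     2^-1 * \sum_i \sum_j h ord0 i * h ord0 j * partial i (partial j u0) x| <=
     (A2 + A2 + A3) * (q ^+ 2 * q `^ s).
  apply: powR_interpolation => //; first exact: addr_ge0.
  rewrite (le_trans (ler_normB _ _))// mulrDl lerD//; first exact: (T2 [::]).
  rewrite normrM ger0_norm//; have := normr_ge0 (\sum_i \sum_j h ord0 i * h ord0 j * partial i (partial j u0) x).
  lra.
have g2 := norm_le_growth ka z (isT : 2 <= 2)%N.
have g1 := norm_le_growth ka z (isT : 1 <= 2)%N; rewrite expr1 in g1.
have eps_s : eps <= eps `^ s.
  by rewrite -{1}(powRr1 (ltW eps0)); apply: ger_powR; [rewrite eps0|case/andP: hs].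
have e2 : 0 <= eps ^+ 2 by rewrite exprn_ge0 ?(ltW eps0).
have gr0 : 0 <= growth s z by exact: le_trans (growth_ge1 ka z).
have Q : q ^+ 2 * q `^ s <= eps ^+ 2 * eps `^ s * growth s z.
  rewrite /q exprMn powRM ?(ltW eps0)// mulrACA ler_wpM2l ?(mulr_ge0 e2) ?powR_ge0//.
  rewrite ler_pM ?exprn_ge0 ?powR_ge0//; first by rewrite lerXn2r ?nnegrE ?addr_ge0// lerDr.
  by apply: (ge0_ler_powR s0); rewrite ?nnegrE ?addr_ge0// lerDr.
have Q2 : eps * q ^+ 2 <= eps ^+ 2 * eps `^ s * growth s z.
  have -> : eps * q ^+ 2 = eps ^+ 2 * (eps * `|z| ^+ 2) by rewrite /q; ring.
  by rewrite -mulrA; apply: (ler_wpM2l e2); apply: ler_pM; rewrite ?(ltW eps0) ?exprn_ge0.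
have Q1 : eps ^+ 2 * q <= eps ^+ 2 * eps `^ s * growth s z.
  by rewrite /q -mulrA; apply: (ler_wpM2l e2); apply: ler_pM; rewrite ?(ltW eps0).
rewrite (le_trans (ler_normD _ _))// [leRHS]mulrDl lerD//.
  rewrite (le_trans (ler_normD _ _))// [leRHS]mulrDl lerD//.
    by rewrite (le_trans B0)// ler_wpM2l// !addr_ge0.
  rewrite normrM (gtr0_norm eps0).
  apply: (@le_trans _ _ (eps * (d%:R * (Kc * (A2 * q ^+ 2))))).
    rewrite ler_wpM2l ?(ltW eps0)//; apply: ord_sum_le => i; rewrite normrM ler_pM//.
    exact: (T2 [:: i]).
  apply: le_trans (ler_wpM2l _ Q2); last by rewrite !mulr_ge0.
  by rewrite le_eqVlt; apply/orP; left; apply/eqP; ring.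
rewrite normrM (ger0_norm e2).
apply: (@le_trans _ _ (eps ^+ 2 * (d%:R * (d%:R * (Kc * (A1 * q)))))).
  rewrite ler_wpM2l//; apply: ord_sum_le => i; apply: ord_sum_le => j; rewrite normrM ler_pM//.
  exact: (T1 [:: i; j]).
apply: le_trans (ler_wpM2l _ Q1); last by rewrite !mulr_ge0.
by rewrite le_eqVlt; apply/orP; left; apply/eqP; ring.
Qed.

Context (Theta : 'M[R]_d) (k1 : 'I_d -> Rd -> R).
Context (k1_cper : forall i, cper (k1 i)).
Context (k1_eq : forall i x,
  kint a (fun z => mu (x - z) * (k1 i (x - z) - k1 i x - z ord0 i)) = 0).
Context (chi_ex : forall e, 0 < e -> exists chi : 'I_d -> 'I_d -> Rd -> R,
  (forall i j, cper (chi i j)) /\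
  forall i j x, `|kint a (fun z => mu (x - z) * (2^-1 * z ord0 i * z ord0 j -
    z ord0 i * k1 j (x - z) + chi i j (x - z) - chi i j x)) - Theta i j / lam x| <= e).

Local Notation D2 u x := (\sum_i \sum_j Theta i j * partial i (partial j u) x).

(** The tolerance [e] of the second corrector is fixed before [eps], because [K] depends on it
    through the bound of [chi]. Its own contribution carries no power of [eps]: it is multiplied by
    [lam] and by the second derivatives of [u0]. *)
Lemma two_scale_expansion (u0 : Rd -> R) (K0 e : R) : schwartz u0 -> 0 <= K0 -> 0 < e ->
  (forall r : seq 'I_d, (size r <= 3)%N -> forall x, `|partials r u0 x| <= K0) ->
  exists K, forall eps, 0 < eps <= 1 -> exists u h, [/\ L_eps a lam mu eps (u, h),
    forall x, `|u x - u0 x| <= eps * K &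
    forall x, `|h x - D2 u0 x| <= alpha2 * (d%:R * (d%:R * (K0 * e))) + eps `^ s * K].
Proof.
move=> su K00 e0 HK; have [chi [chi_cper chi_eq]] := chi_ex e0.
have [Kc Kc0 Hk] : exists2 K : R, 0 <= K & forall i x, `|k1 i x| <= K.
  by apply: family_bounded => i; exact: cper_bounded.
have [Kd Kd0 Hc] : exists2 K : R, 0 <= K & forall p x, `|chi p.1 p.2 x| <= K.
  apply: (@family_bounded R d ('I_d * 'I_d)%type (fun p => chi p.1 p.2)) => p.
  exact: cper_bounded.
pose Km : R := Kc + Kd; have Km0 : 0 <= Km by rewrite addr_ge0.
have k1K i x : `|k1 i x| <= Km by rewrite (le_trans (Hk i x))// lerDl.
have chiK i j x : `|chi i j x| <= Km by rewrite (le_trans (Hc (i, j) x))// lerDr.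
have [Kr Kr0 HR] := two_scale_remainder su K00 Km0 HK.
have a20 : 0 <= alpha2 by have /andP[_ +] := mu_bnd 0; apply: le_trans; exact: ltW.
pose Kg := kint a (growth s).
pose K1 : R := d%:R * (Km * K0) + d%:R * (d%:R * (Km * K0)).
have K10 : 0 <= K1 by rewrite addr_ge0// !mulr_ge0.
pose K2 : R := alpha2 * (alpha2 * Kr * Kg).
exists (K1 + `|K2|) => eps /andP[eps0 eps1].
have [u Hu] := two_scale_C0 eps0 su k1_cper chi_cper.
have [h Lh] := L_eps_total ka a_int lam_cper mu_cper alpha1_gt0 lam_bnd mu_bnd eps0 u.
exists u, h; split=> // x.
  rewrite Hu -[u0 x + _ + _]addrA (addrC (u0 x)) addrK.
  apply: (@le_trans _ _ (eps * K1)); last by rewrite ler_wpM2l ?lerDl ?(ltW eps0).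
  rewrite (le_trans (ler_normD _ _))// /K1 mulrDr lerD//.
    rewrite normrM (gtr0_norm eps0) ler_wpM2l ?(ltW eps0)//; apply: ord_sum_le => i.
    by rewrite normrM ler_pM//; exact: (HK [:: i]).
  rewrite normrM ger0_norm ?exprn_ge0 ?(ltW eps0)//.
  apply: ler_pM; rewrite ?exprn_ge0 ?(ltW eps0)//.
    by rewrite expr2 ler_piMr ?(ltW eps0).
  apply: ord_sum_le => i; apply: ord_sum_le => j.
  by rewrite normrM ler_pM//; exact: (HK [:: i; j]).
pose xi := eps^-1 *: x.
have en0 : eps != 0 by rewrite gt_eqF.
have xiE (z : Rd) : eps^-1 *: (x - eps *: z) = xi - z.
  by rewrite scalerBr scalerA mulVf// scale1r.
pose T (z : Rd) := mu (xi - z) * (u (x - eps *: z) - u x).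
pose G1 i (z : Rd) := mu (xi - z) * (k1 i (xi - z) - k1 i xi - z ord0 i).
pose G2 i j (z : Rd) := mu (xi - z) * (2^-1 * z ord0 i * z ord0 j -
    z ord0 i * k1 j (xi - z) + chi i j (xi - z) - chi i j xi).
pose S (z : Rd) := \sum_i eps * partial i u0 x * G1 i z +
  \sum_i \sum_j eps ^+ 2 * partial i (partial j u0) x * G2 i j z.
have /choice[A1 aG1] : forall i, exists K, admissible s K (G1 i).
  by move=> i; exact: drift_admissible.
have /choice[A2 aG2] : forall p : 'I_d * 'I_d, exists K, admissible s K (G2 p.1 p.2).
  by move=> p; exact: diffusion_admissible.
have aS1 := fun i => admissibleZ (eps * partial i u0 x) (aG1 i).
have aS2 := fun i j => admissibleZ (eps ^+ 2 * partial i (partial j u0) x) (aG2 (i, j)).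
have aS2' i := admissible_sum (index_enum 'I_d) xpredT (aS2 i).
have aS : exists K, admissible s K S.
  eexists; apply: admissibleD; first exact: (admissible_sum _ xpredT aS1).
  exact: (admissible_sum _ xpredT aS2').
have [KS {}aS] := aS.
(* The first cell problem annihilates the part of order [eps], which would become [1 / eps] after
   the division by [eps ^ 2]. *)
have kS : kint a S = eps ^+ 2 * \sum_i \sum_j partial i (partial j u0) x * kint a (G2 i j).
  rewrite /S (kintD ka (admissible_sum _ xpredT aS1) (admissible_sum _ xpredT aS2')).
  rewrite (kint_sum ka _ xpredT aS1) big1 ?add0r => [|i _]; last first.
    by rewrite (kintZ ka _ (aG1 i)) k1_eq mulr0.
  rewrite (kint_sum ka _ xpredT aS2') mulr_sumr; apply: eq_bigr => i _.
  rewrite (kint_sum ka _ xpredT (aS2 i)) mulr_sumr; apply: eq_bigr => j _.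
  by rewrite (kintZ ka _ (aG2 (i, j))) mulrA.
have [Kmu aMu] := cper_admissible ka mu_cper.
have aT : exists K, admissible s K T.
  exists (alpha2 * `|u| + `|- u x| * Kmu).
  have := admissibleD (admissible_jump ka mu_cper alpha1_gt0 mu_bnd eps u x) (admissibleZ (- u x) (aMu xi)).
  by congr admissible; apply/funext => z; rewrite /T; ring.
have [KT {}aT] := aT.
have aRem : admissible s (alpha2 * Kr * (eps ^+ 2 * eps `^ s)) (fun z => T z - S z).
  split; first exact: measurable_funB aT.1 aS.1.
  move=> z; have -> : T z - S z = mu (xi - z) * (u (x - eps *: z) - u x -
     (\sum_i eps * partial i u0 x * (k1 i (xi - z) - k1 i xi - z ord0 i) +
      \sum_i \sum_j eps ^+ 2 * partial i (partial j u0) x * (2^-1 * z ord0 i * z ord0 j -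
    z ord0 i * k1 j (xi - z) + chi i j (xi - z) - chi i j xi))).
    rewrite mulrBr; congr (_ - _); rewrite mulrDr !mulr_sumr; congr (_ + _).
      by apply: eq_bigr => i _; rewrite /G1; ring.
    by apply: eq_bigr => i _; rewrite mulr_sumr; apply: eq_bigr => j _; rewrite /G2; ring.
  rewrite !Hu xiE -/xi two_scale_identity normrM ger0_norm ?(ltW (mu0 _))//.
  rewrite -!(mulrA alpha2) ler_pM ?(ltW (mu0 _))//; first by have /andP[] := mu_bnd (xi - z).
  rewrite -mulrA; apply: HR => //; by rewrite eps0.
(* Two sources of error remain: the inexact solution of the second cell problem, and the Taylor
   remainders collected in [T - S]. *)
have hE : h x - D2 u0 x = lam xi * \sum_i \sum_j partial i (partial j u0) x *
    (kint a (G2 i j) - Theta i j / lam xi) + eps ^- 2 * lam xi * kint a (fun z => T z - S z).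
  rewrite (Lh x) (L_eps_integralE ka lam mu_cper alpha1_gt0 mu_bnd eps0) (kintB ka aT aS) kS.
  rewrite -/xi -[kint a (fun z => _ * _)]/(kint a T) mulrBr [_ * (eps ^+ 2 * _)]mulrA.
  have -> : eps ^- 2 * lam xi * eps ^+ 2 = lam xi by field.
  have -> : \sum_i \sum_j partial i (partial j u0) x * (kint a (G2 i j) - Theta i j / lam xi) =
      \sum_i \sum_j partial i (partial j u0) x * kint a (G2 i j) - (lam xi)^-1 * D2 u0 x.
    rewrite mulr_sumr -sumrB; apply: eq_bigr => i _; rewrite mulr_sumr -sumrB.
    by apply: eq_bigr => j _; ring.
  rewrite mulrBr [lam xi * ((lam xi)^-1 * _)]mulrA mulfV ?gt_eqF// mul1r; ring.
rewrite hE (le_trans (ler_normD _ _))// lerD//.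
  rewrite normrM ger0_norm ?(ltW (lam0 _))// ler_pM ?(ltW (lam0 _))//.
    by have /andP[] := lam_bnd xi.
  apply: ord_sum_le => i; apply: ord_sum_le => j; rewrite normrM ler_pM//.
  - exact: (HK [:: i; j]).
  - exact: chi_eq.
have := kint_norm_le ka aRem; rewrite -/Kg => hr.
have e2 : 0 < eps ^+ 2 by exact: exprn_gt0.
suff hr2 : `|eps ^- 2 * lam xi * kint a (fun z => T z - S z)| <= eps `^ s * K2.
  apply: (le_trans hr2); apply: ler_wpM2l; first exact: powR_ge0.
  by rewrite (le_trans (ler_norm _))// lerDr.
rewrite normrM ger0_norm ?mulr_ge0 ?invr_ge0 ?(ltW e2) ?(ltW (lam0 _))//.
rewrite -mulrA mulrC ler_pdivrMr//.
have -> : eps `^ s * K2 * eps ^+ 2 = alpha2 * (alpha2 * Kr * (eps ^+ 2 * eps `^ s) * Kg).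
  by rewrite /K2; ring.
rewrite ler_pM ?(ltW (lam0 _))//; by have /andP[] := lam_bnd xi.
Qed.

Lemma core_approximation (u0 : Rd -> R) (eta : R) : schwartz u0 -> 0 < eta ->
  exists2 r : R, 0 < r & forall eps, 0 < eps <= r -> exists u h, [/\ L_eps a lam mu eps (u, h),
    forall x, `|u x - u0 x| <= eta & forall x, `|h x - D2 u0 x| <= eta].
Proof.
move=> su eta0; have [K0 K00 HK] := schwartz_bounds 3 su.
have /andP[s0 _] := ker_s ka.
have a20 : 0 <= alpha2 by have /andP[_ +] := mu_bnd 0; apply: le_trans; exact: ltW.
pose c := alpha2 * (d%:R * (d%:R * K0)); have c0 : 0 <= c by rewrite !mulr_ge0.
have c1 : 0 < 2 * (c + 1) by lra.
have e0 : 0 < eta / (2 * (c + 1)) by exact: divr_gt0.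
have [K HK'] := two_scale_expansion su K00 e0 HK.
pose del := eta / (2 * (`|K| + 1)).
have K1 : 0 < 2 * (`|K| + 1) by have := normr_ge0 K; lra.
have del0 : 0 < del by exact: divr_gt0.
have delK : del * K <= eta / 2.
  apply: (@le_trans _ _ (del * (`|K| + 1))).
    by rewrite ler_wpM2l ?(ltW del0)// (le_trans (ler_norm _))// lerDl.
  rewrite le_eqVlt; apply/orP; left; apply/eqP; rewrite /del; field.
  by have := normr_ge0 K; lra.
(* The last two bounds give [eps <= del] and [eps ^ s <= del], and [del * K <= eta / 2]. *)
exists (Num.min 1 (Num.min del (del `^ s^-1))).
  by rewrite !lt_min ltr01 del0 powR_gt0.
move=> eps /andP[eps0]; rewrite !le_min => /and3P[eps1 epsd epss].
have [|u [h [Lh Hu Hh]]] := HK' eps; first by rewrite eps0.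
have small (r : R) : 0 <= r <= del -> r * K <= eta / 2.
  move=> /andP[r0 rd]; have [K2|K2] := leP 0 K.
    by rewrite (le_trans _ delK)// ler_wpM2r.
  by rewrite (@le_trans _ _ 0)// ?mulr_ge0_le0 ?(ltW K2)//; lra.
exists u, h; split=> // x.
  rewrite (le_trans (Hu x))// (le_trans (small eps _)) ?(ltW eps0) ?epsd//; lra.
rewrite (le_trans (Hh x))// [leRHS]splitr lerD//.
  rewrite (_ : _ * _ = c * (eta / (2 * (c + 1)))); last by rewrite /c; ring.
  have -> : c * (eta / (2 * (c + 1))) = c / (c + 1) * (eta / 2) by field; lra.
  apply: ler_piMl; first lra.
  by rewrite ler_pdivrMr; lra.
apply: small; rewrite powR_ge0/=.
have := ge0_ler_powR (ltW s0) _ _ epss; rewrite !nnegrE -powRrM mulVf ?gt_eqF// powRr1 ?(ltW del0)//.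
by apply; rewrite ?powR_ge0// ltW.
Qed.

(* With [k = p . k1], [w = k (x - z) - p . z] and [psi] the function [p . chi p - k ^ 2 / 2],
   the integrand of the second cell problem contracted with [p p^T] is
   [(w - k x) ^ 2 / 2 + k x (w - k x) + psi (x - z) - psi x]: the middle term integrates
   to 0 by the first cell problem, and the increment is at least [- e] where [psi] is
   almost minimal. *)
Lemma effective_matrix_psd (p : 'I_d -> R) : 0 <= \sum_i \sum_j p i * p j * Theta i j.
Proof.
have a20 : 0 <= alpha2 by have /andP[_ +] := mu_bnd 0; apply: le_trans; exact: ltW.
have [Km aMu] := cper_admissible ka mu_cper.
pose M := Km * kint a (growth s).
pose P := \sum_i \sum_j `|p i * p j|.
have P0 : 0 <= P by apply: sumr_ge0 => i _; exact: sumr_ge0.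
have main e : 0 < e -> - (alpha2 * (e * (`|M| + P))) <= \sum_i \sum_j p i * p j * Theta i j.
  move=> e0; have [chi [chi_cper chi_eq]] := chi_ex e0.
  pose k (x : Rd) := \sum_i p i * k1 i x.
  pose X (x : Rd) := \sum_i \sum_j p i * p j * chi i j x.
  have ck : cper k by apply: cper_sum => i; apply: cperM => //; exact: cper_cst.
  have cX : cper X.
    by apply: cper_sum => i; apply: cper_sum => j; apply: cperM => //; exact: cper_cst.
  pose psi (x : Rd) := X x - 2^-1 * (k x * k x).
  have cpsi : cper psi.
    by apply: cperB => //; apply: cperM; [exact: cper_cst|exact: cperM].
  (* A minimum of [psi] up to [e], the same tolerance as that of [chi]; both errors disappear
     together when [e] tends to 0. *)
  have [x Hx] : exists x, forall y, psi x <= psi y + e.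
    have [Kp Hp] := cper_bounded cpsi.
    have hi : has_inf (range psi).
      split; first by exists (psi 0), 0.
      by exists (- Kp) => _ [y _ <-]; have := Hp y; rewrite ler_norml => /andP[].
    have [_ [x _ <-] xe] := inf_adherent e0 hi.
    exists x => y; rewrite (le_trans (ltW xe))// lerD2r; apply: ge_inf; first exact: hi.2.
    by exists y.
  pose q (z : Rd) := \sum_i p i * z ord0 i.
  pose G1 i (z : Rd) := mu (x - z) * (k1 i (x - z) - k1 i x - z ord0 i).
  pose G2 i j (z : Rd) := mu (x - z) * (2^-1 * z ord0 i * z ord0 j -
    z ord0 i * k1 j (x - z) + chi i j (x - z) - chi i j x).
  have /choice[A1 aG1] : forall i, exists K, admissible s K (G1 i).
    by move=> i; exact: drift_admissible.
  have /choice[A2 aG2] : forall ij : 'I_d * 'I_d, exists K, admissible s K (G2 ij.1 ij.2).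
    by move=> ij; exact: diffusion_admissible.
  have aS1 := fun i => admissibleZ (p i) (aG1 i).
  have aS2 := fun i j => admissibleZ (p i * p j) (aG2 (i, j)).
  have aS2' i := admissible_sum (index_enum 'I_d) xpredT (aS2 i).
  have aT1 := admissibleZ (k x) (admissible_sum (index_enum 'I_d) xpredT aS1).
  have aT := admissibleD aT1 (admissibleZ (- e) (aMu x)).
  have aT2 := admissible_sum (index_enum 'I_d) xpredT aS2'.
  have le z : k x * (\sum_i p i * G1 i z) + - e * mu (x - z) <= \sum_i \sum_j p i * p j * G2 i j z.
    have -> : \sum_i p i * G1 i z = mu (x - z) * (k (x - z) - k x - q z).
      rewrite /k /q -!sumrB mulr_sumr; apply: eq_bigr => i _; rewrite /G1; ring.
    have -> : \sum_i \sum_j p i * p j * G2 i j z =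
        mu (x - z) * (2^-1 * (q z * q z) - q z * k (x - z) + X (x - z) - X x).
      rewrite /q /k !big_distrlr/= mulr_sumr /X -sumrB -big_split -sumrB mulr_sumr.
      apply: eq_bigr => i _ /=; rewrite !mulr_sumr -sumrB -big_split -sumrB mulr_sumr.
      by apply: eq_bigr => j _; rewrite /G2/=; ring.
    have := Hx (x - z); have := mu0 (x - z); rewrite /psi.
    set m := mu _; set k' := k (x - z); set X' := X (x - z); move: (k x) (X x) (q z) => kx Xx qz m0 Hp.
    have -> : kx * (m * (k' - kx - qz)) + - e * m = m * (kx * (k' - kx - qz) - e) by ring.
    by rewrite ler_wpM2l ?(ltW m0)//; have := sqr_ge0 (k' - qz - kx); rewrite expr2; lra.
  have := kint_le ka aT aT2 le.
  rewrite (kintD ka aT1 (admissibleZ (- e) (aMu x))) (kintZ ka _ (admissible_sum _ xpredT aS1)).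
  rewrite (kintZ ka _ (aMu x)) (kint_sum ka _ xpredT aS1) big1 ?mulr0 ?add0r; last first.
    by move=> i _; rewrite (kintZ ka _ (aG1 i)) k1_eq mulr0.
  rewrite (kint_sum ka _ xpredT aS2') => h1.
  have h2 : \sum_i kint a (fun z : Rd => \sum_j p i * p j * G2 i j z) <=
      (lam x)^-1 * (\sum_i \sum_j p i * p j * Theta i j) + e * P.
    rewrite /P !mulr_sumr -big_split/=; apply: ler_sum => i _.
    rewrite (kint_sum ka _ xpredT (aS2 i)) !mulr_sumr -big_split/=; apply: ler_sum => j _.
    rewrite (kintZ ka _ (aG2 (i, j)))/= -lerBlDl.
    have -> : p i * p j * kint a (G2 i j) - (lam x)^-1 * (p i * p j * Theta i j) =
      p i * p j * (kint a (G2 i j) - Theta i j / lam x) by ring.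
    rewrite (le_trans (ler_norm _))// normrM [leRHS]mulrC; apply: ler_wpM2l => //.
    exact: chi_eq.
  have hM : kint a (fun z => mu (x - z)) <= `|M|.
    by rewrite (le_trans (ler_norm _))// (le_trans (kint_norm_le ka (aMu x)))// ler_norm.
  have l0 := lam0 x; have /andP[_ l2] := lam_bnd x.
  have h3 : - (e * (`|M| + P)) <= (lam x)^-1 * (\sum_i \sum_j p i * p j * Theta i j).
    have : e * kint a (fun z => mu (x - z)) <= e * `|M| by rewrite ler_wpM2l// ltW.
    by move: h1 h2; lra.
  have {}h3 : - (lam x * (e * (`|M| + P))) <= \sum_i \sum_j p i * p j * Theta i j.
    by rewrite -mulrN -ler_pdivlMl.
  apply: le_trans h3; rewrite lerN2 ler_wpM2r// mulr_ge0 ?addr_ge0 ?(ltW e0)//.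
rewrite -[leRHS]addr0; apply/ler_addgt0Pl => e e0.
pose c := alpha2 * (`|M| + P); have c0 : 0 <= c by rewrite mulr_ge0 ?addr_ge0.
have := main (e / (c + 1)) (divr_gt0 e0 (ltr_wpDl c0 ltr01)).
have -> : alpha2 * (e / (c + 1) * (`|M| + P)) = c / (c + 1) * e by rewrite /c; ring.
have : c / (c + 1) * e <= e.
  by rewrite ler_piMl ?(ltW e0)// ler_pdivrMr ?mul1r ?lerDl// ltr_wpDl.
lra.
Qed.

End two_scale.

(** * Density of Schwartz functions *)

Section mollification.
Context (R : realType) (d : nat).
Local Notation Rd := 'rV[R]_d.
Local Notation leb := (lebesgue_rV R d).
Implicit Types (x y z h : Rd).

(** A Taylor bound thus yields differentiability and the values of the partial derivatives at once,
    which is how [convolution_partial] differentiates under the integral. *)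
Lemma quadratic_remainder_differentiable (f : Rd -> R) x (D : 'I_d -> R) (K : R) :
  (forall h, `|f (x + h) - f x - \sum_i h ord0 i * D i| <= K * `|h| ^+ 2) ->
  differentiable f x /\ forall i, partial i f x = D i.
Proof.
move=> HK; pose L h : R := \sum_i h ord0 i * D i.
have linL : linear L.
  move=> k u v; rewrite /L scaler_sumr -big_split/=; apply: eq_bigr => i _.
  by rewrite !mxE mulrDl /GRing.scale/= mulrA.
pose Ll := HB.pack_for {linear Rd -> R} L (GRing.isLinear.Build _ _ _ _ _ linL).
have cL : continuous Ll.
  have lc i : continuous (fun h => h ord0 i * D i).
    by apply: continuous_mul; [exact: coord_continuous|exact: cst_continuous].
  by apply: continuous_big => // -[y z]; apply: cvgD; [exact: cvg_fst|exact: cvg_snd].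
have E : f \o shift x = cst (f x) + (Ll : Rd -> R) +o_ (0 : Rd) id.
  apply/eqaddoP => e e0; have K1 : 0 < `|K| + 1 by rewrite ltr_wpDl.
  near=> h; rewrite /= (_ : _ h = f (x + h) - f x - L h); last first.
    by rewrite /= !fctE /= opprD addrA (addrC x).
  rewrite (le_trans (HK h))// expr2 mulrA ler_wpM2r//.
  apply: (@le_trans _ _ ((`|K| + 1) * `|h|)).
    by rewrite ler_wpM2r// (le_trans (ler_norm _))// lerDl.
  rewrite mulrC -ler_pdivlMr//; near: h.
  apply/nbhs_ballP; exists (e / (`|K| + 1)); first exact: divr_gt0.
  by move=> h; rewrite -ball_normE/= sub0r normrN => /ltW.
have dE := diff_unique cL E.
have df : differentiable f x by apply/diff_locallyP; rewrite dE.
split=> // i; rewrite /partial deriveE// dE.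
rewrite -[RHS]mul1r -[LHS]/(L _) /L (bigD1 i)//= big1 ?addr0; first by rewrite mxE !eqxx.
by move=> j ji; rewrite mxE eqxx (negPf ji) mul0r.
Unshelve. all: end_near. Qed.

Lemma C0_uniformly_continuous (u : C0 R d) (e : R) : 0 < e ->
  exists2 r, 0 < r & forall x h, `|h| <= r -> `|u (x + h) - u x| <= e.
Proof.
move=> e0; have e2 : 0 < e / 2 by rewrite divr_gt0.
have [M HM] := C0_vanishing u e2.
(* The margin 1, together with [r <= 1], keeps [x + h] beyond radius [M] when [x] is outside [K];
   there both values are below [e / 2]. *)
pose K := [set x : Rd | `|x| <= M + 1].
have cK : compact K.
  apply: bounded_closed_compact.
    exists (M + 1); split; first exact: num_real.
    by move=> N MN x /= /le_trans; apply; exact: ltW.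
  rewrite (_ : K = closed_ball_ Num.norm 0 (M + 1)); first exact: closed_closed_ball_.
  by apply/seteqP; split=> x; rewrite /K /closed_ball_/= sub0r normrN.
have cov : \forall r \near (0 : R)^'+, K `<=` [set x | forall h, `|h| <= r -> `|u (x + h) - u x| <= e].
  move/compact_near_coveringP : cK; apply => x Kx.
  have cu : {for x, continuous u} by exact: (@C0_continuous _ _ u).
  move/continuous_distP : cu => /(_ _ e2) /nbhs_ballP[r /= r0 Hr].
  exists (ball x (r / 2), [set r' | 0 < r' < r / 2]) => /=.
    split; first exact: nbhsx_ballx (divr_gt0 r0 _).
    near=> r'; apply/andP; split=> //.
    by near: r'; apply: nbhs_right_lt; exact: divr_gt0.
  move=> [y r'] /= [xy /andP[r'0 r'r]] h hr.
  rewrite -ball_normE/= in xy.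
  have u1 : `|u x - u y| <= e / 2.
    by apply: Hr; rewrite -ball_normE/=; rewrite (lt_trans xy)//; lra.
  have u2 : `|u x - u (y + h)| <= e / 2.
    apply: Hr; rewrite -ball_normE/= opprD addrA (le_lt_trans (ler_normB _ _))//.
    by rewrite [r]splitr ltr_leD// (le_trans hr)// ltW.
  have -> : u (y + h) - u y = (u x - u y) - (u x - u (y + h)) by ring.
  by rewrite (le_trans (ler_normB _ _))// [e]splitr lerD.
have [r [r0 [r1 Hr]]] : exists r : R, 0 < r /\ r <= 1 /\
    K `<=` [set x | forall h, `|h| <= r -> `|u (x + h) - u x| <= e].
  have : \forall r \near (0 : R)^'+, 0 < r /\ r <= 1 /\
    K `<=` [set x | forall h, `|h| <= r -> `|u (x + h) - u x| <= e].
    near=> r; split=> //; split; first by near: r; exact: nbhs_right_le.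
    by near: r.
  by move=> /filter_ex.
exists r => // x h hr; have [xM|xM] := leP `|x| (M + 1); first exact: Hr.
have h1 : `|u x| < e / 2 by apply: HM; lra.
have h2 : `|u (x + h)| < e / 2.
  apply: HM; have : `|x| <= `|x + h| + `|h| by rewrite -{1}(addrK h x) -[`|h|]normrN ler_normD.
  lra.
by rewrite (le_trans (ler_normB _ _))//; lra.
Unshelve. all: end_near. Qed.

(* The compactly supported function is written as [g w] with [g] a fixed decaying kernel,
   so that its convolutions are integrals against [g]. *)
Section schwartz_convolution.
Context (g : Rd -> R) (s t C : R) (kg : decaying_kernel g s t C).
Context (w : Rd -> R) (M rho : R) (mw : measurable_fun setT w) (wM : forall y, `|w y| <= M)
  (w0 : forall y, rho < `|y| -> w y = 0).

Let M0 : 0 <= M. Proof. exact: le_trans (wM 0). Qed.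

Lemma convolution_admissible (psi : Rd -> R) (K : R) x : continuous psi ->
  (forall y, `|psi y| <= K) -> admissible s (M * K) (fun y => w y * psi (x - y)).
Proof.
move=> cpsi HK; apply: (admissible_bounded kg) => [|y].
  apply: measurable_funM => //.
  by apply: measurable_reflect; exact: measurable_fun_rV_continuous.
by rewrite normrM ler_pM.
Qed.

Local Notation W psi := (fun x => kint g (fun y => w y * psi (x - y))).

Lemma convolution_partial (psi : Rd -> R) : schwartz psi ->
  (forall x, differentiable (W psi) x) /\ forall i, partial i (W psi) = W (partial i psi).
Proof.
move=> sp; have [K K0 HK] := schwartz_bounds 2 sp.
pose A := d%:R * (d%:R * K).
suff H x : differentiable (W psi) x /\ forall i, partial i (W psi) x = W (partial i psi) x.
  by split=> [x|i]; [exact: (H x).1|apply/funext => x; exact: (H x).2].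
apply: (quadratic_remainder_differentiable (K := M * A * kint g (growth s))) => h.
have a0 y := convolution_admissible y (schwartz_continuous sp) (HK [::] isT).
have a1 i := convolution_admissible x (schwartz_continuous (schwartz_partial i sp)) (HK [:: i] isT).
have a1' := fun i => admissibleZ (h ord0 i) (a1 i).
have aD := admissibleD (a0 (x + h)) (admissibleZ (-1) (a0 x)).
have aS := admissible_sum (index_enum 'I_d) xpredT a1'.
have -> : kint g (fun y => w y * psi (x + h - y)) - kint g (fun y => w y * psi (x - y)) -
    \sum_i h ord0 i * kint g (fun y => w y * partial i psi (x - y)) =
    kint g (fun y => (w y * psi (x + h - y) + -1 * (w y * psi (x - y))) -
      \sum_i h ord0 i * (w y * partial i psi (x - y))).
  rewrite (kintB kg aD aS) (kintD kg (a0 (x + h)) (admissibleZ (-1) (a0 x))) (kintZ kg _ (a0 x)).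
  rewrite mulN1r (kint_sum kg _ xpredT a1'); congr (_ - _).
  by apply: eq_bigr => i _; rewrite (kintZ kg _ (a1 i)).
rewrite mulrAC.
apply: (kint_norm_le kg); apply: (admissible_bounded kg).
  exact: measurable_funB aD.1 aS.1.
move=> y; have -> : w y * psi (x + h - y) + -1 * (w y * psi (x - y)) -
      \sum_i h ord0 i * (w y * partial i psi (x - y)) =
    w y * (psi (x - y + h) - psi (x - y) - \sum_i h ord0 i * partial i psi (x - y)).
  rewrite (addrAC x) 2!mulrBr mulr_sumr mulN1r; congr (_ - _).
  by apply: eq_bigr => i _; ring.
rewrite normrM -mulrA ler_pM//.
exact: (taylor2 (sp [::]).1 (fun i => (sp [:: i]).1) (fun i j y => HK [:: j; i] isT y)).
Qed.

(** Derivatives pass to [psi]. Decay passes to the convolution because [w] lives on [|y| <= rho],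
    where [1 + |x| <= (1 + |rho|) (1 + |x - y|)]. *)
Lemma convolution_schwartz (psi : Rd -> R) : schwartz psi -> schwartz (W psi).
Proof.
move=> sp; apply/schwartzP => r.
have [chi sc ->] : exists2 chi, schwartz chi & partials r (W psi) = W chi.
  elim: r => [|i r [chi sc /= ->]]; first by exists psi.
  by exists (partial i chi); [exact: schwartz_partial|exact: (convolution_partial sc).2].
split=> [x|k]; first exact: (convolution_partial sc).1.
have [K HK] := schwartz_rapid sc k.
have [K0 HK0] := rapid_bounded (schwartz_rapid sc).
pose r1 := 1 + `|rho|; have r10 : 0 <= r1 by rewrite addr_ge0.
exists (M * (r1 ^+ k * K) * kint g (growth s)) => x.
have aw := convolution_admissible x (schwartz_continuous sc) HK0.
rewrite -[X in X * _]ger0_norm ?exprn_ge0 ?addr_ge0// -normrM -(kintZ kg _ aw).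
apply: (kint_norm_le kg); apply: (admissible_bounded kg).
  exact: (admissibleZ _ aw).1.
move=> y; have [yr|yr] := leP `|y| rho; last first.
  rewrite w0// mul0r mulr0 normr0 !mulr_ge0 ?exprn_ge0//.
  by rewrite (le_trans _ (HK 0))// mulr_ge0 ?exprn_ge0 ?addr_ge0.
rewrite mulrCA normrM ler_pM// normrM ger0_norm ?exprn_ge0 ?addr_ge0//.
apply: (@le_trans _ _ (r1 ^+ k * ((1 + `|x - y|) ^+ k * `|chi (x - y)|))); last first.
  by rewrite ler_wpM2l ?exprn_ge0.
rewrite mulrA -exprMn ler_wpM2r// lerXn2r ?nnegrE ?mulr_ge0 ?addr_ge0//.
have xy : `|x| <= `|x - y| + `|y| by rewrite -{1}(subrK y x) ler_normD.
have := ler_norm rho; have := normr_ge0 (x - y); have := normr_ge0 rho.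
rewrite /r1; move: xy yr; move: (`|x|) (`|x - y|) (`|y|) (`|rho|) => X Z Y P; nra.
Qed.

End schwartz_convolution.

(** Subtract from [u] its truncation to [[- e, e]]: the difference vanishes wherever [|u| <= e],
    hence far from the origin. *)
Lemma C0_threshold (u : C0 R d) (e : R) : 0 < e -> exists v : C0 R d, exists rho : R,
  (forall x, `|u x - v x| <= e) /\ forall x, rho < `|x| -> v x = 0.
Proof.
move=> e0; pose f x := u x - Num.max (- e) (Num.min e (u x)).
have fe x : `|u x| <= e -> f x = 0.
  rewrite ler_norml /f => /andP[h1 h2]; rewrite min_r// max_r// subrr//.
have [rho Hrho] := C0_vanishing u e0.
have cf : continuous f.
  have cu : continuous u := @C0_continuous _ _ u.
  move=> x; apply: continuousB; first exact: cu.
  apply: continuous_max; first exact: cst_continuous.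
  by apply: continuous_min; [exact: cst_continuous|exact: cu].
have f0 x : rho < `|x| -> f x = 0 by move=> /Hrho/ltW; exact: fe.
have vf : vanishing_at_infinity f.
  by move=> r r0; exists rho => x /f0 ->; rewrite normr0.
have [v Hv] := C0_exists cf vf; exists v, rho; split=> x; last by rewrite Hv; exact: f0.
rewrite Hv /f opprB addrC subrK ler_norml le_max lexx/= ge_max ge_min lexx/= andbT.
by rewrite (le_trans _ (ltW e0))// oppr_le0 ltW.
Qed.

(** Threshold to bounded support, then average against a Gaussian of width [1 / (n + 1)], normalised
    by its total mass [I1]. *)
Lemma schwartz_dense (u : C0 R d) (e : R) : 0 < e ->
  exists2 f, schwartz f & forall x, `|u x - f x| <= e.
Proof.
move=> e0; have e2 : 0 < e / 2 by rewrite divr_gt0.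
have [v [rho [uv v0]]] := C0_threshold u e2.
suff [f sf Hf] : exists2 f, schwartz f & forall x, `|v x - f x| <= e / 2.
  exists f => // x; rewrite (_ : _ - _ = (u x - v x) + (v x - f x)); last by ring.
  by rewrite (le_trans (ler_normD _ _))// [e]splitr lerD.
have [C kg] := gauss_kernel R d.
have g0 x : 0 < gauss 1 x by exact: expR_gt0.
have a1 : admissible 1 1 (fun _ : Rd => 1 : R).
  by apply: (admissible_bounded kg) => // z; rewrite normr1.
pose I1 := kint (gauss 1) (fun _ : Rd => 1 : R).
have I10 : 0 < I1.
  have h : expR (- d%:R) * (1 *+ 2) ^+ d <= conv (gauss 1) (fun _ : Rd => 1 : R) 0.
    apply: (conv_ge_cube kg (w := 0) ltr01 (cper_cst _ _)) => // z; rewrite subr0 mulr1 => z1.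
    rewrite ler_expR lerN2 mul1r.
    apply: (@le_trans _ _ (\sum_(i < d) (1 : R))); last by rewrite sumr_const card_ord.
    apply: ler_sum => i _; rewrite -real_normK ?num_real// expr_le1//.
    exact: le_trans (rV_norm_coord z i) z1.
  by apply: lt_le_trans h; rewrite mulr_gt0 ?expR_gt0// exprn_gt0.
have vle y : `|v y| <= `|v| by exact: C0_le_norm.
have mv : measurable_fun setT v by apply: measurable_fun_rV_continuous; exact: (@C0_continuous _ _ v).
have aV (n : nat) x : admissible 1 `|v| (fun z : Rd => v (x - n.+1%:R^-1 *: z)).
  apply: (admissible_bounded kg) => [|z]; last exact: vle.
  under eq_fun do rewrite -scaleNr.
  exact: (measurableT_comp mv (measurable_rV_affine x (- n.+1%:R^-1))).
pose F (n : nat) x := I1^-1 * kint (gauss 1) (fun z => v (x - n.+1%:R^-1 *: z)).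
have sF n : schwartz (F n).
  pose N : R := n.+1%:R; have N0 : 0 < N by [].
  (* In the variable [y = x - z / N] the average is a convolution of [v] with [gauss (N ^ 2)].
     Dividing [v] by [gauss 1] rewrites it as a [kint] against [gauss 1], and [w] stays bounded
     because [v] vanishes beyond [rho]. *)
  pose w y := v y / gauss 1 y.
  have cg : continuous (gauss 1 : Rd -> R) by apply/schwartz_continuous/gauss_schwartz.
  have mw : measurable_fun setT w.
    apply: measurable_fun_rV_continuous; apply: continuous_mul; first exact: (@C0_continuous _ _ v).
    by apply: continuous_inv => // y; rewrite gt_eqF.
  have wM y : `|w y| <= `|v| * expR (d%:R * rho ^+ 2).
    rewrite /w; have [yr|yr] := leP `|y| rho; last by rewrite v0// mul0r normr0 mulr_ge0 ?expR_ge0.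
    rewrite normrM ler_pM// normfV gtr0_norm// -expRN ler_expR opprK mul1r.
    apply: (@le_trans _ _ (\sum_(i < d) rho ^+ 2)); last by rewrite sumr_const card_ord mulr_natl.
    have rho0 := le_trans (normr_ge0 y) yr.
    apply: ler_sum => i _; rewrite -real_normK ?num_real// lerXn2r ?nnegrE//.
    exact: le_trans (rV_norm_coord y i) yr.
  have w0 y : rho < `|y| -> w y = 0 by move=> yr; rewrite /w v0// mul0r.
  have sW := convolution_schwartz kg mw wM w0 (@gauss_schwartz R d _ (exprn_gt0 2 N0)).
  rewrite (_ : F n = fun x => (I1^-1 * N ^+ d) * kint (gauss 1) (fun y => w y * gauss (N ^+ 2) (x - y))).
    exact: schwartzZ sW.
  apply/funext => x; rewrite /F -mulrA; congr (_ * _).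
  have nN : - N != 0 by rewrite oppr_eq0 gt_eqF.
  rewrite /kint (Rintegral_affine (N *: x) nN (ker_integrable kg (aV n x))).
  rewrite normrN gtr0_norm//; congr (_ * _); apply: eq_Rintegral => y _.
  have -> : N *: x + - N *: y = N *: (x - y) by rewrite scaleNr -scalerBr.
  rewrite -/N scalerA mulVf ?gt_eqF// scale1r subKr /w.
  have -> : gauss 1 (N *: (x - y)) = gauss (N ^+ 2) (x - y).
    rewrite /gauss mul1r mulr_sumr; congr (expR (- _)); apply: eq_bigr => i _.
    by rewrite [in LHS]mxE exprMn.
  by rewrite mulrA mulrCA mulfV ?gt_eqF// mulr1 mulrC.
suff [n Hn] : exists n, forall x, `|v x - F n x| <= e / 2 by exists (F n).
(* If no [n] worked, points [xs n] would witness the failure. At these points the shifted values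
   approach [v (xs n)] for each [z] by uniform continuity, so dominated convergence contradicts the
   gap. *)
apply: contrapT => nex.
have /choice[xs Hxs] : forall n, exists x, e / 2 < `|v x - F n x|.
  move=> n; apply: contrapT => nx; apply: nex; exists n => x; rewrite leNgt; apply/negP => h.
  by apply: nx; exists x.
have aG n : admissible 1 (`|v| + `|- v (xs n)| * 1) (fun z : Rd => v (xs n - n.+1%:R^-1 *: z) + - v (xs n) * 1).
  exact: admissibleD (aV n (xs n)) (admissibleZ (- v (xs n)) a1).
have aG' n : admissible 1 (2 * `|v|) (fun z : Rd => v (xs n - n.+1%:R^-1 *: z) + - v (xs n) * 1).
  split; first exact: (aG n).1.
  move=> z; rewrite (le_trans (ler_normD _ _))//.
  rewrite (@le_trans _ _ (2 * `|v|))//.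
    by rewrite mulr1 normrN mulr_natl mulr2n lerD.
  by rewrite ler_peMr ?mulr_ge0// (growth_ge1 kg).
have lim0 z : v (xs k - k.+1%:R^-1 *: z) + - v (xs k) * 1 @[k --> \oo] --> (0 : R).
  apply/cvgrPdist_le => r r0; have [q q0 Hq] := C0_uniformly_continuous v r0.
  near=> k; rewrite sub0r normrN mulr1 -scaleNr; apply: Hq.
  rewrite normrZ normrN ger0_norm ?invr_ge0// mulrC.
  apply: (@le_trans _ _ (`|z| * (q / (`|z| + 1)))).
    rewrite ler_wpM2l// ltW//; near: k.
    by apply: (near_infty_natSinv_lt (PosNum (divr_gt0 q0 (ltr_wpDl (normr_ge0 z) ltr01)))).
  by rewrite mulrCA ler_piMr ?(ltW q0)// ler_pdivrMr ?mul1r ?lerDl ?ltr_wpDl.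
have := kint_cvg kg aG' lim0; rewrite kint0 => /cvgrPdist_lt.
move=> /(_ _ (mulr_gt0 I10 e2))[N _ /(_ N (leqnn N))]; rewrite sub0r normrN.
rewrite (kintD kg (aV N (xs N)) (admissibleZ (- v (xs N)) a1)) (kintZ kg _ a1) -/I1.
apply/negP; rewrite -leNgt.
have -> : kint (gauss 1) (fun z => v (xs N - N.+1%:R^-1 *: z)) + - v (xs N) * I1 =
    - (I1 * (v (xs N) - F N (xs N))).
  by rewrite /F; field; rewrite gt_eqF.
by rewrite normrN normrM gtr0_norm// ler_wpM2l ?(ltW I10)// ltW.
Unshelve. all: end_near. Qed.

End mollification.

(** * Density of the range of the limit operator *)

Section quadratic_form.
Context (R : realType) (d : nat).
Local Notation Rd := 'rV[R]_d.
Implicit Types (A : 'I_d -> 'I_d -> R) (p : 'I_d -> R).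

Definition quad_form A p : R := \sum_i \sum_j p i * p j * A i j.

Lemma delta_sum i (F : 'I_d -> R) : \sum_k (k == i)%:R * F k = F i.
Proof.
rewrite (bigD1 i)//= eqxx mul1r big1 ?addr0// => k ki.
by rewrite (negPf ki) mul0r.
Qed.

Lemma quad_form_shift A p i (r : R) : (forall i j, A i j = A j i) ->
  quad_form A (fun k => p k + r * (k == i)%:R) =
  quad_form A p + 2 * r * (\sum_k p k * A i k) + r ^+ 2 * A i i.
Proof.
move=> sA; transitivity (quad_form A p + r * (\sum_k p k * A i k) +
    r * (\sum_k (k == i)%:R * \sum_l p l * A k l) +
    r ^+ 2 * \sum_k (k == i)%:R * \sum_l (l == i)%:R * A k l).
  rewrite /quad_form !mulr_sumr -!big_split/=; apply: eq_bigr => k _.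
  rewrite [r * (_ * \sum_(_ < _) _)]mulrA [r ^+ 2 * _]mulrA !mulr_sumr.
  rewrite (sA i k).
  have -> : r * (p k * A k i) = \sum_l r * (l == i)%:R * (p k * A k l).
    by rewrite -{1}(delta_sum i (fun l => p k * A k l)) mulr_sumr; apply: eq_bigr => l _; ring.
  by rewrite -!big_split/=; apply: eq_bigr => l _; ring.
by rewrite !delta_sum; ring.
Qed.

(* Lagrange reduction: subtracting the square of a row with nonzero diagonal entry
   decreases the number of nonzero diagonal entries. *)
Lemma psd_rank_one_sum A : (forall i j, A i j = A j i) -> (forall p, 0 <= quad_form A p) ->
  exists s : seq Rd, forall i j, A i j = \sum_(w <- s) w ord0 i * w ord0 j.
Proof.
have [n] := ubnP #|[pred i | A i i != 0]|; elim: n A => // n IHn A Hn sA pA.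
have form0 B : quad_form B (fun=> 0) = 0.
  by rewrite /quad_form big1// => i _; rewrite big1// => j _; rewrite !mul0r.
have diag B i : (forall i j, B i j = B j i) -> quad_form B (fun k => 0 + 1 * (k == i)%:R) = B i i.
  move=> sB; rewrite quad_form_shift// form0 big1; last by move=> k _; rewrite mul0r.
  by ring.
have [/existsP[i Aii]|nex] := boolP [exists i, A i i != 0]; last first.
  (* With a zero diagonal, the form at [e_i + r e_j] is [2 * r * A i j]; its sign for [r = 1] and
     [r = -1] forces [A i j = 0]. *)
  exists [::] => i j; rewrite big_nil.
  have A0 k : A k k = 0.
    by apply/eqP; apply: contraNT nex => h; apply/existsP; exists k.
  have H (r : R) : 0 <= 2 * r * A i j.
    have := pA (fun k => (0 + 1 * (k == i)%:R) + r * (k == j)%:R).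
    rewrite quad_form_shift// diag// !A0 mulr0 addr0 add0r.
    under eq_bigr do rewrite add0r mul1r.
    by rewrite delta_sum sA.
  by have := H 1; have := H (-1); lra.
have c0 : 0 < A i i by rewrite lt_neqAle eq_sym Aii -(diag A i sA) pA.
pose B j k := A j k - A i j * A i k / A i i.
have sB j k : B j k = B k j by rewrite /B sA; ring.
have BE p : quad_form B p = quad_form A p - (\sum_k p k * A i k) ^+ 2 / A i i.
  rewrite expr2 big_distrlr/= mulr_suml -sumrB; apply: eq_bigr => j _.
  by rewrite mulr_suml -sumrB; apply: eq_bigr => k _; rewrite /B; ring.
(* [B] is a Schur complement: its form at [p] is the form of [A] minimised over multiples of [e_i]
   added to [p], the minimiser having coefficient [- b / A i i]. *)
have pB p : 0 <= quad_form B p.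
  set b := \sum_k p k * A i k; have := pA (fun k => p k + - (b / A i i) * (k == i)%:R).
  rewrite quad_form_shift// BE -/b; congr (0 <= _); field; exact: Aii.
have Bi : B i i = 0 by rewrite /B; field.
have Bj j : A j j = 0 -> B j j = 0.
  move=> Aj; apply/eqP; rewrite eq_le -{2}(diag B j sB) pB andbT.
  by rewrite /B Aj sub0r oppr_le0 divr_ge0 ?(ltW c0)// -expr2 sqr_ge0.
have [|s Hs] := IHn B _ sB pB.
  rewrite ltnS in Hn; apply: leq_trans Hn; apply: proper_card; apply/properP; split.
    by apply/fintype.subsetP => j; rewrite !inE; apply: contraNN => /eqP /Bj ->.
  by exists i; rewrite inE// negbK Bi.
exists ((\row_k (A i k / Num.sqrt (A i i))) :: s) => j k.
rewrite big_cons -Hs ![(\row__ _) _ _]mxE /B.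
by rewrite mulrACA -invfM -expr2 sqr_sqrtr ?(ltW c0)// addrC subrK.
Qed.

End quadratic_form.

(** * Random-walk approximation of the diffusion resolvent *)

Section finite_difference.
Context (R : realType) (d : nat).
Local Notation Rd := 'rV[R]_d.
Implicit Types (f g u : Rd -> R) (r : seq 'I_d).

Lemma partials_sum (I : Type) (s : seq I) (F : I -> Rd -> R) r : (forall i, schwartz (F i)) ->
  partials r (fun x => \sum_(i <- s) F i x) = fun x => \sum_(i <- s) partials r (F i) x.
Proof.
move=> sF; elim: s => [|i s IHs].
  under eq_fun do rewrite big_nil; under [RHS]eq_fun do rewrite big_nil.
  by elim: r => //= i r ->; apply/funext => x; exact: derive_cst.
under eq_fun do rewrite big_cons; under [RHS]eq_fun do rewrite big_cons.
by rewrite partialsD//; [rewrite IHs|exact: schwartz_sum].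
Qed.

Context (ws : seq Rd) (h m : R) (h_gt0 : 0 < h) (m_gt0 : 0 < m).

(** The gain part of the generator of the walk that jumps by each [h w] and each [- h w] at rate
    [h ^ (- 2)]; [total_rate] is the corresponding loss. *)
Definition neighbour_sum u x : R :=
  h ^- 2 * \sum_(w <- ws) (u (x + h *: w) + u (x + (- h) *: w)).

Definition total_rate : R := h ^- 2 * \sum_(w <- ws) 2.

Lemma total_rate_ge0 : 0 <= total_rate.
Proof. by rewrite mulr_ge0 ?invr_ge0 ?exprn_ge0 ?(ltW h_gt0)// sumr_ge0. Qed.

Let q := total_rate.
Let mq0 : 0 < m + q. Proof. by rewrite ltr_wpDr ?total_rate_ge0. Qed.

Lemma neighbour_sum_le u (K : R) : (forall x, `|u x| <= K) ->
  forall x, `|neighbour_sum u x| <= q * K.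
Proof.
move=> uK x; rewrite /neighbour_sum /q /total_rate normrM ger0_norm ?invr_ge0 ?exprn_ge0 ?(ltW h_gt0)//.
rewrite -mulrA ler_wpM2l ?invr_ge0 ?exprn_ge0 ?(ltW h_gt0)// (le_trans (ler_norm_sum _ _ _))//.
rewrite mulr_suml; apply: ler_sum => w _.
by rewrite (le_trans (ler_normD _ _))// mulr_natl mulr2n lerD.
Qed.

Lemma neighbour_sumB u v x :
  neighbour_sum (fun y => u y - v y) x = neighbour_sum u x - neighbour_sum v x.
Proof.
rewrite /neighbour_sum -mulrBr -sumrB; congr (_ * _); apply: eq_bigr => w _; ring.
Qed.

Lemma neighbour_sum_schwartz u : schwartz u -> schwartz (neighbour_sum u) /\
  forall r, partials r (neighbour_sum u) = neighbour_sum (partials r u).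
Proof.
move=> su; have sw (w : Rd) : schwartz (fun x => u (x + h *: w) + u (x + (- h) *: w)).
  by apply: schwartzD; exact: schwartz_shift.
have ss := schwartz_sum ws sw.
split=> [|r]; first exact: schwartzZ.
rewrite partialsZ// partials_sum//; apply/funext => x; congr (_ * _); apply: eq_bigr => w _.
by rewrite partialsD ?partials_shift//; exact: schwartz_shift.
Qed.

(* Fixed point iteration for [m u - (neighbour_sum u - q u) = g]. *)
Fixpoint jump_iter g n : Rd -> R :=
  if n is n'.+1 then fun x => (m + q)^-1 * (g x + neighbour_sum (jump_iter g n') x) else fun=> 0.

Lemma jump_iter_schwartz g n : schwartz g -> schwartz (jump_iter g n) /\
  forall r, partials r (jump_iter g n) = jump_iter (partials r g) n.
Proof.
move=> sg; elim: n => [|n [sn En]].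
  split=> [|r]; first exact: schwartz0.
  by elim: r => //= i r ->; apply/funext => x; exact: derive_cst.
have [sN EN] := neighbour_sum_schwartz sn.
split=> [|r]; first by apply: schwartzZ; exact: schwartzD.
by rewrite /= partialsZ ?partialsD ?EN ?En//; exact: schwartzD.
Qed.

(** [K / m] is the fixed point of [B -> (K + q B) / (m + q)] whatever the rate [q], hence
    independent of the step [h]. *)
Lemma jump_iter_le g n (K : R) : (forall x, `|g x| <= K) -> forall x, `|jump_iter g n x| <= K / m.
Proof.
move=> gK; have K0 : 0 <= K by exact: le_trans (gK 0).
elim: n => [|n IHn] x /=; first by rewrite normr0 divr_ge0// ltW.
rewrite normrM gtr0_norm ?invr_gt0// mulrC ler_pdivrMr//.
rewrite (le_trans (ler_normD _ _))// mulrDr lerD//; first by rewrite divfK// gt_eqF.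
by rewrite mulrC; exact: neighbour_sum_le.
Qed.

(** The residual is [m + q] times the increment between consecutive iterates, and each iteration
    shrinks increments by [q / (m + q)]. *)
Lemma jump_iter_residual g n (K : R) : (forall x, `|g x| <= K) ->
  forall x, `|g x + neighbour_sum (jump_iter g n) x - (m + q) * jump_iter g n x| <=
    (q / (m + q)) ^+ n * K.
Proof.
move=> gK; have K0 : 0 <= K by exact: le_trans (gK 0).
suff H x : `|jump_iter g n.+1 x - jump_iter g n x| <= (m + q)^-1 * ((q / (m + q)) ^+ n * K).
  move=> x; have -> : g x + neighbour_sum (jump_iter g n) x - (m + q) * jump_iter g n x =
      (m + q) * (jump_iter g n.+1 x - jump_iter g n x).
    by rewrite mulrBr/= mulrA mulfV ?mul1r// gt_eqF.
  by rewrite normrM gtr0_norm// -ler_pdivlMl.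
elim: n x => [|n IHn] x.
  rewrite expr0 mul1r /= subr0 /neighbour_sum big1 => [|w _]; last by rewrite addr0.
  by rewrite mulr0 addr0 normrM gtr0_norm ?invr_gt0// ler_wpM2l// invr_ge0 ltW.
rewrite [jump_iter g n.+2]/= [X in _ - X]/= -mulrBr opprD addrACA subrr add0r -neighbour_sumB.
rewrite normrM gtr0_norm ?invr_gt0// ler_wpM2l ?invr_ge0 ?(ltW mq0)//.
have := neighbour_sum_le IHn x; congr (_ <= _); rewrite exprS; ring.
Qed.

(** Adding the expansions at [h w] and [- h w] cancels the first-order terms and doubles the
    second-order one; the cubic remainders divided by [h ^ 2] leave [O(h)]. *)
Lemma neighbour_sum_taylor u (K : R) : schwartz u ->
  (forall i j k x, `|partial k (partial j (partial i u)) x| <= K) ->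
  forall x, `|neighbour_sum u x - q * u x -
     \sum_i \sum_j (\sum_(w <- ws) w ord0 i * w ord0 j) * partial i (partial j u) x| <=
    h * (2 * (d%:R * (d%:R * (d%:R * K))) * \sum_(w <- ws) `|w| ^+ 3).
Proof.
move=> su uK x; set A := d%:R * _.
have T := taylor3 (su [::]).1 (fun i => (su [:: i]).1) (fun i j => (su [:: j; i]).1) uK x.
pose H (w : Rd) : R := \sum_i \sum_j w ord0 i * w ord0 j * partial i (partial j u) x.
have HZ (c : R) (w : Rd) : \sum_i \sum_j (c *: w) ord0 i * (c *: w) ord0 j * partial i (partial j u) x =
    c ^+ 2 * H w.
  rewrite mulr_sumr; apply: eq_bigr => i _; rewrite mulr_sumr; apply: eq_bigr => j _.
  by rewrite !mxE; ring.
have S1Z (c : R) (w : Rd) : \sum_i (c *: w) ord0 i * partial i u x = c * \sum_i w ord0 i * partial i u x.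
  by rewrite mulr_sumr; apply: eq_bigr => i _; rewrite mxE mulrA.
have hn0 : h != 0 by rewrite gt_eqF.
have -> : \sum_i \sum_j (\sum_(w <- ws) w ord0 i * w ord0 j) * partial i (partial j u) x =
    \sum_(w <- ws) H w.
  rewrite [RHS]exchange_big; apply: eq_bigr => i _ /=; rewrite [RHS]exchange_big.
  by apply: eq_bigr => j _; rewrite mulr_suml.
have -> : neighbour_sum u x - q * u x =
    h ^- 2 * \sum_(w <- ws) (u (x + h *: w) + u (x + (- h) *: w) - 2 * u x).
  by rewrite /q /total_rate -mulrA -mulrBr mulr_suml -sumrB.
have -> : h ^- 2 * \sum_(w <- ws) (u (x + h *: w) + u (x + (- h) *: w) - 2 * u x) -
    \sum_(w <- ws) H w = \sum_(w <- ws) h ^- 2 *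
      (u (x + h *: w) + u (x + (- h) *: w) - 2 * u x - h ^+ 2 * H w).
  rewrite mulr_sumr -sumrB; apply: eq_bigr => w _.
  by rewrite [in RHS]mulrBr mulrA mulVf ?mul1r// expf_neq0.
rewrite (le_trans (ler_norm_sum _ _ _))// !mulr_sumr; apply: ler_sum => w _.
have := T (h *: w); have := T ((- h) *: w); rewrite !HZ !S1Z !normrZ normrN (gtr0_norm h_gt0) sqrrN.
set D := \sum_i _ * _; set n := `|w| => T1 T2.
rewrite [`|h ^- 2|]ger0_norm ?invr_ge0 ?exprn_ge0 ?(ltW h_gt0)// mulrC ler_pdivrMr ?exprn_gt0//.
have -> : h * (2 * A * n ^+ 3) * h ^+ 2 = A * (h * n) ^+ 3 + A * (h * n) ^+ 3 by ring.
apply: le_trans (lerD T1 T2); apply: le_trans (ler_normD _ _).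
by rewrite le_eqVlt; apply/orP; left; apply/eqP; congr (`| _ |); rewrite /partials/=; field.
Qed.

End finite_difference.

(* All derivatives of the iterates are bounded by those of [g] divided by [m], uniformly
   in the step [h]; hence [h] can be chosen before the number of iterations. *)
Lemma diffusion_range_dense (R : realType) (d : nat) (Theta : 'M[R]_d) (m e : R)
  (g : 'rV[R]_d -> R) : 0 < m -> 0 < e -> (forall p : 'I_d -> R, 0 <= \sum_i \sum_j p i * p j * Theta i j) ->
  schwartz g -> exists2 u, schwartz u &
  forall x, `|g x - (m * u x - \sum_i \sum_j Theta i j * partial i (partial j u) x)| <= e.
Proof.
(* The quadratic form of [Theta] sees only its symmetric part [A], and so does its contraction with
   the Hessian, because partial derivatives commute. *)
move=> m0 e0 psd sg; pose A (i j : 'I_d) := 2^-1 * (Theta i j + Theta j i).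
have qA p : quad_form A p = \sum_i \sum_j p i * p j * Theta i j.
  have -> : quad_form A p = 2^-1 * (\sum_i \sum_j p i * p j * Theta i j +
      \sum_i \sum_j p i * p j * Theta j i).
    rewrite -big_split mulr_sumr; apply: eq_bigr => i _; rewrite -big_split mulr_sumr.
    by apply: eq_bigr => j _; rewrite /A/=; ring.
  rewrite [X in _ + X]exchange_big/=.
  under [X in _ + X]eq_bigr do under eq_bigr do rewrite (mulrC (p _) (p _)).
  by field.
have [ws Hws] : exists s : seq 'rV[R]_d, forall i j, A i j = \sum_(w <- s) w ord0 i * w ord0 j.
  by apply: psd_rank_one_sum => [i j|p]; [rewrite /A addrC|rewrite qA].
have [K K0 HK] := schwartz_bounds 3 sg.
pose c := 2 * (d%:R * (d%:R * (d%:R * (K / m)))) * \sum_(w <- ws) `|w| ^+ 3.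
have c0 : 0 <= c.
  by rewrite mulr_ge0//; [rewrite !mulr_ge0// invr_ge0 ltW|rewrite sumr_ge0// => w _; rewrite exprn_ge0].
have c1 : 0 < 2 * (c + 1) by lra.
pose h := e / (2 * (c + 1)); have h0 : 0 < h by exact: divr_gt0.
have hc : h * c <= e / 2.
  have -> : h * c = c / (c + 1) * (e / 2) by rewrite /h; field; lra.
  by rewrite ler_piMl ?divr_ge0 ?(ltW e0)// ler_pdivrMr ?mul1r; lra.
pose q := total_rate ws h; have q0 : 0 <= q := total_rate_ge0 ws h0.
pose th := q / (m + q); have mq0 : 0 < m + q by rewrite ltr_wpDr.
have th0 : 0 <= th by rewrite divr_ge0// ltW.
have th1 : `|th| < 1 by rewrite ger0_norm// ltr_pdivrMr// mul1r ltrDr.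
have [n Hn] : exists n, th ^+ n * K <= e / 2.
  have K1 : 0 < K + 1 by rewrite ltr_wpDl.
  have eK : 0 < e / 2 / (K + 1) by rewrite !divr_gt0.
  have /cvgrPdist_le/(_ _ eK)[n _ /(_ n (leqnn n))] := cvg_expr th1; rewrite sub0r normrN normrX ger0_norm// ler_pdivlMr// => hn.
  by exists n; apply: le_trans hn; rewrite ler_wpM2l ?exprn_ge0// lerDl.
have [su Eu] := jump_iter_schwartz ws h m n sg.
set u := jump_iter ws h m g n in su Eu.
have uK i j k x : `|partial k (partial j (partial i u)) x| <= K / m.
  rewrite -[partial k _]/(partials [:: k; j; i] u) Eu; apply: jump_iter_le => // y.
  exact: HK.
exists u => // x.
have -> : \sum_i \sum_j Theta i j * partial i (partial j u) x =
    \sum_i \sum_j (\sum_(w <- ws) w ord0 i * w ord0 j) * partial i (partial j u) x.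
  transitivity (\sum_i \sum_j A i j * partial i (partial j u) x); last first.
    by apply: eq_bigr => i _; apply: eq_bigr => j _; rewrite Hws.
  have E : \sum_i \sum_j Theta i j * partial i (partial j u) x =
      \sum_i \sum_j Theta j i * partial i (partial j u) x.
    by rewrite exchange_big; apply: eq_bigr => i _; apply: eq_bigr => j _; rewrite partial_comm.
  transitivity (2^-1 * (\sum_i \sum_j Theta i j * partial i (partial j u) x +
      \sum_i \sum_j Theta j i * partial i (partial j u) x)); first by rewrite -E; field.
  rewrite -big_split mulr_sumr; apply: eq_bigr => i _; rewrite -big_split mulr_sumr.
  by apply: eq_bigr => j _; rewrite /A/=; ring.
have h1 := jump_iter_residual ws h0 m0 n (HK [::] isT) x.
have h2 := neighbour_sum_taylor ws h0 su uK x.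
rewrite -/q -/th -/u in h1; rewrite -/q -/c in h2.
set D := \sum_i _ in h2 *.
have -> : g x - (m * u x - D) = (g x + neighbour_sum ws h u x - (m + q) * u x) -
    (neighbour_sum ws h u x - q * u x - D) by ring.
by rewrite (le_trans (ler_normB _ _))// [e]splitr lerD// ?(le_trans h1)// (le_trans h2).
Qed.

(** * Convergence of resolvents *)

Section trotter_kato.
Context (R : realType) (E : completeNormedModType R).
Context (L : R -> set (E * E)) (D : set (E * E)).
Context (L_dissipative : forall eps : R, 0 < eps -> dissipative (L eps)).
Context (L_sub : forall eps : R, 0 < eps -> sub_closed (L eps)).
Context (L_resolvent : forall eps m : R, 0 < eps -> 0 < m -> in_resolvent_set (L eps) m).
Context (D_sub : sub_closed D).
Context (D_approx : forall u h (eta : R), D (u, h) -> 0 < eta -> exists2 r : R, 0 < r &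
  forall eps : R, 0 < eps <= r -> exists u' h', [/\ L eps (u', h'), `|u' - u| <= eta & `|h' - h| <= eta]).
Context (D_range : forall (m : R) f (eta : R), 0 < m -> 0 < eta ->
  exists u h, D (u, h) /\ `|f - (h - m *: u)| <= eta).

Lemma closure_distP (u h : E) : closure D (u, h) <->
  forall eta, 0 < eta -> exists u' h', [/\ D (u', h'), `|u' - u| <= eta & `|h' - h| <= eta].
Proof.
split=> [cD eta e0|H B].
  have [|[u' h'] [Duh [/= b1 b2]]] := cD (ball u eta `*` ball h eta).
    by exists (ball u eta, ball h eta) => //=; split; exact: nbhsx_ballx.
  by exists u', h'; rewrite -!ball_normE/= in b1 b2; split=> //; rewrite distrC ltW.
move=> [[B1 B2] /= [/nbhs_ballP[r1 r10 b1] /nbhs_ballP[r2 r20 b2]] sB]; rewrite /= in r10 r20.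
have r0 : 0 < Num.min r1 r2 / 2 by rewrite divr_gt0// lt_min r10.
have [u' [h' [Duh h1 h2]]] := H _ r0.
have lt2 : Num.min r1 r2 / 2 < Num.min r1 r2 by rewrite ltr_pdivrMr// ltr_pMr ?ltr1n// lt_min r10.
exists (u', h'); split=> //; apply: sB; split=> /=.
  by apply: b1; rewrite -ball_normE/= distrC (le_lt_trans h1)// (lt_le_trans lt2)// ge_min lexx.
by apply: b2; rewrite -ball_normE/= distrC (le_lt_trans h2)// (lt_le_trans lt2)// ge_min lexx orbT.
Qed.

Lemma closure_approx u h (eta : R) : closure D (u, h) -> 0 < eta -> exists2 r : R, 0 < r &
  forall eps : R, 0 < eps <= r -> exists u' h', [/\ L eps (u', h'), `|u' - u| <= eta & `|h' - h| <= eta].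
Proof.
move=> /closure_distP cD e0; have e2 : 0 < eta / 2 by rewrite divr_gt0.
have [v [k [Dvk h1 h2]]] := cD _ e2; have [r r0 Hr] := D_approx Dvk e2.
exists r => // eps /Hr[u' [h' [Luh h3 h4]]]; exists u', h'; split=> //.
  by rewrite -(subrK v u') -addrA (le_trans (ler_normD _ _))// [eta]splitr lerD.
by rewrite -(subrK k h') -addrA (le_trans (ler_normD _ _))// [eta]splitr lerD.
Qed.

Lemma closure_dissipative : dissipative (closure D).
Proof.
move=> m u h m0 cD; apply/ler_addgt0Pr => e e0.
(* Replacing [(u, h)] by an approximant at distance [eta] costs [m * eta] on the left, and
   [eta + m * eta] on the right. *)
have mm : 0 < 2 * m + 1 by lra.
have [r r0 Hr] := closure_approx cD (divr_gt0 e0 mm).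
have [|u' [h' [Luh h1 h2]]] := Hr r; first by rewrite r0 lexx.
have := L_dissipative r0 m0 Luh; set eta := e / _ in h1 h2 => H.
have H1 : `|u| <= `|u'| + eta.
  by rewrite -{1}(subrK u' u) addrC (le_trans (ler_normD _ _))// lerD2l distrC.
have H2 : `|h' - m *: u'| <= `|h - m *: u| + (eta + m * eta).
  have -> : h' - m *: u' = (h - m *: u) + ((h' - h) - m *: (u' - u)).
    by rewrite scalerBr opprB addrACA [h + _]addrC subrK addKr.
  rewrite (le_trans (ler_normD _ _))// lerD2l (le_trans (ler_normB _ _))// lerD//.
  by rewrite normrZ gtr0_norm// ler_wpM2l// ltW.
have : m * `|u| <= m * (`|u'| + eta) by rewrite ler_wpM2l// ltW.
have -> : e = (2 * m + 1) * eta by rewrite /eta mulrC divfK// gt_eqF.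
by rewrite mulrDr; lra.
Qed.

Lemma closure_sub_closed : sub_closed (closure D).
Proof.
move=> u v h k /closure_distP cu /closure_distP cv; apply/closure_distP => e e0.
have e2 : 0 < e / 2 by rewrite divr_gt0.
have [u' [h' [D1 h1 h2]]] := cu _ e2; have [v' [k' [D2 h3 h4]]] := cv _ e2.
exists (u' - v'), (h' - k'); split; first exact: D_sub.
  rewrite (_ : _ - _ = (u' - u) - (v' - v)); last by rewrite !opprD addrACA.
  by rewrite (le_trans (ler_normB _ _))// [e]splitr lerD.
rewrite (_ : _ - _ = (h' - h) - (k' - k)); last by rewrite !opprD addrACA.
by rewrite (le_trans (ler_normB _ _))// [e]splitr lerD.
Qed.

(** Approximate solutions taken from [D] form a Cauchy sequence by dissipativity applied to their
    differences; their limit solves the equation because the graph is closed. *)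
Lemma closure_resolvent_set (m : R) : 0 < m -> in_resolvent_set (closure D) m.
Proof.
move=> m0; apply: resolvent_set_dissipative => //.
- exact: closure_dissipative.
- exact: closure_sub_closed.
move=> f; have H n : exists p : E * E, D p /\ `|f - (p.2 - m *: p.1)| <= n.+1%:R^-1.
  have i0 : 0 < n.+1%:R^-1 :> R by rewrite invr_gt0.
  by have [u [h [Duh fuh]]] := D_range f m0 i0; exists (u, h).
have [p Hp] := choice H; pose u n := (p n).1; pose h n := (p n).2.
have dist n k : `|u n - u k| <= m^-1 * (n.+1%:R^-1 + k.+1%:R^-1).
  have cD : closure D (u n - u k, h n - h k).
    by apply: subset_closure; apply: D_sub; rewrite -surjective_pairing; exact: (Hp _).1.
  have := closure_dissipative m0 cD; rewrite ler_pdivlMl// => /le_trans; apply.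
  rewrite (_ : _ - _ = (f - (h k - m *: u k)) - (f - (h n - m *: u n))); last first.
    by rewrite [RHS]addrC opprB addrA subrK scalerBr !opprD addrACA.
  by rewrite (le_trans (ler_normB _ _))// addrC lerD//; exact: (Hp _).2.
have small (e : R) : 0 < e -> exists N, forall n, (N <= n)%N -> n.+1%:R^-1 <= e.
  move=> e0; have [N _ HN] := near_infty_natSinv_lt (PosNum e0).
  by exists N => n /HN /ltW.
have cu : cvg (u n @[n --> \oo]).
  apply: cauchy_cvg; apply: cauchy_exP => e e0.
  have e3 : 0 < m * e / 3 by rewrite divr_gt0// mulr_gt0.
  have [N HN] := small _ e3.
  exists (u N); exists N => // n /= Nn; rewrite -ball_normE/= (le_lt_trans (dist N n))//.
  rewrite mulrC ltr_pdivrMr// mulrC; have := HN _ Nn; have := HN _ (leqnn N).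
  have : 0 < m * e by exact: mulr_gt0.
  by move: (N.+1%:R^-1) (n.+1%:R^-1) (m * e) => A B c; lra.
exists (lim (u n @[n --> \oo])); rewrite shift_opE; apply/closure_distP => e e0.
set ul := lim _; have m1 : 0 < 1 + m by lra.
pose e1 := e / (2 * (1 + m)); have e10 : 0 < e1 by rewrite divr_gt0// mulr_gt0.
have [N HN] := small _ e10.
have /cvgrPdist_le/(_ _ e10)[N' _ HN'] := cu.
pose n := maxn N N'; have b1 := HN _ (leq_maxl N N'); have b2 := HN' _ (leq_maxr N N').
rewrite -/n in b1 b2; have ee : (1 + m) * e1 = e / 2 by rewrite /e1; field; lra.
exists (u n), (h n); split.
- by have := (Hp n).1; rewrite [p n]surjective_pairing.
- by rewrite distrC (le_trans b2)//; nra.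
rewrite (_ : h n - _ = - (f - (h n - m *: u n)) - m *: (ul - u n)); last first.
  by rewrite scalerBr !opprB addrACA subrK -opprD.
rewrite (le_trans (ler_normB _ _))// normrN normrZ gtr0_norm//.
have := le_trans (Hp n).2 b1; have : m * `|ul - u n| <= m * e1 by rewrite ler_wpM2l// ltW.
rewrite -/(h n) -/(u n); nra.
Qed.

(** Choose [(u, h)] in [D] with [h - m *: u] close to [f], and approximants in the graph of [L eps].
    By [resolvent_dist] both resolvents of [f] are then close to [u]. *)
Lemma resolvent_convergence (m : R) f : 0 < m ->
  `|resolvent (L eps) m f - resolvent (closure D) m f| @[eps --> 0^'+] --> (0 : R).
Proof.
move=> m0; apply/cvgrPdist_le => e e0.
(* After multiplication by [m] the errors add up to [(3 + 2 m) * eta], which is [m * e] for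
   [eta = e / (3 / m + 2)]. *)
have c0 : 0 < 3 / m + 2 by have := divr_gt0 (ltr0Sn R 2) m0; lra.
pose eta := e / (3 / m + 2); have eta0 : 0 < eta by exact: divr_gt0.
have [u [h [Duh fuh]]] := D_range f m0 eta0.
have [r r0 Hr] := D_approx Duh eta0.
have d0 := resolvent_dist f m0 closure_dissipative closure_sub_closed (closure_resolvent_set m0)
  (subset_closure Duh).
near=> eps; have eps0 : 0 < eps by [].
have [|u' [h' [Luh h1 h2]]] := Hr eps; first by rewrite eps0; near: eps; exact: nbhs_right_le.
have d1 := resolvent_dist f m0 (L_dissipative eps0) (L_sub eps0) (L_resolvent eps0 m0) Luh.
rewrite sub0r normrN normr_id.
set a := resolvent _ m f in d1 *; set b := resolvent _ m f in d0 *.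
have {}d1 : m * `|a - u'| <= 2 * eta + m * eta.
  rewrite (le_trans d1)// (_ : f - _ = (f - (h - m *: u)) - ((h' - h) - m *: (u' - u))).
    rewrite (_ : 2 * eta + m * eta = eta + (eta + m * eta)); last by ring.
    rewrite (le_trans (ler_normB _ _))// lerD//.
    by rewrite (le_trans (ler_normB _ _))// lerD// normrZ gtr0_norm// ler_wpM2l// ltW.
  rewrite -[RHS]addrA -opprD; congr (f - _).
  by rewrite scalerBr (opprB (m *: u')) addrACA [h + _]addrC subrK addKr.
have {}d0 : m * `|b - u| <= eta by exact: le_trans d0 fuh.
have : `|a - b| <= `|a - u'| + `|u' - u| + `|b - u|.
  rewrite (_ : a - b = (a - u') + (u' - u) - (b - u)); last by rewrite addrA subrK opprB addrA subrK.
  by rewrite (le_trans (ler_normB _ _))// lerD2r ler_normD.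
move=> /le_trans; apply; rewrite -(ler_pM2l m0) !mulrDr.
have -> : m * e = 2 * eta + m * eta + m * eta + eta by rewrite /eta; field; rewrite !gt_eqF//=; nra.
by rewrite lerD// lerD// ler_wpM2l// ltW.
Unshelve. all: end_near. Qed.

End trotter_kato.

(** * Verification of the hypotheses and conclusion *)

Lemma power_decay_kernel (R : realType) (d : nat) (a : 'rV[R]_d -> R) (C delta : R) :
  continuous a -> (forall x, a x = a (- x)) -> (forall x, 0 <= a x) -> 2 < delta ->
  (forall x, a x <= C / (1 + enorm x `^ (d%:R + delta))) ->
  exists s t C', decaying_kernel a s t C'.
Proof.
(* The surplus [delta - 2] is shared between [s], the moment beyond the second, and [t], the
   integrability of the weight: [(2 + s) + (d + t) <= d + delta]. Passing from [1 + enorm z ^ p] to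
   [(1 + |z|) ^ p] costs the factor [2 ^ p]. *)
move=> ca ea a0 d2 aC; pose p := d%:R + delta; pose t := (delta - 2) / 2.
have t0 : 0 < t by rewrite divr_gt0// subr_gt0.
have p0 : 0 <= p by rewrite addr_ge0//; lra.
pose s := Num.min 1 t; have s0 : 0 < s by rewrite lt_min ltr01.
have st : s + t <= delta - 2.
  have : s <= t by rewrite ge_min lexx orbT.
  by rewrite /t; lra.
have den0 (x : 'rV[R]_d) : 0 < 1 + enorm x `^ p by rewrite ltr_wpDr ?powR_ge0.
have C0 : 0 <= C by have := le_trans (a0 0) (aC 0); rewrite pmulr_lge0// invr_gt0 den0.
exists s, t, (C * 2 `^ p); split=> //; first by rewrite s0 ge_min lexx.
move=> z; have z1 : 1 <= 1 + `|z| by rewrite lerDl.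
have z0 : 0 < 1 + `|z| by rewrite ltr_pwDl.
have den : (1 + `|z|) `^ p <= 2 `^ p * (1 + enorm z `^ p).
  have [z2|z2] := leP `|z| 1.
    apply: (@le_trans _ _ (2 `^ p)); last by rewrite ler_peMr ?powR_ge0// lerDl powR_ge0.
    by apply: ge0_ler_powR; rewrite ?nnegrE ?(ltW z0)//; lra.
  apply: (@le_trans _ _ ((2 * enorm z) `^ p)).
    apply: ge0_ler_powR; rewrite ?nnegrE ?(ltW z0) ?mulr_ge0 ?sqrtr_ge0//.
    by have := norm_le_enorm z; lra.
  by rewrite powRM ?sqrtr_ge0// ler_wpM2l ?powR_ge0// lerDr.
have az : a z <= C * 2 `^ p * (1 + `|z|) `^ (- p).
  rewrite (le_trans (aC z))// -mulrA ler_wpM2l// powRN ler_pdivlMr ?powR_gt0//.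
  by rewrite mulrC ler_pdivrMr.
have -> : growth s z = (1 + `|z|) `^ (2 + s).
  by rewrite /growth powRD ?(gt_eqF z0) ?implybT// -powR_mulrn ?(ltW z0).
apply: (le_trans (ler_wpM2r (powR_ge0 _ _) az)); rewrite -[leLHS]mulrA.
apply: ler_wpM2l; first by rewrite mulr_ge0 ?powR_ge0.
rewrite /weight -powRD ?(gt_eqF z0) ?implybT//; apply: ler_powR => //.
by move: st; rewrite /p; lra.
Qed.

Lemma L0_core_sub_closed (R : realType) (d : nat) (Theta : 'M[R]_d) : sub_closed (L0_core Theta).
Proof.
move=> u v h k [/= su Hh] [/= sv Hk].
have E : (u - v : C0 R d) = (fun x => u x + -1 * v x) :> ('rV[R]_d -> R).
  by apply/funext => x; rewrite C0_subE mulN1r.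
have sZ := schwartzZ (-1) sv.
have [s1 s2] : schwartz (fun x => u x + -1 * v x) /\ forall x, h x - k x =
    \sum_i \sum_j Theta i j * partial i (partial j (fun x => u x + -1 * v x)) x.
  split=> [|x]; first exact: schwartzD.
  rewrite Hh Hk -sumrB; apply: eq_bigr => i _; rewrite -sumrB; apply: eq_bigr => j _.
  have /(congr1 (@^~ x)) /= -> := partialsD [:: i; j] su sZ.
  have /(congr1 (@^~ x)) /= -> := partialsZ [:: i; j] (-1) sv.
  by rewrite mulN1r mulrBr.
by rewrite -E in s1 s2; split.
Qed.

Lemma L0_core_range_dense (R : realType) (d : nat) (Theta : 'M[R]_d) (m : R) (f : C0 R d) (eta : R) :
  (forall p : 'I_d -> R, 0 <= \sum_i \sum_j p i * p j * Theta i j) -> 0 < m -> 0 < eta ->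
  exists u h, L0_core Theta (u, h) /\ `|f - (h - m *: u)| <= eta.
Proof.
move=> psd m0 e0; have e2 : 0 < eta / 2 by rewrite divr_gt0.
(* The sign changes because [diffusion_range_dense] solves [m u - L^0 u = g], while the shifted
   operator here is [L^0 - m]. *)
have [g sg fg] := schwartz_dense (- f) e2.
have [v sv Hv] := diffusion_range_dense m0 e2 psd sg.
have [u Hu] := schwartz_C0 sv; have uv : u = v :> ('rV[R]_d -> R) by apply/funext.
have sh : schwartz (fun x => \sum_i \sum_j Theta i j * partial i (partial j v) x).
  apply: schwartz_sum => i; apply: schwartz_sum => j; apply: schwartzZ.
  exact/schwartz_partial/schwartz_partial.
have [h Hh] := schwartz_C0 sh; exists u, h; split.
  by split=> [|x] /=; rewrite uv.
apply: C0_norm_leP => x; rewrite !(C0_subE, C0_scaleE) Hu Hh.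
set D := \sum_i _; have -> : f x - (D - m * v x) = - (((- f) x - g x) + (g x - (m * v x - D))).
  by rewrite C0_oppE; ring.
by rewrite normrN (le_trans (ler_normD _ _))// [eta]splitr lerD.
Qed.

(** The first two conjuncts give the third its meaning: [resolvent] takes the default value 0
    wherever the shifted equation has no solution. *)
Theorem proposition5p2 (R : realType) (d : nat)
    (a lam mu : 'rV[R]_d -> R) (C delta alpha1 alpha2 : R)
    (kappa : 'I_d -> 'rV[R]_d -> R) (Theta : 'M[R]_d)
    (d_ge1 : (1 <= d)%N)
    (a_cont : continuous a)
    (a_even : forall x, a x = a (- x))
    (a_ge0 : forall x, 0 <= a x)
    (a_int : 0 < \int[lebesgue_rV R d]_x a x)
    (delta_gt2 : 2 < delta)
    (a_decay : forall x, a x <= C / (1 + enorm x `^ (d%:R + delta)))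
    (lam_cont : continuous lam) (lam_per : Zd_periodic lam)
    (mu_cont : continuous mu) (mu_per : Zd_periodic mu)
    (alpha1_gt0 : 0 < alpha1)
    (lam_bnd : forall x, alpha1 <= lam x <= alpha2)
    (mu_bnd : forall x, alpha1 <= mu x <= alpha2)
    (kappaP : is_corrector a mu kappa)
    (ThetaP : is_effective_matrix a lam mu kappa Theta)
    (m : R) (m_gt0 : 0 < m) :
  [/\ forall eps : R, 0 < eps -> in_resolvent_set (L_eps a lam mu eps) m,
      in_resolvent_set (L0 Theta) m &
      forall f : C0 R d,
        `|resolvent (L_eps a lam mu eps) m f - resolvent (L0 Theta) m f|
          @[eps --> 0^'+] --> (0 : R)].
Proof.
have [s [t [C' ka]]] := power_decay_kernel a_cont a_even a_ge0 delta_gt2 a_decay.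
have lam_cper : cper lam by split.
have mu_cper : cper mu by split.
have [k1 [k1_cper k1_eq chi_ex]] :=
  correctors_exist ka a_int lam_cper mu_cper alpha1_gt0 lam_bnd mu_bnd kappaP ThetaP.
have psd := effective_matrix_psd ka mu_cper alpha1_gt0 lam_bnd mu_bnd k1_cper k1_eq chi_ex.
have approx (u h : C0 R d) (eta : R) : L0_core Theta (u, h) -> 0 < eta ->
    exists2 r : R, 0 < r & forall eps : R, 0 < eps <= r -> exists u' h' : C0 R d,
      [/\ L_eps a lam mu eps (u', h'), `|u' - u| <= eta & `|h' - h| <= eta].
  move=> [/= su Hh] eta0.
  have [r r0 Hr] := core_approximation ka a_int lam_cper mu_cper alpha1_gt0 lam_bnd mu_bnd
    k1_cper k1_eq chi_ex su eta0.
  exists r => // eps /Hr[u' [h' [Luh Hu' Hh']]]; exists u', h'; split=> //.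
    by apply: C0_norm_leP => x; rewrite C0_subE.
  by apply: C0_norm_leP => x; rewrite C0_subE Hh.
have Ld eps (eps0 : 0 < eps) :=
  L_eps_dissipative ka a_int mu_cper alpha1_gt0 lam_bnd mu_bnd eps0.
have Ls eps (eps0 : 0 < eps) : sub_closed (L_eps a lam mu eps) :=
  L_eps_sub_closed ka mu_cper alpha1_gt0 mu_bnd eps0.
have Lr eps q (eps0 : 0 < eps) (q0 : 0 < q) : in_resolvent_set (L_eps a lam mu eps) q :=
  L_eps_resolvent_set ka a_int lam_cper mu_cper alpha1_gt0 lam_bnd mu_bnd eps0 q0.
have Ds := @L0_core_sub_closed R d Theta.
have Dr q f eta := @L0_core_range_dense R d Theta q f eta psd.
split=> [eps eps0||f].
- exact: Lr.
- exact: (closure_resolvent_set Ld Ds approx Dr m_gt0).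
- exact: (resolvent_convergence Ld Ls Lr Ds approx Dr f m_gt0).
Qed.
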